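(* Let $H$ be a Hopf algebroid over $B$ and let $\Gamma$ be an invertible 2-cocycle on $H$. Then ${}_\Gamma H$ is an $H^\Gamma$-$H$-biGalois extension which is both left cleft (over $H^\Gamma$) and right anti-cleft (over $H$). Moreover, $\Gamma^{-1}$ is a 2-cocycle on $H^\Gamma$, with $(H^\Gamma)^{\Gamma^{-1}}=H$.
   Context: Let $k$ be a field, $B$ a unital $k$-algebra, $\overline B$ its opposite algebra, $b\mapsto\bar b$ the canonical anti-isomorphism $B\to\overline B$, $B^e=B\otimes\overline B$. $\otimes_B,\otimes_{\overline B}$ are the usual balanced tensor products; $M\diamond_BN=M\otimes N/\langle\bar bm\otimes n-m\otimes bn\rangle$. The Takeuchi product $M\times_BN\subseteq M\diamond_BN$ consists of the $\sum m_i\otimes n_i$ with $\sum m_i\bar a\otimes n_i=\sum m_i\otimes n_ia$ for all $a\in B$. A left bialgebroid over $B$ is an algebra $H$ with algebra maps $s:B\to H$, $t:\overline B\to H$ with commuting images (one writes $b,\bar b$ for $s(b),t(\bar b)$ in products), a coassociative algebra map $\Delta:H\to H\times_BH$, $X\mapsto X_{(1)}\otimes X_{(2)}$, with $\Delta(b\bar cX)=bX_{(1)}\otimes\bar cX_{(2)}$, and $\varepsilon:H\to B$ with $\varepsilon(b\bar cX)=b\varepsilon(X)c$, $\varepsilon(X_{(1)})X_{(2)}=X=\overline{\varepsilon(X_{(2)})}X_{(1)}$, $\varepsilon(1)=1$, $\varepsilon(X\varepsilon(Y))=\varepsilon(XY)=\varepsilon(X\overline{\varepsilon(Y)})$. It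 is a Hopf algebroid if $\lambda:H\otimes_{\overline B}H\to H\diamond_BH$, $X\otimes Y\mapsto X_{(1)}\otimes X_{(2)}Y$ and $\mu:H\otimes_BH\to H\diamond_BH$, $X\otimes Y\mapsto X_{(1)}Y\otimes X_{(2)}$ are bijective; write $X_+\otimes X_-=\lambda^{-1}(X\otimes1)$, $X_{[+]}\otimes X_{[-]}=\mu^{-1}(1\otimes X)$. An (invertible) 2-cocycle on $H$ is a map $\Gamma:H\otimes_{\overline B}H\to B$ with $\Gamma(b\bar cX,Y)=b\Gamma(X,Y)c$, $\Gamma(X,\Gamma(Y_{(1)},Z_{(1)})Y_{(2)}Z_{(2)})=\Gamma(\Gamma(X_{(1)},Y_{(1)})X_{(2)}Y_{(2)},Z)$, $\Gamma(1,X)=\varepsilon(X)=\Gamma(X,1)$ (and such that there is $\Gamma^{-1}:H\otimes_BH\to B$ with $\Gamma^{-1}(b\bar cX,Y)=b\Gamma^{-1}(X,Y)c$, $\Gamma^{-1}(X,\bar bY)=\Gamma^{-1}(X_{(1)},Y)\Gamma^{-1}(X_{(2)},\bar b)$, $\Gamma(X_{(1)},Y_{(1)})\Gamma^{-1}(X_{(2)},Y_{(2)})=\Gamma(X,\varepsilon(Y))$, $\Gamma^{-1}(X_{(1)},Y_{(1)})\Gamma(X_{(2)},Y_{(2)})=\varepsilon(XY)$). $H^\Gamma$ is $H$ with the same source, target, coproduct and counit and product $X\cdot_\Gamma Y=\Gamma(X_{(1)},Y_{(1)})\overline{\Gamma^{-1}(X_{(3)},Y_{(3)})}X_{(2)}Y_{(2)}$;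 it is a Hopf algebroid over $B$. ${}_\Gamma H$ is the space $H$ with product $X\cdot Y=\Gamma(X_{(1)},Y_{(1)})X_{(2)}Y_{(2)}$, right $H$-coaction $\Delta$ and left $H^\Gamma$-coaction $\Delta$, with $B$ and $\overline B$ mapping to it by $s,t$. A left comodule over $H$ is a left $B$-module $V$ with coassociative counital coaction $v\mapsto v_{(-1)}\otimes v_{(0)}\in H\diamond_BV$, $bv\mapsto bv_{(-1)}\otimes v_{(0)}$ (a $B$-bimodule by $vb=\varepsilon(v_{(-1)}b)v_{(0)}$); a right comodule is a left $\overline B$-module $P$ with coaction $p\mapsto p_{(0)}\otimes p_{(1)}\in P\diamond_BH$, $\bar bp\mapsto p_{(0)}\otimes\bar bp_{(1)}$ (a $\overline B$-bimodule by $p\bar b=\overline{\varepsilon(p_{(1)}b)}p_{(0)}$). Left (right) comodule algebras are $B$-rings ($\overline B$-rings) with comodule structure such that the coaction into the Takeuchi product is a ring map over $B$ ($\overline B$). Left/right coinvariants: $p_{(-1)}\otimes p_{(0)}=1\otimes p$, resp. $p_{(0)}\otimes p_{(1)}=p\otimes1$. A left comodule is reversible if $V\otimes_BH\to H\diamond_BV$, $v\otimes X\mapsto v_{(-1)}X\otimes v_{(0)}$ is bijective; a right comodule is reversible if $P\otimes_{\overline B}H\to P\diamond_BH$, $p\otimes X\mapsto p_{(0)}\otimes p_{(1)}X$ is bijective. For Hopf algebroids $L,H$ over $B$, an $L$-$H$-biGalois extension is an $L$-$H$-bicomodule algebra $P$ with ${}^{\mathrm{co}L}P=\overline B$, $P^{\mathrm{co}H}=B$,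 and bijective canonical maps $P\otimes_{\overline B}P\to L\diamond_BP$, $p\otimes q\mapsto p_{(-1)}\otimes p_{(0)}q$ and $P\otimes_BP\to P\diamond_BH$, $p\otimes q\mapsto p_{(0)}q\otimes p_{(1)}$. Right anti-cleft: a reversible right $H$-comodule algebra $P$ with $B$ a subalgebra of $P^{\mathrm{co}H}$ and a right colinear, left $B$-linear $\tilde\rho:H\to P$ for which there is a left $\overline B$-linear, right $B$-linear $\rho:H\to P$ with $\tilde\rho(X_+)\rho(X_-)=\varepsilon(X)1$, $\rho(X_{[+]})\tilde\rho(X_{[-]})=\overline{\varepsilon(X)}1$. Left cleft over $L$: a reversible left $L$-comodule algebra $P$ with $\overline B$ a subalgebra of ${}^{\mathrm{co}L}P$ and a left colinear, left $\overline B$-linear $\tilde\gamma:L\to P$ for which there is a left $B$-linear, right $\overline B$-linear $\gamma:L\to P$ with $\gamma(X_+)\tilde\gamma(X_-)=\varepsilon(X)1$, $\tilde\gamma(X_{[+]})\gamma(X_{[-]})=\overline{\varepsilon(X)}1$ (translation maps of $L$). *)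

(* Defs.v *)
From HB Require Import structures.
From mathcomp Require Import all_boot all_algebra generic_quotient ring_quotient.
From mathcomp Require Import boolp classical_sets.
From mathcomp Require finmap monalg.

Set Implicit Arguments.
Unset Strict Implicit.
Unset Printing Implicit Defensive.

Import GRing.Theory.
Local Open Scope ring_scope.

(* [tens r l] is the free abelian group on M x N modulo biadditivity and
   r b m (x) n = m (x) l b n for b : B.  All the tensor products used below
   (over B, over the opposite of B, and the product written with a diamond)
   are of this form for suitable actions r and l.  Since k acts through B,
   balancing over B already makes the quotient k-balanced. *)
Module Tensor.
Import finmap monalg Quotient.
Local Open Scope quotient_scope.

Section Tensor.
Variables (B : Type) (M N : zmodType) (r : B -> M -> M) (l : B -> N -> N).

Definition tfree : zmodType := {malg int[(M * N)%type]}.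

Definition trel (x : tfree) : bool :=
  `[< forall S : {pred tfree}, zmod_closed S ->
        (forall m m' n, << (m + m', n) >> - << (m, n) >> - << (m', n) >> \in S) ->
        (forall m n n', << (m, n + n') >> - << (m, n) >> - << (m, n') >> \in S) ->
        (forall b m n, << (r b m, n) >> - << (m, l b n) >> \in S) ->
        x \in S >].

Lemma trel_zmod_closed : zmod_closed trel.
Proof.
split=> [|x y /asboolP xS /asboolP yS]; apply/asboolP=> S cS h1 h2 h3.
  exact: cS.1.
by apply: cS.2; [exact: xS | exact: yS].
Qed.

HB.instance Definition _ :=
  GRing.isZmodClosed.Build tfree trel trel_zmod_closed.

Definition tens : Type := {quot (GRing.ZmodClosed.clone tfree trel _)}.
HB.instance Definition _ := GRing.Zmodule.on tens.

Definition tpure (m : M) (n : N) : tens := \pi_tens (<< (m, n) >> : tfree).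

Let pi_eq (x y : tfree) :
  (forall S : {pred tfree}, zmod_closed S ->
     (forall m m' n, << (m + m', n) >> - << (m, n) >> - << (m', n) >> \in S) ->
     (forall m n n', << (m, n + n') >> - << (m, n) >> - << (m, n') >> \in S) ->
     (forall b m n, << (r b m, n) >> - << (m, l b n) >> \in S) ->
     x - y \in S) -> \pi_tens x = \pi_tens y.
Proof. by move=> h; apply/eqP; rewrite piE; apply/asboolP. Qed.

Lemma tpureDl m m' n : tpure (m + m') n = tpure m n + tpure m' n.
Proof.
rewrite /tpure -raddfD; apply: pi_eq => S _ h _ _.
by rewrite opprD addrA; exact: h.
Qed.

Lemma tpureDr m n n' : tpure m (n + n') = tpure m n + tpure m n'.
Proof.
rewrite /tpure -raddfD; apply: pi_eq => S _ _ h _.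
by rewrite opprD addrA; exact: h.
Qed.

Lemma tpure_bal b m n : tpure (r b m) n = tpure m (l b n).
Proof. by apply: pi_eq => S _ _ _ h; exact: h. Qed.

Lemma tpureNl m n : tpure (- m) n = - tpure m n.
Proof.
have h0 : tpure 0 n = 0.
  by apply: (addrI (tpure 0 n)); rewrite -tpureDl !addr0.
by apply/eqP; rewrite -addr_eq0 -tpureDl addNr h0.
Qed.

Lemma tens_sum (z : tens) :
  exists s : seq (M * N), z == \sum_(p <- s) tpure p.1 p.2.
Proof.
pose P (z : tens) := exists s : seq (M * N), z == \sum_(p <- s) tpure p.1 p.2.
have PD x y : P x -> P y -> P (x + y).
  by move=> [s /eqP->] [t /eqP->]; exists (s ++ t); rewrite big_cat.
have PN x : P x -> P (- x).
  move=> [s /eqP->]; exists [seq (- p.1, p.2) | p <- s].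
  rewrite big_map -sumrN; apply/eqP/eq_bigr => p _ /=.
  by rewrite tpureNl.
have P0 : P 0 by exists [::]; rewrite big_nil.
have PM x n : P x -> P (x *+ n).
  move=> Px; elim: n => [|n IH]; first by rewrite mulr0n; exact: P0.
  by rewrite mulrS; apply: PD; [exact: Px | exact: IH].
rewrite -/(P z) -[z]reprK (monalgE (repr z)) raddf_sum /=.
apply: (big_ind P); [exact: P0 | exact: PD | move=> -[m n] _].
have Pu : P (\pi_tens (<< (m, n) >> : tfree)).
  by exists [:: (m, n)]; rewrite big_seq1.
case: (mcoeff _ _) => c.
  have -> : << Posz c *g (m, n) >> = << (m, n) >> *+ c :> tfree.
    by rewrite -monalgUMn -mulr_natr mul1r natz.
  by rewrite raddfMn; exact: PM.
rewrite NegzE monalgUN raddfN; apply: (PN).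
have -> : << Posz c.+1 *g (m, n) >> = << (m, n) >> *+ c.+1 :> tfree.
  by rewrite -monalgUMn -mulr_natr mul1r natz.
by rewrite raddfMn; exact: PM.
Qed.

(* A chosen expression of z as a finite sum of pure tensors. *)
Definition rep (z : tens) : seq (M * N) := xchoose (tens_sum z).

Lemma repE (z : tens) : z = \sum_(p <- rep z) tpure p.1 p.2.
Proof. exact/eqP/(xchooseP (tens_sum z)). Qed.

Section Lift.
Variables (G : zmodType) (f : M -> N -> G).

Definition tlift (z : tens) : G := \sum_(p <- rep z) f p.1 p.2.

Hypothesis fDl : forall m m' n, f (m + m') n = f m n + f m' n.
Hypothesis fDr : forall m n n', f m (n + n') = f m n + f m n'.
Hypothesis f_bal : forall b m n, f (r b m) n = f m (l b n).

Let fext (x : tfree) : G := \sum_(p <- msupp x) f p.1 p.2 *~ x@_p.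

Let fextE (x : tfree) d : (msupp x `<=` d)%fset ->
  fext x = \sum_(p <- d) f p.1 p.2 *~ x@_p.
Proof.
move=> le_xd; rewrite /fext (big_fset_incl _ le_xd) // => p _ /mcoeff_outdom ->.
by rewrite mulr0z.
Qed.

Let fextB x y : fext (x - y) = fext x - fext y.
Proof.
pose d := (msupp x `|` msupp y)%fset.
rewrite (@fextE (x - y) d) ?(@fextE x d) ?(@fextE y d) ?fsubsetUl ?fsubsetUr //.
  rewrite -sumrB; apply: eq_bigr => p _.
  by rewrite mcoeffB mulrzBr.
exact: msuppB_le.
Qed.

Let fextU m n : fext << (m, n) >> = f m n.
Proof.
rewrite (@fextE _ [fset (m, n)]%fset) ?msuppU_le //.
by rewrite big_seq_fset1 mcoeffUU.
Qed.

Let fext_pi (x y : tfree) : \pi_tens x = \pi_tens y -> fext x = fext y.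
Proof.
move=> /eqP; rewrite piE => /asboolP /(_ [pred x | fext x == 0]).
rewrite inE fextB subr_eq0 => h; apply/eqP/h; rewrite ?/zmod_closed.
- split=> [|u v]; first by rewrite inE /fext msupp0 big_seq_fset0.
  by rewrite !inE fextB => /eqP -> /eqP ->; rewrite subrr.
- by move=> m m' n; rewrite inE !fextB !fextU fDl addrAC addrK subrr.
- by move=> m n n'; rewrite inE !fextB !fextU fDr addrAC addrK subrr.
- by move=> b m n; rewrite inE !fextB !fextU f_bal subrr.
Qed.

(* Hence sums over [rep z] do not depend on the chosen expression of z. *)
Lemma tlift_sum (s : seq (M * N)) :
  tlift (\sum_(p <- s) tpure p.1 p.2) = \sum_(p <- s) f p.1 p.2.
Proof.
have fextS (t : seq (M * N)) :
    fext (\sum_(p <- t) << p >>) = \sum_(p <- t) f p.1 p.2.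
  elim: t => [|[m n] t IH]; first by rewrite !big_nil /fext msupp0 big_seq_fset0.
  rewrite !big_cons -[X in _ + X]opprK fextB -[X in - fext X]sub0r fextB IH fextU.
  by rewrite /fext msupp0 big_seq_fset0 sub0r opprK.
have piS (t : seq (M * N)) :
    \pi_tens (\sum_(p <- t) << p >> : tfree) = \sum_(p <- t) tpure p.1 p.2.
  by rewrite raddf_sum; apply: eq_bigr => -[].
rewrite /tlift -!fextS; apply: fext_pi.
by rewrite !piS -repE.
Qed.

Lemma tlift_tpure m n : tlift (tpure m n) = f m n.
Proof. by have := tlift_sum [:: (m, n)]; rewrite !big_seq1. Qed.

End Lift.
End Tensor.
End Tensor.
Export Tensor.

Arguments tens {B M N} r l.
Arguments tpure {B M N r l} m n.
Arguments tlift {B M N r l G} f z.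

Declare Scope hopf_scope.
Local Open Scope hopf_scope.

Notation "m ⊗ n" := (tpure m n) (at level 40, left associativity) : hopf_scope.

Section Data.
Variables (k : fieldType) (B : algType k).

(* Raw data of an algebra P with maps from B and its opposite; [tgt b] stands
   for the image of \bar b, so [tgt] is antimultiplicative on B.  The left
   actions b p and \bar b p are recorded separately (the axioms identify them
   with multiplication by [src b] and [tgt b]): the tensor products over B then
   depend on the actions only, so twisting the product of a bialgebroid leaves
   the type of its coproduct unchanged. *)
Record berng := BeRng {
  carrier :> lmodType k;
  bmul : carrier -> carrier -> carrier;
  bone : carrier;
  src : B -> carrier;
  tgt : B -> carrier;
  lact : B -> carrier -> carrier;
  lactop : B -> carrier -> carrier }.

Definition ract (P : berng) (b : B) (p : P) : P := bmul p (src P b).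
Definition ractop (P : berng) (b : B) (p : P) : P := bmul p (tgt P b).

Record hopfdata := HopfData {
  hring :> berng;
  cop : hring -> tens (@lactop hring) (@lact hring);
  eps : hring -> B }.

End Data.

Arguments bmul {k B b} _ _ : rename.
Arguments bone {k B b} : rename.
Arguments src {k B b} _ : rename.
Arguments tgt {k B b} _ : rename.
Arguments lact {k B b} _ _ : rename.
Arguments lactop {k B b} _ _ : rename.
Arguments ract {k B P} b p.
Arguments ractop {k B P} b p.
Arguments cop {k B h} _ : rename.
Arguments eps {k B h} _ : rename.

Notation "x ⋅ y" := (bmul x y) (at level 39, left associativity) : hopf_scope.
(* [b ▹ p] is b p and [b ▸ p] is \bar b p. *)
Notation "b ▹ p" := (lact b p) (at level 38, right associativity) : hopf_scope.
Notation "b ▸ p" := (lactop b p) (at level 38, right associativity) : hopf_scope.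

(* Sweedler notation: [x] runs through a finite sum representing the coproduct
   or coaction, so that x.1 and x.2 are X_(1) and X_(2).  By [tlift_sum] the sum
   depends on [z] only when its body is biadditive and balanced in x; in the
   products of two coproducts below, balancedness in the second one holds after
   summation over the first one, by the Takeuchi condition. *)
Notation "\sw_ ( x <- z ) F" := (\sum_(x <- rep z) F)
  (at level 41, F at level 41, x, z at level 50,
   format "'[' \sw_ ( x  <-  z ) '/  '  F ']'") : hopf_scope.

Section Defs.
Variables (k : fieldType) (B : algType k).
Implicit Types (P : berng B) (H L : hopfdata B) (V : lmodType k).

Record is_lmod V (a : B -> V -> V) : Prop := {
  lmod_linl : forall v, linear (a^~ v);
  lmod_linr : forall b, linear (a b);
  lmod_1 : forall v, a 1 v = v;
  lmod_M : forall b c v, a (b * c) v = a b (a c v) }.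

Record is_lmodop V (a : B -> V -> V) : Prop := {
  lmodop_linl : forall v, linear (a^~ v);
  lmodop_linr : forall b, linear (a b);
  lmodop_1 : forall v, a 1 v = v;
  lmodop_M : forall b c v, a (b * c) v = a c (a b v) }.

Record is_alg P : Prop := {
  alg_linl : forall y : P, linear (fun x : P => x ⋅ y);
  alg_linr : forall x : P, linear (fun y : P => x ⋅ y);
  alg_mulA : forall x y z : P, x ⋅ (y ⋅ z) = (x ⋅ y) ⋅ z;
  alg_mul1 : forall x : P, bone ⋅ x = x;
  alg_mulr1 : forall x : P, x ⋅ bone = x }.

Record is_src P : Prop := {
  src_lin : linear (@src _ _ P);
  src_1 : src 1 = bone :> P;
  src_M : forall b c, src (b * c) = src b ⋅ src c :> P;
  src_lact : forall b (p : P), b ▹ p = src b ⋅ p }.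

Record is_tgt P : Prop := {
  tgt_lin : linear (@tgt _ _ P);
  tgt_1 : tgt 1 = bone :> P;
  tgt_M : forall b c, tgt (b * c) = tgt c ⋅ tgt b :> P;
  tgt_lactop : forall b (p : P), b ▸ p = tgt b ⋅ p }.

Definition src_tgt_commute P : Prop :=
  forall b c, src b ⋅ tgt c = tgt c ⋅ src b :> P.

(* Left action of the opposite of B on the second factor, needed to form the
   tensor product of three factors as an iterated one. *)
Definition lactop2 (M N : zmodType) (r : B -> M -> M) (l b : B -> N -> N)
    (c : B) : tens r l -> tens r l := tlift (fun m n => m ⊗ b c n).

Record is_bialgebroid H : Prop := {
  bia_alg : is_alg H;
  bia_src : is_src H;
  bia_tgt : is_tgt H;
  bia_comm : src_tgt_commute H;
  cop_add : forall X Y : H, cop (X + Y) = cop X + cop Y;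
  cop_takeuchi : forall (X : H) a,
    (\sw_(x <- cop X) ractop a x.1 ⊗ x.2 : tens (@lactop _ _ H) lact)
      = \sw_(x <- cop X) x.1 ⊗ ract a x.2;
  cop_1 : cop (bone : H) = bone ⊗ bone;
  cop_M : forall X Y : H,
    cop (X ⋅ Y) = \sw_(x <- cop X) \sw_(y <- cop Y) (x.1 ⋅ y.1) ⊗ (x.2 ⋅ y.2);
  cop_bilin : forall b c (X : H),
    cop (b ▹ c ▸ X) = \sw_(x <- cop X) (b ▹ x.1) ⊗ (c ▸ x.2);
  cop_coassoc : forall X : H,
    (\sw_(x <- cop X) cop x.1 ⊗ x.2
       : tens (@lactop2 H H lactop lact lactop) (@lact _ _ H))
      = \sw_(x <- cop X) \sw_(y <- cop x.2) (x.1 ⊗ y.1) ⊗ y.2;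
  eps_lin : linear (@eps _ _ H);
  eps_bilin : forall b c (X : H), eps (b ▹ c ▸ X) = b * eps X * c;
  eps_l : forall X : H, \sw_(x <- cop X) eps x.1 ▹ x.2 = X;
  eps_r : forall X : H, \sw_(x <- cop X) eps x.2 ▸ x.1 = X;
  eps_1 : eps (bone : H) = 1;
  eps_src : forall X Y : H, eps (X ⋅ src (eps Y)) = eps (X ⋅ Y);
  eps_tgt : forall X Y : H, eps (X ⋅ tgt (eps Y)) = eps (X ⋅ Y) }.

Definition hopf_lambda H :
    tens (@ractop _ _ H) (@lactop _ _ H) -> tens (@lactop _ _ H) (@lact _ _ H) :=
  tlift (fun X Y : H => \sw_(x <- cop X) x.1 ⊗ (x.2 ⋅ Y)).

Definition hopf_mu H :
    tens (@ract _ _ H) (@lact _ _ H) -> tens (@lactop _ _ H) (@lact _ _ H) :=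
  tlift (fun X Y : H => \sw_(x <- cop X) (x.1 ⋅ Y) ⊗ x.2).

Record is_hopf_algebroid H : Prop := {
  hopf_bia : is_bialgebroid H;
  hopf_lambda_bij : bijective (@hopf_lambda H);
  hopf_mu_bij : bijective (@hopf_mu H) }.

(* The translation maps X_+ (x) X_- and X_[+] (x) X_[-]; the default value 0 is
   irrelevant as lambda and mu are bijective on a Hopf algebroid. *)
Definition trans_lambda H (X : H) : tens (@ractop _ _ H) (@lactop _ _ H) :=
  xget 0 [set w | hopf_lambda w = X ⊗ bone].

Definition trans_mu H (X : H) : tens (@ract _ _ H) (@lact _ _ H) :=
  xget 0 [set w | hopf_mu w = bone ⊗ X].

Section LeftComodule.
Variables (H : hopfdata B) (V : lmodType k) (a : B -> V -> V).
Variable d : V -> tens (@lactop _ _ H) a.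

Record is_lcomod : Prop := {
  lcomod_lmod : is_lmod a;
  lcomod_add : forall v w, d (v + w) = d v + d w;
  lcomod_lact : forall b v, d (a b v) = \sw_(x <- d v) (b ▹ x.1) ⊗ x.2;
  lcomod_coassoc : forall v,
    (\sw_(x <- d v) cop x.1 ⊗ x.2
       : tens (@lactop2 H H lactop lact lactop) a)
      = \sw_(x <- d v) \sw_(y <- d x.2) (x.1 ⊗ y.1) ⊗ y.2;
  lcomod_counit : forall v, \sw_(x <- d v) a (eps x.1) x.2 = v }.

Definition lcomod_ract (b : B) (v : V) : V :=
  \sw_(x <- d v) a (eps (ract b x.1)) x.2.

Definition lreversible : Prop :=
  bijective (tlift (fun v X => \sw_(x <- d v) (x.1 ⋅ X) ⊗ x.2)
    : tens lcomod_ract (@lact _ _ H) -> tens (@lactop _ _ H) a).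

End LeftComodule.

Section RightComodule.
Variables (H : hopfdata B) (V : lmodType k) (a : B -> V -> V).
Variable d : V -> tens a (@lact _ _ H).

Record is_rcomod : Prop := {
  rcomod_lmodop : is_lmodop a;
  rcomod_add : forall v w, d (v + w) = d v + d w;
  rcomod_lactop : forall b v, d (a b v) = \sw_(x <- d v) x.1 ⊗ (b ▸ x.2);
  rcomod_coassoc : forall v,
    (\sw_(x <- d v) d x.1 ⊗ x.2
       : tens (@lactop2 V H a lact lactop) (@lact _ _ H))
      = \sw_(x <- d v) \sw_(y <- cop x.2) (x.1 ⊗ y.1) ⊗ y.2;
  rcomod_counit : forall v, \sw_(x <- d v) a (eps x.2) x.1 = v }.

Definition rcomod_ractop (b : B) (v : V) : V :=
  \sw_(x <- d v) a (eps (ract b x.2)) x.1.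

Definition rreversible : Prop :=
  bijective (tlift (fun v X => \sw_(x <- d v) x.1 ⊗ (x.2 ⋅ X))
    : tens rcomod_ractop (@lactop _ _ H) -> tens a (@lact _ _ H)).

End RightComodule.

(* A left comodule algebra only involves the B-ring structure of P, a right
   comodule algebra only the ring structure over the opposite of B. *)
Record is_lcomod_alg H P (d : P -> tens (@lactop _ _ H) (@lact _ _ P)) : Prop := {
  lca_comod : is_lcomod d;
  lca_alg : is_alg P;
  lca_src : is_src P;
  lca_ract : forall b (p : P), lcomod_ract d b p = ract b p;
  lca_takeuchi : forall (p : P) b,
    (\sw_(x <- d p) ractop b x.1 ⊗ x.2 : tens (@lactop _ _ H) (@lact _ _ P))
      = \sw_(x <- d p) x.1 ⊗ ract b x.2;
  lca_M : forall p q : P,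
    d (p ⋅ q) = \sw_(x <- d p) \sw_(y <- d q) (x.1 ⋅ y.1) ⊗ (x.2 ⋅ y.2);
  lca_1 : d bone = bone ⊗ bone;
  lca_B : forall b, d (src b) = src b ⊗ bone }.

Record is_rcomod_alg H P (d : P -> tens (@lactop _ _ P) (@lact _ _ H)) : Prop := {
  rca_comod : is_rcomod d;
  rca_alg : is_alg P;
  rca_tgt : is_tgt P;
  rca_ractop : forall b (p : P), rcomod_ractop d b p = ractop b p;
  rca_takeuchi : forall (p : P) b,
    (\sw_(x <- d p) ractop b x.1 ⊗ x.2 : tens (@lactop _ _ P) (@lact _ _ H))
      = \sw_(x <- d p) x.1 ⊗ ract b x.2;
  rca_M : forall p q : P,
    d (p ⋅ q) = \sw_(x <- d p) \sw_(y <- d q) (x.1 ⋅ y.1) ⊗ (x.2 ⋅ y.2);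
  rca_1 : d bone = bone ⊗ bone;
  rca_B : forall b, d (tgt b) = bone ⊗ tgt b }.

Definition lcoinv H P (d : P -> tens (@lactop _ _ H) (@lact _ _ P)) : set P :=
  [set p | d p = bone ⊗ p].

Definition rcoinv H P (d : P -> tens (@lactop _ _ P) (@lact _ _ H)) : set P :=
  [set p | d p = p ⊗ bone].

Record is_bicomod_alg L H P (dl : P -> tens (@lactop _ _ L) (@lact _ _ P))
    (dr : P -> tens (@lactop _ _ P) (@lact _ _ H)) : Prop := {
  bca_comm : src_tgt_commute P;
  bca_l : is_lcomod_alg dl;
  bca_r : is_rcomod_alg dr;
  bca_dl : forall b (p : P), dl (b ▸ p) = \sw_(x <- dl p) x.1 ⊗ (b ▸ x.2);
  bca_dr : forall b (p : P), dr (b ▹ p) = \sw_(x <- dr p) (b ▹ x.1) ⊗ x.2;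
  bca_coassoc : forall p : P,
    (\sw_(x <- dr p) dl x.1 ⊗ x.2
       : tens (@lactop2 L P lactop lact lactop) (@lact _ _ H))
      = \sw_(x <- dl p) \sw_(y <- dr x.2) (x.1 ⊗ y.1) ⊗ y.2 }.

Record is_biGalois L H P (dl : P -> tens (@lactop _ _ L) (@lact _ _ P))
    (dr : P -> tens (@lactop _ _ P) (@lact _ _ H)) : Prop := {
  bg_hopfl : is_hopf_algebroid L;
  bg_hopfr : is_hopf_algebroid H;
  bg_bicomod : is_bicomod_alg dl dr;
  bg_tgt_inj : injective (@tgt _ _ P);
  bg_lcoinv : lcoinv dl = range (@tgt _ _ P);
  bg_src_inj : injective (@src _ _ P);
  bg_rcoinv : rcoinv dr = range (@src _ _ P);
  bg_canl : bijective (tlift (fun p q : P => \sw_(x <- dl p) x.1 ⊗ (x.2 ⋅ q))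
    : tens (@ractop _ _ P) (@lactop _ _ P) -> tens (@lactop _ _ L) (@lact _ _ P));
  bg_canr : bijective (tlift (fun p q : P => \sw_(x <- dr p) (x.1 ⋅ q) ⊗ x.2)
    : tens (@ract _ _ P) (@lact _ _ P) -> tens (@lactop _ _ P) (@lact _ _ H)) }.

Definition right_anticleft H P (d : P -> tens (@lactop _ _ P) (@lact _ _ H)) :
    Prop :=
  [/\ is_rcomod_alg d, rreversible d,
      [/\ is_src P, injective (@src _ _ P) & (range (@src _ _ P) `<=` rcoinv d)%classic] &
  exists rt : H -> P,
    [/\ linear rt,
        forall b X, rt (b ▸ X) = b ▸ rt X,
        forall X, d (rt X) = \sw_(x <- cop X) rt x.1 ⊗ x.2,
        forall b X, rt (b ▹ X) = b ▹ rt X &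
  exists r : H -> P,
    [/\ linear r,
        forall b X, r (b ▸ X) = b ▸ r X,
        forall b X, r (ract b X) = ract b (r X),
        forall X, \sw_(x <- trans_lambda X) rt x.1 ⋅ r x.2 = src (eps X) &
        forall X, \sw_(x <- trans_mu X) r x.1 ⋅ rt x.2 = tgt (eps X)]]].

Definition left_cleft L P (d : P -> tens (@lactop _ _ L) (@lact _ _ P)) : Prop :=
  [/\ is_lcomod_alg d, lreversible d,
      [/\ is_tgt P, injective (@tgt _ _ P) & (range (@tgt _ _ P) `<=` lcoinv d)%classic] &
  exists gt : L -> P,
    [/\ linear gt,
        forall b X, gt (b ▹ X) = b ▹ gt X,
        forall X, d (gt X) = \sw_(x <- cop X) x.1 ⊗ gt x.2,
        forall b X, gt (b ▸ X) = b ▸ gt X &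
  exists g : L -> P,
    [/\ linear g,
        forall b X, g (b ▹ X) = b ▹ g X,
        forall b X, g (ractop b X) = ractop b (g X),
        forall X, \sw_(x <- trans_lambda X) g x.1 ⋅ gt x.2 = src (eps X) &
        forall X, \sw_(x <- trans_mu X) gt x.1 ⋅ g x.2 = tgt (eps X)]]].

(* X, Y |-> G(X_(1), Y_(1)) X_(2) Y_(2) *)
Definition cocycle_mul H (G : H -> H -> B) (X Y : H) : H :=
  \sw_(x <- cop X) \sw_(y <- cop Y) G x.1 y.1 ▹ (x.2 ⋅ y.2).

(* Maps out of a balanced tensor product of H with itself are represented by
   balanced bilinear maps. *)
Record is_2cocycle H (G : H -> H -> B) : Prop := {
  coc_linl : forall Y, linear (G^~ Y);
  coc_linr : forall X, linear (G X);
  coc_bal : forall X b Y, G (ractop b X) Y = G X (b ▸ Y);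
  coc_bilin : forall b c X Y, G (b ▹ c ▸ X) Y = b * G X Y * c;
  coc_cocycle : forall X Y Z,
    G X (cocycle_mul G Y Z) = G (cocycle_mul G X Y) Z;
  coc_1l : forall X, G bone X = eps X;
  coc_1r : forall X, G X bone = eps X }.

Record is_cocycle_inverse H (G Gi : H -> H -> B) : Prop := {
  coci_linl : forall Y, linear (Gi^~ Y);
  coci_linr : forall X, linear (Gi X);
  coci_bal : forall X b Y, Gi (ract b X) Y = Gi X (b ▹ Y);
  coci_bilin : forall b c X Y, Gi (b ▹ c ▸ X) Y = b * Gi X Y * c;
  coci_lactop : forall X b Y,
    Gi X (b ▸ Y) = \sw_(x <- cop X) Gi x.1 Y * Gi x.2 (tgt b);
  coci_l : forall X Y,
    \sw_(x <- cop X) \sw_(y <- cop Y) G x.1 y.1 * Gi x.2 y.2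
      = G X (src (eps Y));
  coci_r : forall X Y,
    \sw_(x <- cop X) \sw_(y <- cop Y) Gi x.1 y.1 * G x.2 y.2
      = eps (X ⋅ Y) }.

(* The triples ((X_(1), X_(2)), X_(3)). *)
Definition cop3 H (X : H) : seq (H * H * H) :=
  [seq (y, x.2) | x <- rep (cop X), y <- rep (cop x.1)].

(* H^Gamma, where Gi is the inverse of G. *)
Definition twist H (G Gi : H -> H -> B) : hopfdata B :=
  @HopfData _ _
    (@BeRng _ _ H
       (fun X Y => \sum_(x <- cop3 X) \sum_(y <- cop3 Y)
          G x.1.1 y.1.1 ▹ Gi x.2 y.2 ▸ (x.1.2 ⋅ y.1.2))
       bone src tgt lact lactop)
    cop eps.

(* _Gamma H; both of its coactions are the coproduct of H. *)
Definition cocycle_alg H (G : H -> H -> B) : berng B :=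
  @BeRng _ _ H (cocycle_mul G) bone src tgt lact lactop.

End Defs.

Arguments is_2cocycle {k B} H G.
Arguments is_cocycle_inverse {k B} H G Gi.
Arguments twist {k B} H G Gi.
Arguments cocycle_alg {k B} H G.
Arguments is_biGalois {k B} L H P dl dr.
Arguments left_cleft {k B} L P d.
Arguments right_anticleft {k B} H P d.

(* Main.v *)
Require Import Defs.
From HB Require Import structures.
From mathcomp Require Import all_boot all_algebra.
From mathcomp Require Import boolp classical_sets.

(** Write L for the twist of H and P for the algebra of the cocycle.  All four
    algebras L, P, H and Q, where Q is the analogue of P for the inverse cocycle,
    share the coring of H.  Index H by 2 and L by 1, and put m_22 = H, m_12 = P,
    m_21 = Q, m_11 = L and c_ij = eps o m_ij.  Then
      Delta (X ._ij Y) = X_(1) ._ik Y_(1) (x) X_(2) ._kj Y_(2),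
    the c_ij are convolved as c_ik * c_kj = c_ij, and c_12, c_21 are the cocycle
    and its inverse: these data form a connected cogroupoid, which is symmetric
    under exchanging 1 and 2 and, up to the co-opposite coring, under exchanging
    i and j.

    Put lambda_ij (X (x) Y) = X_(1) (x) X_(2) ._ij Y and
    mu_ij (X (x) Y) = X_(1) ._ij Y (x) X_(2).  If lambda_jj and mu_jj are bijective,
    rho X = c_ji(X_[+](1), X_[-]) X_[+](2) satisfies
    X_+ ._ij rho X_- = eps X and rho X_[+] ._ij X_[-] = \bar{eps X}, so that
    X (x) Y |-> X_+ (x) rho X_- ._ij Y inverts lambda_ij.  Convolving with c_jk turns
    lambda_ij into lambda_ik, hence all lambda_ij are bijective, and all mu_ij by
    symmetry.  This gives the Hopf algebroid L, both Galois maps of P, and the two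
    cleaving maps, the left one by applying the right one to the symmetric data. *)

Set Implicit Arguments.
Unset Strict Implicit.
Unset Printing Implicit Defensive.

Import GRing.Theory.
Local Open Scope ring_scope.
Local Open Scope hopf_scope.

(** The obstacle is that B is noncommutative. A sum over two coproducts is meaningful only because
    summing over one of them makes the rest balanced in the other, by the Takeuchi condition, so
    each regrouping of Sweedler indices has to be justified. Two devices contain this. Functions of
    two variables carry a type (i, j) that records for which right actions they are balanced, and
    associativity of convolution is proved once for all targets. Identities for translation maps are
    checked on the tensors X_(1) ⊗ X_(2) Y, or X_(1) Y ⊗ X_(2), which exhaust the target because
    lambda and mu are surjective.

    The right actions need an index because multiplying by b on the right in the twist gives
    Gamma(X_(1), b) X_(2), not X b.

    The formula for rho comes from Hopf algebras with bijective antipode S: there X_[+] ⊗ X_[-] =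
    X_(2) ⊗ S^-1(X_(1)), so rho X = c_ji(X_(2), S^-1(X_(1))) X_(3), and m_jj = c_ji * m_ij turns rho
    X_[+] ._ij X_[-] into X_[+] ._jj X_[-].

    Neither the cocycle condition for the inverse nor its normalisation is assumed; both are derived
    from the convolution identities. *)

Record adt (U W : zmodType) (f : U -> W) : Prop := Adt {
  adtD : forall x y, f (x + y) = f x + f y }.

(* Locked, like [tpr] below: comparing two different sums up to conversion would
   unfold the quotient construction. *)
HB.lock Definition tsum (B : Type) (M N : zmodType) (r : B -> M -> M)
    (l : B -> N -> N) (G : zmodType) (f : M -> N -> G) (z : tens r l) : G :=
  tlift f z.

Arguments tsum {B M N r l G} f z.

HB.lock Definition tpr (B : Type) (M N : zmodType) (r : B -> M -> M)
    (l : B -> N -> N) (m : M) (n : N) : tens r l := m ⊗ n.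

Arguments tpr {B M N r l} m n.
Notation "m ⊠ n" := (tpr m n) (at level 40, left associativity) : hopf_scope.

(** * Additive functions and balanced maps out of tensor products *)

Section Additive.
Variables U W Z : zmodType.

Lemma adt_id : adt (fun x : U => x). Proof. by []. Qed.

Lemma adt_comp (g : W -> Z) (f : U -> W) :
  adt g -> adt f -> adt (fun x => g (f x)).
Proof. by move=> [hg] [hf]; split=> x y; rewrite hf hg. Qed.

Lemma adt0 (f : U -> W) : adt f -> f 0 = 0.
Proof. by move=> [hf]; apply: (addrI (f 0)); rewrite -hf !addr0. Qed.

Lemma adt_sum (f : U -> W) : adt f -> forall (T : Type) (s : seq T) g,
  f (\sum_(i <- s) g i) = \sum_(i <- s) f (g i).
Proof.
move=> hf T s g; elim: s => [|a s IH]; first by rewrite !big_nil adt0.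
by rewrite !big_cons (adtD hf) IH.
Qed.

Lemma adt_inv (f : U -> W) (g : W -> U) :
  cancel f g -> cancel g f -> adt f -> adt g.
Proof. by move=> fK gK [hf]; split=> x y; rewrite -{1}(gK x) -{1}(gK y) -hf fK. Qed.

End Additive.

Section Tens.
Variables (B : Type) (M N : zmodType) (r : B -> M -> M) (l : B -> N -> N).

Record bal (G : zmodType) (f : M -> N -> G) : Prop := Bal {
  balDl : forall n, adt (fun m => f m n);
  balDr : forall m, adt (f m);
  balB : forall b m n, f (r b m) n = f m (l b n) }.

Lemma adt_tprl n : adt (fun m => (m ⊠ n : tens r l)).
Proof. by split=> x y; rewrite tpr.unlock tpureDl. Qed.

Lemma adt_tprr m : adt (fun n => (m ⊠ n : tens r l)).
Proof. by split=> x y; rewrite tpr.unlock tpureDr. Qed.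

Lemma repE_tpr (z : tens r l) : z = \sum_(p <- rep z) p.1 ⊠ p.2.
Proof. by rewrite tpr.unlock -repE. Qed.

Lemma tpr_bal b m n : (r b m ⊠ n : tens r l) = m ⊠ l b n.
Proof. by rewrite tpr.unlock tpure_bal. Qed.

Lemma bal_tpr : bal (fun m n => (m ⊠ n : tens r l)).
Proof. by split=> [n|m|b m n]; [exact: adt_tprl|exact: adt_tprr|exact: tpr_bal]. Qed.

Section Lift.
Variables (G : zmodType) (f : M -> N -> G).
Hypothesis hf : bal f.

Lemma tsum_seq (s : seq (M * N)) :
  tsum f (\sum_(p <- s) (p.1 ⊠ p.2 : tens r l)) = \sum_(p <- s) f p.1 p.2.
Proof.
rewrite tpr.unlock tsum.unlock; apply: tlift_sum => *.
- exact: (adtD (balDl hf _)).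
- exact: (adtD (balDr hf _)).
- exact: (balB hf).
Qed.

Lemma tsum_pure m n : tsum f (m ⊠ n : tens r l) = f m n.
Proof.
rewrite tpr.unlock tsum.unlock; apply: tlift_tpure => *.
- exact: (adtD (balDl hf _)).
- exact: (adtD (balDr hf _)).
- exact: (balB hf).
Qed.

Lemma adt_tsum : adt (tsum f : tens r l -> G).
Proof.
split=> x y; rewrite {1}(repE_tpr x) {1}(repE_tpr y) -big_cat tsum_seq.
by rewrite big_cat tsum.unlock.
Qed.
End Lift.

(** From here to [adt_tsumf], and in [tsum_exch], no balancedness is required: [tsum f z] is a
    finite sum over the one chosen representative of [z], whatever [f] is. Balancedness matters only
    where the representative changes. *)
Lemma eq_tsum (G : zmodType) (f g : M -> N -> G) (z : tens r l) :
  (forall m n, f m n = g m n) -> tsum f z = tsum g z.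
Proof. by move=> e; rewrite tsum.unlock; apply: eq_bigr => p _; exact: e. Qed.

Lemma tsum_addf (G : zmodType) (f g : M -> N -> G) (z : tens r l) :
  tsum (fun m n => f m n + g m n) z = tsum f z + tsum g z.
Proof. by rewrite tsum.unlock; exact: big_split. Qed.

Lemma tsum_adt (G G' : zmodType) (h : G -> G') (f : M -> N -> G) (z : tens r l) :
  adt h -> h (tsum f z) = tsum (fun m n => h (f m n)) z.
Proof. by move=> hh; rewrite tsum.unlock /tlift (adt_sum hh). Qed.

Lemma adt_tsumf (U G : zmodType) (f : U -> M -> N -> G) (z : tens r l) :
  (forall m n, adt (fun x => f x m n)) -> adt (fun x => tsum (f x) z).
Proof.
by move=> hf; split=> x y; rewrite -tsum_addf; apply: eq_tsum => m n; rewrite (adtD (hf m n)).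
Qed.

Lemma tens_ext (G : zmodType) (f g : tens r l -> G) :
  adt f -> adt g -> (forall m n, f (m ⊠ n) = g (m ⊠ n)) -> f =1 g.
Proof.
by move=> hf hg e z; rewrite (repE_tpr z) !adt_sum //; apply: eq_bigr.
Qed.

End Tens.

Arguments bal {B M N} r l {G} f.

Lemma tsum_tsum (B B' : Type) (M N M' N' G : zmodType) (r : B -> M -> M)
    (l : B -> N -> N) (r' : B' -> M' -> M') (l' : B' -> N' -> N')
    (f : M -> N -> G) (g : M' -> N' -> tens r l) (z : tens r' l') :
  bal r l f -> tsum f (tsum g z) = tsum (fun m n => tsum f (g m n)) z.
Proof. by move=> hf; rewrite (tsum_adt _ _ (adt_tsum hf)). Qed.

Lemma tsum_exch (B B' : Type) (M N M' N' G : zmodType) (r : B -> M -> M)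
    (l : B -> N -> N) (r' : B' -> M' -> M') (l' : B' -> N' -> N')
    (f : M -> N -> M' -> N' -> G) (z : tens r l) (z' : tens r' l') :
  tsum (fun a b => tsum (fun c d => f a b c d) z') z
    = tsum (fun c d => tsum (fun a b => f a b c d) z) z'.
Proof. by rewrite tsum.unlock; exact: exchange_big. Qed.

Create HintDb adt.
#[global] Hint Resolve adt_id adt_tprl adt_tprr : adt.

Lemma adt_mull (R : pzRingType) (c : R) : adt (fun x : R => x * c).
Proof. by split=> x y; rewrite mulrDl. Qed.
Lemma adt_mulr (R : pzRingType) (c : R) : adt (fun x : R => c * x).
Proof. by split=> x y; rewrite mulrDr. Qed.
#[global] Hint Resolve adt_mull adt_mulr : adt.

(** Additivity is derived by recursion on the body of the function: the variable may occur in the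
    tensor summed over, in the summand, or in an argument of a function whose additivity is in the
    hint database. [bal] calls [adt] for both variables and leaves the balancing identity to
    [tpr_bal]. *)
Ltac adt :=
  intros; cbv beta;
  lazymatch goal with
  | |- adt (fun x => x) => exact: adt_id
  | |- adt _ => first
    [ solve [auto with adt]
    | match goal with
      | |- adt (fun x => @tsum ?B ?M ?N ?r ?l ?G ?F (@?z x)) =>
          apply: (adt_comp (g := @tsum B M N r l G F) (f := z));
          [apply: adt_tsum; bal | adt]
      | |- adt (fun x => @tsum ?B ?M ?N ?r ?l ?G (@?F x) ?z) =>
          apply: (adt_tsumf (f := F)); adt
      | |- adt (fun x => ?h (@?f x)) =>
          apply: (adt_comp (g := h) (f := f)); [solve [auto with adt] | adt]
      | |- adt (fun x => ?h (@?f x) ?c) =>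
          apply: (adt_comp (g := fun y => h y c) (f := f)); [solve [auto with adt] | adt]
      | |- adt (fun x => ?h (@?f x) ?c ?d) =>
          apply: (adt_comp (g := fun y => h y c d) (f := f)); [solve [auto with adt] | adt]
      end
    | match goal with
      | |- adt ?f => let f' := eval cbv beta in (fun x => f x) in
                     change (adt f'); progress cbv beta; adt
      end ]
  end
with bal := solve [auto with adt | split; [adt | adt | intros; cbv beta; balb]]
with balb := solve [auto with adt | by rewrite ?tpr_bal].

(** * Corings with several right actions *)

(* [la b x] and [lb b x] stand for b x and \bar b x, and [ra i b x], [rb i b x] for
   x b and x \bar b, formed in the i-th product. *)
Record coringData (B : pzRingType) (I : Type) := CoringData {
  cv :> zmodType;
  la : B -> cv -> cv;
  lb : B -> cv -> cv;
  cD : cv -> tens lb la;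
  ce : cv -> B;
  c1 : cv;
  ra : I -> B -> cv -> cv;
  rb : I -> B -> cv -> cv }.

Arguments la {B I c} _ _ : rename.
Arguments lb {B I c} _ _ : rename.
Arguments cD {B I c} _ : rename.
Arguments ce {B I c} _ : rename.
Arguments c1 {B I c} : rename.
Arguments ra {B I c} _ _ _ : rename.
Arguments rb {B I c} _ _ _ : rename.

Notation "''S' ( u , v <- x ) F" := (tsum (fun u v => F) (cD x))
  (at level 41, u name, v name, x at level 50, F at level 41,
   format "''S' ( u ,  v  <-  x )  F") : hopf_scope.

Record bal3 (B : pzRingType) (I : Type) (C : coringData B I) (A : zmodType)
    (F : C -> C -> C -> A) : Prop := Bal3 {
  bal3D1 : forall y z, adt (fun x => F x y z);
  bal3D2 : forall x z, adt (fun y => F x y z);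
  bal3D3 : forall x y, adt (fun z => F x y z);
  bal3B1 : forall b x y z, F (lb b x) y z = F x (la b y) z;
  bal3B2 : forall b x y z, F x (lb b y) z = F x y (la b z) }.

(** Coassociativity is tested against all balanced functions of three variables, so no tensor
    product of three factors is ever formed. No product occurs: convolution needs of the products
    only their right actions, one pair and one Takeuchi condition for each index. *)
Record coring (B : pzRingType) (I : Type) (C : coringData B I) : Prop := Coring {
  laDl : forall x : C, adt (fun b => la b x);
  laDr : forall b, adt (la b : C -> C);
  lbDl : forall x : C, adt (fun b => lb b x);
  lbDr : forall b, adt (lb b : C -> C);
  laM : forall b c (x : C), la b (la c x) = la (b * c) x;
  lbM : forall b c (x : C), lb b (lb c x) = lb (c * b) x;
  la1 : forall x : C, la 1 x = x;
  lb1 : forall x : C, lb 1 x = x;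
  la_lb : forall b c (x : C), la b (lb c x) = lb c (la b x);
  cDD : adt (cD : C -> _);
  cD_la : forall b (x : C), cD (la b x) = 'S(u, v <- x) la b u ⊠ v;
  cD_lb : forall b (x : C), cD (lb b x) = 'S(u, v <- x) u ⊠ lb b v;
  coass : forall (A : zmodType) (F : C -> C -> C -> A), bal3 F -> forall x,
    'S(u, v <- x) 'S(a, b <- u) F a b v = 'S(u, v <- x) 'S(a, b <- v) F u a b;
  ceD : adt (ce : C -> B);
  ce_la : forall b (x : C), ce (la b x) = b * ce x;
  ce_lb : forall b (x : C), ce (lb b x) = ce x * b;
  counl : forall x : C, 'S(u, v <- x) la (ce u) v = x;
  counr : forall x : C, 'S(u, v <- x) lb (ce v) u = x;
  cD1 : cD (c1 : C) = c1 ⊠ c1;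
  ce1 : ce (c1 : C) = 1;
  raDl : forall i (x : C), adt (fun b => ra i b x);
  raDr : forall i b, adt (ra i b : C -> C);
  rbDl : forall i (x : C), adt (fun b => rb i b x);
  rbDr : forall i b, adt (rb i b : C -> C);
  ra_la : forall i b c (x : C), ra i b (la c x) = la c (ra i b x);
  ra_lb : forall i b c (x : C), ra i b (lb c x) = lb c (ra i b x);
  rb_la : forall i b c (x : C), rb i b (la c x) = la c (rb i b x);
  rb_lb : forall i b c (x : C), rb i b (lb c x) = lb c (rb i b x);
  cD_ra : forall i b (x : C), cD (ra i b x) = 'S(u, v <- x) ra i b u ⊠ v;
  cD_rb : forall i b (x : C), cD (rb i b x) = 'S(u, v <- x) u ⊠ rb i b v;
  takeuchi : forall k b (x : C),
    'S(u, v <- x) (rb k b u ⊠ v : tens lb la) = 'S(u, v <- x) u ⊠ ra k b v;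
  ce_rarb : forall i b (x : C), ce (ra i b x) = ce (rb i b x);
  ra_c1 : forall i b, ra i b c1 = la b (c1 : C);
  rb_c1 : forall i b, rb i b c1 = lb b (c1 : C) }.

Section Coring.
Variables (B : pzRingType) (I : Type) (C : coringData B I).
Hypothesis hC : coring C.
Variable A : zmodType.
Implicit Types (F : C -> C -> A) (x y : C).

Let hDr := laDr hC. Let hDl := laDl hC.
Let hbDr := lbDr hC. Let hbDl := lbDl hC.
#[local] Hint Resolve hDr hDl hbDr hbDl : adt.

Lemma S_la F b x : bal lb la F -> 'S(u, v <- la b x) F u v = 'S(u, v <- x) F (la b u) v.
Proof.
move=> hF; rewrite (cD_la hC) tsum_tsum //; apply: eq_tsum => u v.
by rewrite tsum_pure.
Qed.

Lemma S_lb F b x : bal lb la F -> 'S(u, v <- lb b x) F u v = 'S(u, v <- x) F u (lb b v).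
Proof.
move=> hF; rewrite (cD_lb hC) tsum_tsum //; apply: eq_tsum => u v.
by rewrite tsum_pure.
Qed.

Lemma S_ra F i b x : bal lb la F -> 'S(u, v <- ra i b x) F u v = 'S(u, v <- x) F (ra i b u) v.
Proof.
move=> hF; rewrite (cD_ra hC) tsum_tsum //; apply: eq_tsum => u v.
by rewrite tsum_pure.
Qed.

Lemma S_rb F i b x : bal lb la F -> 'S(u, v <- rb i b x) F u v = 'S(u, v <- x) F u (rb i b v).
Proof.
move=> hF; rewrite (cD_rb hC) tsum_tsum //; apply: eq_tsum => u v.
by rewrite tsum_pure.
Qed.

Lemma S_c1 F : bal lb la F -> 'S(u, v <- c1) F u v = F c1 c1.
Proof. by move=> hF; rewrite (cD1 hC) tsum_pure. Qed.

Lemma S_tak F k b x : bal lb la F ->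
  'S(u, v <- x) F (rb k b u) v = 'S(u, v <- x) F u (ra k b v).
Proof.
move=> hF; have := congr1 (tsum F) (takeuchi hC k b x).
rewrite (tsum_adt _ _ (adt_tsum hF)) [RHS](tsum_adt _ _ (adt_tsum hF)) => e.
under eq_tsum do rewrite -(tsum_pure hF).
by rewrite e; apply: eq_tsum => u v; rewrite tsum_pure.
Qed.

Lemma counlF (h : C -> A) x : adt h -> 'S(u, v <- x) h (la (ce u) v) = h x.
Proof. by move=> hh; rewrite -(tsum_adt _ _ hh) counl. Qed.

Lemma counrF (h : C -> A) x : adt h -> 'S(u, v <- x) h (lb (ce v) u) = h x.
Proof. by move=> hh; rewrite -(tsum_adt _ _ hh) counr. Qed.

Lemma SD F : bal lb la F -> adt (fun x => 'S(u, v <- x) F u v).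
Proof. by move=> hF; split=> x y; rewrite (adtD (cDD hC)) (adtD (adt_tsum hF)). Qed.

End Coring.

(** The counit applied to x_(1) b ⊗ x_(2). It turns a right action into a left action by scalars,
    through which left linear functions can be evaluated. *)
Lemma ra_sum (B : pzRingType) (I : Type) (C : coringData B I) (hC : coring C) i b (x : C) :
  ra i b x = 'S(u, v <- x) la (ce (ra i b u)) v.
Proof.
rewrite -{1}(counl hC (ra i b x)) (S_ra hC) //.
split=> *.
- by apply: (adt_comp (laDl hC _) (ceD hC)).
- exact: (laDr hC).
- by rewrite (ce_lb hC) (laM hC).
Qed.

(* By the Takeuchi condition these conditions make the sum over the coproduct of x
   balanced in y1 and y2, see [adm_bal]. *)
Record adm (B : pzRingType) (I : Type) (C : coringData B I) (A : zmodType) (k : I)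
    (F : C -> C -> C -> C -> A) : Prop := Adm {
  admx : forall y1 y2, bal lb la (fun x1 x2 => F x1 x2 y1 y2);
  admD1 : forall x1 x2 y2, adt (fun y1 => F x1 x2 y1 y2);
  admD2 : forall x1 x2 y1, adt (fun y2 => F x1 x2 y1 y2);
  admB1 : forall b x1 x2 y1 y2, F x1 x2 (lb b y1) y2 = F (rb k b x1) x2 y1 y2;
  admB2 : forall b x1 x2 y1 y2, F x1 x2 y1 (la b y2) = F x1 (ra k b x2) y1 y2 }.

Record adm3 (B : pzRingType) (I : Type) (C : coringData B I) (A : zmodType) (k l : I)
    (F : C -> C -> C -> C -> C -> C -> A) : Prop := Adm3 {
  adm3x : forall y1 y2 y3, bal3 (fun x1 x2 x3 => F x1 x2 x3 y1 y2 y3);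
  adm3D1 : forall x1 x2 x3 y2 y3, adt (fun y1 => F x1 x2 x3 y1 y2 y3);
  adm3D2 : forall x1 x2 x3 y1 y3, adt (fun y2 => F x1 x2 x3 y1 y2 y3);
  adm3D3 : forall x1 x2 x3 y1 y2, adt (fun y3 => F x1 x2 x3 y1 y2 y3);
  adm3B1 : forall b x1 x2 x3 y1 y2 y3,
    F x1 x2 x3 (lb b y1) y2 y3 = F (rb k b x1) x2 x3 y1 y2 y3;
  adm3B2 : forall b x1 x2 x3 y1 y2 y3,
    F x1 x2 x3 y1 (la b y2) y3 = F x1 (ra k b x2) x3 y1 y2 y3;
  adm3B3 : forall b x1 x2 x3 y1 y2 y3,
    F x1 x2 x3 y1 (lb b y2) y3 = F x1 (rb l b x2) x3 y1 y2 y3;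
  adm3B4 : forall b x1 x2 x3 y1 y2 y3,
    F x1 x2 x3 y1 y2 (la b y3) = F x1 x2 (ra l b x3) y1 y2 y3 }.

Section Adm.
Variables (B : pzRingType) (I : Type) (C : coringData B I).
Hypothesis hC : coring C.
Variable A : zmodType.

Lemma adm_bal k (F : C -> C -> C -> C -> A) x : adm k F ->
  bal lb la (fun y1 y2 => 'S(x1, x2 <- x) F x1 x2 y1 y2).
Proof.
case=> hx h1 h2 b1 b2; split.
- by move=> y2; apply: adt_tsumf => x1 x2; exact: h1.
- by move=> y1; apply: adt_tsumf => x1 x2; exact: h2.
- move=> b y1 y2; under eq_tsum do rewrite b1.
  rewrite (S_tak hC (F := fun x1 x2 => F x1 x2 y1 y2)) //.
  by apply: eq_tsum => x1 x2; rewrite b2.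
Qed.

Lemma bal3_12 (F : C -> C -> C -> A) c : bal3 F -> bal lb la (fun a b => F a b c).
Proof. by case=> h1 h2 h3 b1 b2; split=> [n|m|b m n]; [exact: h1|exact: h2|exact: b1]. Qed.

Lemma bal3_23 (F : C -> C -> C -> A) a : bal3 F -> bal lb la (fun b c => F a b c).
Proof. by case=> h1 h2 h3 b1 b2; split=> [n|m|b m n]; [exact: h2|exact: h3|exact: b2]. Qed.

(** Balancing y1 against y2 uses the Takeuchi condition on the inner pair x1, x2. Balancing y2
    against y3 needs it on x2, x3, which become an inner pair only after rebracketing the sum by
    [e]. *)
Lemma adm3_bal3 k l (F : C -> C -> C -> C -> C -> C -> A) x : adm3 k l F ->
  bal3 (fun y1 y2 y3 =>
    'S(u, x3 <- x) 'S(x1, x2 <- u) F x1 x2 x3 y1 y2 y3).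
Proof.
move=> hF.
have e y1 y2 y3 := coass hC (adm3x hF y1 y2 y3) x.
split.
- by move=> y z; do 2 (apply: adt_tsumf => ? ?); exact: (adm3D1 hF).
- by move=> y z; do 2 (apply: adt_tsumf => ? ?); exact: (adm3D2 hF).
- by move=> y z; do 2 (apply: adt_tsumf => ? ?); exact: (adm3D3 hF).
- move=> b y1 y2 y3; apply: eq_tsum => u x3.
  under eq_tsum do rewrite (adm3B1 hF).
  rewrite (S_tak hC (F := fun x1 x2 => F x1 x2 x3 y1 y2 y3)); last first.
    exact: (bal3_12 _ (adm3x hF _ _ _)).
  by apply: eq_tsum => *; rewrite (adm3B2 hF).
- move=> b y1 y2 y3; rewrite [LHS]e [RHS]e; apply: eq_tsum => x1 u.
  under eq_tsum do rewrite (adm3B3 hF).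
  rewrite (S_tak hC (F := fun x2 x3 => F x1 x2 x3 y1 y2 y3)); last first.
    exact: (bal3_23 _ (adm3x hF _ _ _)).
  by apply: eq_tsum => *; rewrite (adm3B4 hF).
Qed.

Lemma adm3_coass k l (F : C -> C -> C -> C -> C -> C -> A) x y : adm3 k l F ->
  'S(v, y3 <- y) 'S(y1, y2 <- v) 'S(u, x3 <- x) 'S(x1, x2 <- u) F x1 x2 x3 y1 y2 y3
  = 'S(y1, v <- y) 'S(y2, y3 <- v) 'S(x1, u <- x) 'S(x2, x3 <- u) F x1 x2 x3 y1 y2 y3.
Proof.
move=> hF; rewrite (coass hC (adm3_bal3 x hF)).
do 2 (apply: eq_tsum => ? ?).
exact: (coass hC (adm3x hF _ _ _)).
Qed.

End Adm.

(** * Convolution of functions of two variables *)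

Section PairFunctions.
Variables (B : pzRingType) (I : Type) (C : coringData B I).
Hypothesis hC : coring C.

(* A function of type (i, j), such as the product ._ij, satisfies the left half [lpf i]
   and the right half [rpf j]; only the halves that meet matter in a convolution. *)
Record lpf (i : I) (A : zmodType) (laA : B -> A -> A) (f : C -> C -> A) : Prop := Lpf {
  lpfDl : forall y, adt (fun x => f x y);
  lpfDr : forall x, adt (f x);
  lpf_la : forall b x y, f (la b x) y = laA b (f x y);
  lpf_ra : forall b x y, f (ra i b x) y = f x (la b y) }.

Record rpf (j : I) (A : zmodType) (lbA : B -> A -> A) (f : C -> C -> A) : Prop := Rpf {
  rpfDl : forall y, adt (fun x => f x y);
  rpfDr : forall x, adt (f x);
  rpf_lb : forall b x y, f (lb b x) y = lbA b (f x y);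
  rpf_rb : forall b x y, f (rb j b x) y = f x (lb b y) }.

(** The sum over x has to be the inner one: it is what makes the summand balanced in y1 and y2, see
    [adm_bal]. The operation [op] may be the product of B, an action of B or the formation of a pure
    tensor. *)
Definition conv (A1 A2 A : zmodType) (op : A1 -> A2 -> A) (f : C -> C -> A1)
    (g : C -> C -> A2) (x y : C) : A :=
  'S(y1, y2 <- y) 'S(x1, x2 <- x) op (f x1 y1) (g x2 y2).

Lemma eq_conv (A1 A2 A : zmodType) (op : A1 -> A2 -> A) f f' g g' x y :
  f =2 f' -> g =2 g' -> conv op f g x y = conv op f' g' x y.
Proof. by move=> e e'; do 2 (apply: eq_tsum => ? ?); rewrite e e'. Qed.

Lemma conv_adm (A1 A2 A : zmodType) (lbA1 : B -> A1 -> A1) (laA2 : B -> A2 -> A2)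
    (op : A1 -> A2 -> A) k f g :
  rpf k lbA1 f -> lpf k laA2 g -> bal lbA1 laA2 op ->
  adm k (fun x1 x2 y1 y2 => op (f x1 y1) (g x2 y2)).
Proof.
move=> hf hg ho; split.
- move=> y1 y2; split=> [n|m|b m n].
  + exact: (adt_comp (balDl ho _) (rpfDl hf _)).
  + exact: (adt_comp (balDr ho _) (lpfDl hg _)).
  + by rewrite (rpf_lb hf) (balB ho) (lpf_la hg).
- by move=> *; exact: (adt_comp (balDl ho _) (rpfDr hf _)).
- by move=> *; exact: (adt_comp (balDr ho _) (lpfDr hg _)).
- by move=> *; rewrite (rpf_rb hf).
- by move=> *; rewrite (lpf_ra hg).
Qed.

Section ConvPf.
Variables (A1 A2 A : zmodType) (lbA1 : B -> A1 -> A1) (laA2 : B -> A2 -> A2).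
Variables (op : A1 -> A2 -> A) (k : I) (f : C -> C -> A1) (g : C -> C -> A2).
Hypotheses (hf : rpf k lbA1 f) (hg : lpf k laA2 g) (ho : bal lbA1 laA2 op).

Let hadm := conv_adm hf hg ho.

Lemma convDr x : adt (conv op f g x).
Proof. exact: (SD hC (adm_bal hC x hadm)). Qed.

Lemma convDl y : adt (fun x => conv op f g x y).
Proof. by apply: adt_tsumf => y1 y2; exact: (SD hC (admx hadm y1 y2)). Qed.

Lemma conv_lpf i laA1 laA : lpf i laA1 f -> (forall b, adt (laA b)) ->
  (forall b a1 a2, op (laA1 b a1) a2 = laA b (op a1 a2)) ->
  lpf i laA (conv op f g).
Proof.
move=> hf' haA hop; split; [exact: convDl|exact: convDr|..] => b x y.
- rewrite /conv (tsum_adt _ _ (haA b)); apply: eq_tsum => y1 y2.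
  rewrite (S_la hC _ _ (admx hadm y1 y2)) (tsum_adt _ _ (haA b)).
  by apply: eq_tsum => *; rewrite (lpf_la hf') hop.
- rewrite /conv (S_la hC _ _ (adm_bal hC x hadm)); apply: eq_tsum => y1 y2.
  rewrite (S_ra hC _ _ _ (admx hadm y1 y2)).
  by apply: eq_tsum => *; rewrite (lpf_ra hf').
Qed.

Lemma conv_rpf j lbA2 lbA : rpf j lbA2 g -> (forall b, adt (lbA b)) ->
  (forall b a1 a2, op a1 (lbA2 b a2) = lbA b (op a1 a2)) ->
  rpf j lbA (conv op f g).
Proof.
move=> hg' haA hop; split; [exact: convDl|exact: convDr|..] => b x y.
- rewrite /conv (tsum_adt _ _ (haA b)); apply: eq_tsum => y1 y2.
  rewrite (S_lb hC _ _ (admx hadm y1 y2)) (tsum_adt _ _ (haA b)).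
  by apply: eq_tsum => *; rewrite (rpf_lb hg') hop.
- rewrite /conv (S_lb hC _ _ (adm_bal hC x hadm)); apply: eq_tsum => y1 y2.
  rewrite (S_rb hC _ _ _ (admx hadm y1 y2)).
  by apply: eq_tsum => *; rewrite (rpf_rb hg').
Qed.

Section Product.
Variables p q m : C -> C -> C.
Hypothesis hm : forall x y,
  cD (m x y) = 'S(y1, y2 <- y) 'S(x1, x2 <- x) p x1 y1 ⊠ q x2 y2.

Lemma S_prod (F : C -> C -> A) x y : bal lb la F ->
  'S(u, v <- m x y) F u v = 'S(y1, y2 <- y) 'S(x1, x2 <- x) F (p x1 y1) (q x2 y2).
Proof.
move=> hF; rewrite hm tsum_tsum //; apply: eq_tsum => y1 y2.
rewrite tsum_tsum //; apply: eq_tsum => x1 x2.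
by rewrite tsum_pure.
Qed.

Lemma conv_prodl x y z : conv op f g (m x y) z =
  'S(z1, z2 <- z) 'S(y1, y2 <- y) 'S(x1, x2 <- x)
    op (f (p x1 y1) z1) (g (q x2 y2) z2).
Proof.
apply: eq_tsum => z1 z2.
exact: (S_prod _ _ (admx hadm z1 z2)).
Qed.

Lemma conv_prodr x y z : conv op f g x (m y z) =
  'S(z1, z2 <- z) 'S(y1, y2 <- y) 'S(x1, x2 <- x)
    op (f x1 (p y1 z1)) (g x2 (q y2 z2)).
Proof. exact: (S_prod _ _ (adm_bal hC x hadm)). Qed.

End Product.
End ConvPf.

Section ConvA.
Variables (A1 A2 A3 A12 A23 A : zmodType) (lbA1 : B -> A1 -> A1).
Variables (laA2 lbA2 : B -> A2 -> A2) (laA3 : B -> A3 -> A3).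
Variables (op1 : A1 -> A2 -> A12) (op2 : A12 -> A3 -> A) (op3 : A2 -> A3 -> A23).
Variables (op4 : A1 -> A23 -> A).
Hypotheses (h1 : bal lbA1 laA2 op1) (h3 : bal lbA2 laA3 op3).
Hypotheses (h2l : forall a, adt (fun x => op2 x a)) (h2r : forall a, adt (op2 a)).
Hypothesis h4r : forall a, adt (op4 a).
Hypothesis hA : forall a b c, op2 (op1 a b) c = op4 a (op3 b c).
Variables (k l : I).

(** The values may be scalars, elements or tensors, whence four operations tied together by [hA].
    Only the middle factor meets a neighbour on each side, so it alone carries both halves of a
    type. *)
Lemma convA f g h x y : rpf k lbA1 f -> lpf k laA2 g -> rpf l lbA2 g ->
  lpf l laA3 h ->
  conv op2 (conv op1 f g) h x y = conv op4 f (conv op3 g h) x y.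
Proof.
move=> hf hg hg' hh.
pose F x1 x2 x3 y1 y2 y3 := op2 (op1 (f x1 y1) (g x2 y2)) (h x3 y3).
have hF : adm3 k l F.
  split.
  - move=> y1 y2 y3; split; rewrite /F => *.
    + exact: (adt_comp (h2l _) (adt_comp (balDl h1 _) (rpfDl hf _))).
    + exact: (adt_comp (h2l _) (adt_comp (balDr h1 _) (lpfDl hg _))).
    + exact: (adt_comp (h2r _) (lpfDl hh _)).
    + by rewrite (rpf_lb hf) (balB h1) (lpf_la hg).
    + by rewrite !hA (rpf_lb hg') (balB h3) (lpf_la hh).
  - by move=> *; exact: (adt_comp (h2l _) (adt_comp (balDl h1 _) (rpfDr hf _))).
  - by move=> *; exact: (adt_comp (h2l _) (adt_comp (balDr h1 _) (lpfDr hg _))).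
  - by move=> *; exact: (adt_comp (h2r _) (lpfDr hh _)).
  - by move=> *; rewrite /F (rpf_rb hf).
  - by move=> *; rewrite /F (lpf_ra hg).
  - by move=> *; rewrite /F (rpf_rb hg').
  - by move=> *; rewrite /F (lpf_ra hh).
transitivity ('S(v, y3 <- y) 'S(y1, y2 <- v) 'S(u, x3 <- x) 'S(x1, x2 <- u)
    F x1 x2 x3 y1 y2 y3).
  apply: eq_tsum => v y3.
  rewrite -tsum_exch; apply: eq_tsum => u x3.
  rewrite (tsum_adt _ _ (h2l _)); apply: eq_tsum => y1 y2.
  by rewrite (tsum_adt _ _ (h2l _)).
rewrite (adm3_coass hC x y hF); apply: eq_tsum => y1 v.
rewrite tsum_exch; apply: eq_tsum => x1 u.
rewrite (tsum_adt _ _ (h4r _)); apply: eq_tsum => y2 y3.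
rewrite (tsum_adt _ _ (h4r _)); apply: eq_tsum => x2 x3.
exact: hA.
Qed.

End ConvA.

Lemma rb_sum i b (x : C) : rb i b x = 'S(u, v <- x) lb (ce (rb i b v)) u.
Proof.
rewrite -{1}(counr hC (rb i b x)) (S_rb hC) //.
split=> *.
- exact: (lbDr hC).
- by apply: (adt_comp (lbDl hC _) (ceD hC)).
- by rewrite (ce_la hC) (lbM hC).
Qed.

Section Unit.
Variables (i : I) (A : zmodType) (aA : B -> A -> A) (f e : C -> C -> A).
Variable c : C -> C -> B.
Hypothesis hc : forall x y, c x y = ce (ra i (ce y) x).

(** The scalar eps(x_(1) eps(y_(1))) is absorbed into the second factor as f(x eps(y_(1)), y_(2)) =
    f(x, eps(y_(1)) y_(2)), and the counit law for y finishes. *)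
Lemma conv_unitl x y : lpf i aA f -> conv aA c f x y = f x y.
Proof.
move=> hf; rewrite -[RHS](counlF hC _ (lpfDr hf x)); apply: eq_tsum => y1 y2.
rewrite -(lpf_ra hf) (ra_sum hC) (tsum_adt _ _ (lpfDl hf y2)).
by apply: eq_tsum => x1 x2; rewrite hc (lpf_la hf).
Qed.

Lemma conv_unitr x y : rpf i aA f -> conv (fun a b => aA b a) f c x y = f x y.
Proof.
move=> hf; rewrite -[RHS](counrF hC _ (rpfDr hf x)); apply: eq_tsum => y1 y2.
rewrite -(rpf_rb hf) rb_sum (tsum_adt _ _ (rpfDl hf y1)).
by apply: eq_tsum => x1 x2; rewrite hc (rpf_lb hf) (ce_rarb hC).
Qed.

End Unit.

Section Triple.
Record lpf3 (i : I) (f : C -> C -> C -> B) : Prop := Lpf3 {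
  lpf3D1 : forall y z, adt (fun x => f x y z);
  lpf3D2 : forall x z, adt (fun y => f x y z);
  lpf3D3 : forall x y, adt (fun z => f x y z);
  lpf3_la : forall b x y z, f (la b x) y z = b * f x y z;
  lpf3_ra1 : forall b x y z, f (ra i b x) y z = f x (la b y) z;
  lpf3_ra2 : forall b x y z, f x (ra i b y) z = f x y (la b z) }.

Record rpf3 (j : I) (f : C -> C -> C -> B) : Prop := Rpf3 {
  rpf3D1 : forall y z, adt (fun x => f x y z);
  rpf3D2 : forall x z, adt (fun y => f x y z);
  rpf3D3 : forall x y, adt (fun z => f x y z);
  rpf3_lb : forall b x y z, f (lb b x) y z = f x y z * b;
  rpf3_rb1 : forall b x y z, f (rb j b x) y z = f x (lb b y) z;
  rpf3_rb2 : forall b x y z, f x (rb j b y) z = f x y (lb b z) }.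

Definition conv3 (f g : C -> C -> C -> B) x y z : B :=
  'S(z1, z2 <- z) 'S(y1, y2 <- y) 'S(x1, x2 <- x) f x1 y1 z1 * g x2 y2 z2.

Lemma eq_conv3 f f' g g' x y z : (forall x y z, f x y z = f' x y z) ->
  (forall x y z, g x y z = g' x y z) -> conv3 f g x y z = conv3 f' g' x y z.
Proof. by move=> e e'; do 3 (apply: eq_tsum => ? ?); rewrite e e'. Qed.

(** Coassociativity in pairs is used twice: with the z's fixed, summing over x makes [F] balanced in
    the y's, and the resulting [F'] is again admissible, now for the y's against the z's. *)
Lemma conv3A k l f g h x y z : rpf3 k f -> lpf3 k g -> rpf3 l g -> lpf3 l h ->
  conv3 (conv3 f g) h x y z = conv3 f (conv3 g h) x y z.
Proof.
move=> hf hg hg' hh.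
pose F z1 z2 z3 x1 x2 x3 y1 y2 y3 := f x1 y1 z1 * g x2 y2 z2 * h x3 y3 z3.
have hF z1 z2 z3 : adm3 k l (F z1 z2 z3).
  split.
  - move=> y1 y2 y3; split; rewrite /F => *.
    + exact: (adt_comp (adt_mull _) (adt_comp (adt_mull _) (rpf3D1 hf _ _))).
    + exact: (adt_comp (adt_mull _) (adt_comp (adt_mulr _) (rpf3D1 hg' _ _))).
    + exact: (adt_comp (adt_mulr _) (lpf3D1 hh _ _)).
    + by rewrite (rpf3_lb hf) (lpf3_la hg) !mulrA.
    + by rewrite (rpf3_lb hg') (lpf3_la hh) !mulrA.
  - move=> *; exact: (adt_comp (adt_mull _) (adt_comp (adt_mull _) (rpf3D2 hf _ _))).
  - move=> *; exact: (adt_comp (adt_mull _) (adt_comp (adt_mulr _) (rpf3D2 hg' _ _))).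
  - move=> *; exact: (adt_comp (adt_mulr _) (lpf3D2 hh _ _)).
  - by move=> *; rewrite /F (rpf3_rb1 hf).
  - by move=> *; rewrite /F (lpf3_ra1 hg).
  - by move=> *; rewrite /F (rpf3_rb1 hg').
  - by move=> *; rewrite /F (lpf3_ra1 hh).
pose F' y1 y2 y3 z1 z2 z3 :=
  'S(u, x3 <- x) 'S(x1, x2 <- u) F z1 z2 z3 x1 x2 x3 y1 y2 y3.
have hF' : adm3 k l F'.
  split.
  - by move=> z1 z2 z3; exact: (adm3_bal3 hC x (hF z1 z2 z3)).
  - move=> *; do 2 (apply: adt_tsumf => ? ?).
    exact: (adt_comp (adt_mull _) (adt_comp (adt_mull _) (rpf3D3 hf _ _))).
  - move=> *; do 2 (apply: adt_tsumf => ? ?).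
    exact: (adt_comp (adt_mull _) (adt_comp (adt_mulr _) (rpf3D3 hg' _ _))).
  - move=> *; do 2 (apply: adt_tsumf => ? ?).
    exact: (adt_comp (adt_mulr _) (lpf3D3 hh _ _)).
  - by move=> *; do 2 (apply: eq_tsum => ? ?); rewrite /F (rpf3_rb2 hf).
  - by move=> *; do 2 (apply: eq_tsum => ? ?); rewrite /F (lpf3_ra2 hg).
  - by move=> *; do 2 (apply: eq_tsum => ? ?); rewrite /F (rpf3_rb2 hg').
  - by move=> *; do 2 (apply: eq_tsum => ? ?); rewrite /F (lpf3_ra2 hh).
transitivity ('S(w, z3 <- z) 'S(z1, z2 <- w) 'S(v, y3 <- y) 'S(y1, y2 <- v)
    F' y1 y2 y3 z1 z2 z3).
  apply: eq_tsum => w z3.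
  rewrite [RHS]tsum_exch; apply: eq_tsum => v y3.
  under [RHS]eq_tsum do rewrite tsum_exch.
  rewrite [RHS]tsum_exch; apply: eq_tsum => u x3.
  rewrite /conv3 (tsum_adt _ _ (adt_mull _)); apply: eq_tsum => z1 z2.
  rewrite (tsum_adt _ _ (adt_mull _)); apply: eq_tsum => y1 y2.
  by rewrite (tsum_adt _ _ (adt_mull _)).
rewrite (adm3_coass hC y z hF'); apply: eq_tsum => z1 w.
rewrite tsum_exch; apply: eq_tsum => y1 v.
transitivity ('S(z2, z3 <- w) 'S(y2, y3 <- v) 'S(x1, u <- x) 'S(x2, x3 <- u)
    F z1 z2 z3 x1 x2 x3 y1 y2 y3).
  do 2 (apply: eq_tsum => ? ?).
  exact: (coass hC (adm3x (hF _ _ _) _ _ _)).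
under eq_tsum do rewrite tsum_exch.
rewrite tsum_exch; apply: eq_tsum => x1 u.
rewrite /conv3 (tsum_adt _ _ (adt_mulr _)); apply: eq_tsum => z2 z3.
rewrite (tsum_adt _ _ (adt_mulr _)); apply: eq_tsum => y2 y3.
rewrite (tsum_adt _ _ (adt_mulr _)); apply: eq_tsum => x2 x3.
by rewrite /F mulrA.
Qed.

End Triple.
End PairFunctions.

(* A connected cogroupoid all of whose objects are the coring C. *)
Record mult (B : pzRingType) (I : Type) (C : coringData B I)
    (m : I -> I -> C -> C -> C) : Prop := Mult {
  m_lpf : forall i j, lpf i la (m i j);
  m_rpf : forall i j, rpf j lb (m i j);
  mA : forall i j x y z, m i j x (m i j y z) = m i j (m i j x y) z;
  m1l : forall i j x, m i j c1 x = x;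
  m1r : forall i j x, m i j x c1 = x;
  cD_m : forall k i j x y, cD (m i j x y) = conv tpr (m i k) (m k j) x y;
  ce_m : forall i x y, ce (m i i x y) = ce (ra i (ce y) x) }.

(** * Twisting a product *)

Section Twisting.
Variables (B : pzRingType) (I : Type) (C : coringData B I).
Hypothesis hC : coring C.
Variables (o : I) (m : C -> C -> C) (c : I -> I -> C -> C -> B).

Local Notation mulB := (fun x y : B => x * y).
Local Notation lmulB := (fun b a : B => b * a).
Local Notation rmulB := (fun b a : B => a * b).
Local Notation lbop := (fun (v : C) b => lb b v).

Hypotheses (hml : lpf o la m) (hmr : rpf o lb m).
Hypothesis hmA : forall x y z, m x (m y z) = m (m x y) z.
Hypothesis hm1l : forall x, m c1 x = x.
Hypothesis hm1r : forall x, m x c1 = x.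
Hypothesis hmD : forall x y, cD (m x y) = conv tpr m m x y.
Hypothesis hmc : forall x y, ce (m x y) = c o o x y.
Hypothesis hcl : forall i j, lpf i lmulB (c i j).
Hypothesis hcr : forall i j, rpf j rmulB (c i j).
Hypothesis hcc : forall i k j x y, conv mulB (c i k) (c k j) x y = c i j x y.
Hypothesis hcd : forall i x y, c i i x y = ce (ra i (ce y) x).
Hypothesis hc1l : forall i j x, c i j c1 x = ce x.
Hypothesis hc1r : forall i j x, c i j x c1 = ce x.

(* [mtw i j] is c_io * m * c_oj. *)
Definition ltw i := conv la (c i o) m.
Definition rtw j := conv lbop m (c o j).
Definition mtw i j := conv lbop (ltw i) (c o j).

(** For i = o this is associativity of [m] seen through the counit. For the other index of the
    application it is the cocycle condition on Gamma. The conditions on the c_oi are deduced in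
    [coc_inv]. *)
Hypothesis hco : forall i x y z, c i o (ltw i x y) z = c i o x (ltw i y z).

Let laDr' := laDr hC. Let laDl' := laDl hC.
Let lbDr' := lbDr hC. Let lbDl' := lbDl hC.

Lemma bal_mul : bal rmulB lmulB mulB.
Proof. by split=> [n|m'|b m' n]; [exact: adt_mull|exact: adt_mulr|rewrite mulrA]. Qed.

Lemma bal_laop : bal rmulB la (la : B -> C -> C).
Proof. by split=> *; [exact: laDl'|exact: laDr'|rewrite (laM hC)]. Qed.

Lemma bal_lbop : bal lb lmulB lbop.
Proof. by split=> *; [exact: lbDr'|exact: lbDl'|rewrite (lbM hC)]. Qed.

Lemma bal_pure : bal lb la (fun u v : C => u ⊠ v : tens lb la).
Proof. exact: bal_tpr. Qed.

Let laT b : tens lb la -> tens lb la := tsum (fun u v : C => la b u ⊠ v).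
Let lbT b : tens lb la -> tens lb la := tsum (fun u v : C => u ⊠ lb b v).

Let bal_laT b : bal lb la (fun u v : C => la b u ⊠ v : tens lb la).
Proof.
split=> [n|u|b' u v].
- by apply: (adt_comp (adt_tprl _ _ _)).
- exact: adt_tprr.
- by rewrite (la_lb hC) tpr_bal.
Qed.

Let bal_lbT b : bal lb la (fun u v : C => u ⊠ lb b v : tens lb la).
Proof.
split=> [n|u|b' u v].
- exact: adt_tprl.
- by apply: (adt_comp (adt_tprr _ _ _)).
- by rewrite -(la_lb hC) tpr_bal.
Qed.

Lemma ltw_lpf i : lpf i la (ltw i).
Proof.
apply: (conv_lpf hC (hcr i o) hml bal_laop (hcl i o)) => //.
by move=> *; rewrite (laM hC).
Qed.

Lemma ltw_rpf i : rpf o lb (ltw i).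
Proof.
apply: (conv_rpf hC (hcr i o) hml bal_laop hmr) => //.
by move=> *; rewrite (la_lb hC).
Qed.

Lemma rtw_lpf i : lpf o la (rtw i).
Proof.
apply: (conv_lpf hC hmr (hcl o i) bal_lbop hml) => //.
by move=> *; rewrite (la_lb hC).
Qed.

Lemma rtw_rpf i : rpf i lb (rtw i).
Proof.
apply: (conv_rpf hC hmr (hcl o i) bal_lbop (hcr o i)) => //.
by move=> *; rewrite (lbM hC).
Qed.

Lemma mtw_lpf i j : lpf i la (mtw i j).
Proof.
apply: (conv_lpf hC (ltw_rpf i) (hcl o j) bal_lbop (ltw_lpf i)) => //.
by move=> *; rewrite (la_lb hC).
Qed.

Lemma mtw_rpf i j : rpf j lb (mtw i j).
Proof.
apply: (conv_rpf hC (ltw_rpf i) (hcl o j) bal_lbop (hcr o j)) => //.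
by move=> *; rewrite (lbM hC).
Qed.

Lemma mtwE i j x y : mtw i j x y = conv la (c i o) (rtw j) x y.
Proof.
apply: (@convA _ _ _ hC _ _ _ _ _ _ rmulB la lb lmulB la lbop lbop la bal_laop
  bal_lbop _ _ _ _ o o _ _ _ _ _ (hcr i o) hml hmr (hcl o j)) => //.
by move=> *; rewrite (la_lb hC).
Qed.

Lemma ltwoE x y : ltw o x y = m x y.
Proof. exact: (conv_unitl hC (hcd o)). Qed.

Lemma rtwoE x y : rtw o x y = m x y.
Proof. exact: (conv_unitr hC (hcd o)). Qed.

Lemma mtw_o_r i x y : mtw i o x y = ltw i x y.
Proof. exact: (conv_unitr hC (hcd o) _ _ (ltw_rpf i)). Qed.

Lemma mtw_o_l j x y : mtw o j x y = rtw j x y.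
Proof. by rewrite mtwE (conv_unitl hC (hcd o) _ _ (rtw_lpf j)). Qed.

Lemma cD_ltw i x y : cD (ltw i x y) = conv tpr (ltw i) m x y.
Proof.
rewrite (@convA _ _ _ hC _ _ _ _ _ _ rmulB la lb la la tpr tpr laT bal_laop
  bal_pure _ _ _ _ o o) //; first 1 last.
- by move=> a; exact: adt_tprl.
- by move=> a; exact: adt_tprr.
- by move=> b; apply: adt_tsum.
- by move=> *; rewrite /laT tsum_pure.
rewrite /ltw /conv (tsum_adt _ _ (cDD hC)); apply: eq_tsum => y1 y2.
rewrite (tsum_adt _ _ (cDD hC)); apply: eq_tsum => x1 x2.
by rewrite (cD_la hC) hmD.
Qed.

Lemma cD_mtw_o i j x y : cD (mtw i j x y) = conv tpr (ltw i) (rtw j) x y.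
Proof.
rewrite -(@convA _ _ _ hC _ _ _ _ _ _ lb la lb lmulB tpr (fun z b => lbT b z) lbop tpr
  bal_pure bal_lbop _ _ _ _ o o) //; first last.
- exact: ltw_rpf.
- by move=> *; rewrite /lbT tsum_pure.
- by move=> a; exact: adt_tprr.
- by move=> z; apply: adt_tsumf => u v; exact: (adt_comp (adt_tprr _ _ _)).
- by move=> b; apply: adt_tsum.
rewrite /mtw /conv (tsum_adt _ _ (cDD hC)); apply: eq_tsum => y1 y2.
rewrite (tsum_adt _ _ (cDD hC)); apply: eq_tsum => x1 x2.
by rewrite (cD_lb hC) /lbT -/(conv _ _ _ _ _) -cD_ltw.
Qed.

(** By [cD_mtw_o] the coproduct is the convolution of c_io * m with m * c_oj. Inserting the unit
    c_oo = c_ok * c_ko between them completes the two factors to m_ik and m_kj. *)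
Lemma cD_mtw k i j x y : cD (mtw i j x y) = conv tpr (mtw i k) (mtw k j) x y.
Proof.
rewrite cD_mtw_o.
rewrite (@convA _ _ _ hC _ _ _ _ _ _ lb lmulB rmulB la lbop tpr la tpr
  bal_lbop bal_laop _ _ _ _ o k _ _ _ _ _ (ltw_rpf i) (hcl o k) (hcr o k)
  (mtw_lpf k j)) //; first last.
- by move=> *; rewrite tpr_bal.
- by move=> a; exact: adt_tprr.
- by move=> a; exact: adt_tprr.
- by move=> a; exact: adt_tprl.
apply: eq_conv => // u v; apply/esym.
transitivity (conv la (c o k) (conv la (c k o) (rtw j)) u v).
  by apply: eq_conv => // ? ?; exact: mtwE.
rewrite -(@convA _ _ _ hC _ _ _ _ _ _ rmulB lmulB rmulB la mulB la la la
  bal_mul bal_laop _ _ _ _ k o _ _ _ _ _ (hcr o k) (hcl k o) (hcr k o)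
  (rtw_lpf j)) //; last by move=> *; rewrite (laM hC).
rewrite -[RHS](conv_unitl hC (hcd o) _ _ (rtw_lpf j)).
by apply: eq_conv => // ? ?; exact: hcc.
Qed.

Lemma ce_mtw i j x y : ce (mtw i j x y) = c i j x y.
Proof.
have e x' y' : ce (ltw i x' y') = c i o x' y'.
  rewrite -(hcc _ o) /ltw /conv (tsum_adt _ _ (ceD hC)); apply: eq_tsum => ? ?.
  rewrite (tsum_adt _ _ (ceD hC)); apply: eq_tsum => ? ?.
  by rewrite (ce_la hC) hmc.
rewrite -(hcc _ o) /mtw /conv (tsum_adt _ _ (ceD hC)); apply: eq_tsum => ? ?.
rewrite (tsum_adt _ _ (ceD hC)); apply: eq_tsum => ? ?.
by rewrite (ce_lb hC) e.
Qed.

Lemma ltw1l i y : ltw i c1 y = y.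
Proof.
rewrite /ltw /conv -[RHS](counl hC); apply: eq_tsum => y1 y2.
rewrite (S_c1 hC) ?hc1l ?hm1l //.
exact: (admx (conv_adm (hcr i o) hml bal_laop)).
Qed.

Lemma ltw1r i x : ltw i x c1 = x.
Proof.
rewrite /ltw /conv (S_c1 hC); last exact: (adm_bal hC x (conv_adm (hcr i o) hml bal_laop)).
rewrite -[RHS](counl hC); apply: eq_tsum => x1 x2.
by rewrite hc1r hm1r.
Qed.

Lemma mtw1l i j y : mtw i j c1 y = y.
Proof.
rewrite /mtw /conv -[RHS](counr hC); apply: eq_tsum => y1 y2.
rewrite (S_c1 hC) ?hc1l ?ltw1l //.
exact: (admx (conv_adm (ltw_rpf i) (hcl o j) bal_lbop)).
Qed.

Lemma mtw1r i j x : mtw i j x c1 = x.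
Proof.
rewrite /mtw /conv (S_c1 hC); last exact: (adm_bal hC x (conv_adm (ltw_rpf i) (hcl o j) bal_lbop)).
rewrite -[RHS](counr hC); apply: eq_tsum => x1 x2.
by rewrite hc1r ltw1r.
Qed.

(** Right multiplication by b is multiplication by b 1, so this is associativity of [m] under the
    sum. *)
Lemma rtw_ra k b x y : rtw k x (ra o b y) = ra o b (rtw k x y).
Proof.
rewrite /rtw /conv (tsum_adt _ _ (raDr hC o b)) (S_ra hC); last first.
  exact: (adm_bal hC x (conv_adm hmr (hcl o k) bal_lbop)).
apply: eq_tsum => y1 y2; rewrite (tsum_adt _ _ (raDr hC o b)).
apply: eq_tsum => x1 x2; rewrite (ra_lb hC); congr lb.
have e u : ra o b u = m u (la b c1) by rewrite -(lpf_ra hml) hm1r.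
by rewrite !e hmA.
Qed.

Lemma c_la1 i j b x : c i j x (la b c1) = ce (ra i b x).
Proof. by rewrite -(lpf_ra (hcl i j)) hc1r. Qed.

(** Required before [mtw k k] is known to be associative. Only the scalar [ce z] matters, so z is
    replaced by a multiple of the unit; then [hco] applies and the unit is absorbed into y. *)
Lemma c_mtw k x y z : c k k (mtw k k x y) z = c k k x (ra k (ce z) y).
Proof.
rewrite hcd -(c_la1 _ o) -[RHS](hcc _ o) /conv (S_ra hC); last first.
  exact: (adm_bal hC x (conv_adm (hcr k o) (hcl o k) bal_mul)).
rewrite /mtw /conv (tsum_adt _ _ (lpfDl (hcl k o) _)); apply: eq_tsum => y1 y2.
rewrite (tsum_adt _ _ (lpfDl (hcl k o) _)); apply: eq_tsum => x1 x2.
rewrite (rpf_lb (hcr k o)) hco; congr (c _ _ _ _ * _).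
by rewrite -(lpf_ra (ltw_lpf k)) ltw1r.
Qed.

(* With d x y z = c_ok (x y, z) and e x y z = c_ok (x, y z), the cocycle condition for
   c_ko gives d = c_oo (x, y z) * d = e * c_ko (x, y z) * d = e * c_kk (x y, z) = e. *)
Lemma coc_inv k x y z : c o k (rtw k x y) z = c o k x (rtw k y z).
Proof.
pose d x y z := c o k (rtw k x y) z.
pose e x y z := c o k x (rtw k y z).
pose f x y z := c k o x (ltw k y z).
have ltwD := lpfDl (ltw_lpf k). have ltwD' := lpfDr (ltw_lpf k).
have rtwD := lpfDl (rtw_lpf k). have rtwD' := lpfDr (rtw_lpf k).
have hd : lpf3 o d.
  split; rewrite /d => *.
  - exact: (adt_comp (lpfDl (hcl o k) _)).
  - exact: (adt_comp (lpfDl (hcl o k) _)).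
  - exact: (lpfDr (hcl o k)).
  - by rewrite (lpf_la (rtw_lpf k)) (lpf_la (hcl o k)).
  - by rewrite (lpf_ra (rtw_lpf k)).
  - by rewrite rtw_ra (lpf_ra (hcl o k)).
have he : rpf3 k e.
  split; rewrite /e => *.
  - exact: (lpfDl (hcl o k)).
  - exact: (adt_comp (lpfDr (hcl o k) _)).
  - exact: (adt_comp (lpfDr (hcl o k) _)).
  - by rewrite (rpf_lb (hcr o k)).
  - by rewrite (rpf_rb (hcr o k)) (rpf_lb (rtw_rpf k)).
  - by rewrite (rpf_rb (rtw_rpf k)).
have hf : lpf3 k f.
  split; rewrite /f => *.
  - exact: (lpfDl (hcl k o)).
  - exact: (adt_comp (lpfDr (hcl k o) _)).
  - exact: (adt_comp (lpfDr (hcl k o) _)).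
  - by rewrite (lpf_la (hcl k o)).
  - by rewrite (lpf_ra (hcl k o)) (lpf_la (ltw_lpf k)).
  - by rewrite (lpf_ra (ltw_lpf k)).
have hf' : rpf3 o f.
  split; rewrite /f => *.
  - exact: (lpfDl (hcl k o)).
  - exact: (adt_comp (lpfDr (hcl k o) _)).
  - exact: (adt_comp (lpfDr (hcl k o) _)).
  - by rewrite (rpf_lb (hcr k o)).
  - by rewrite (rpf_rb (hcr k o)) (rpf_lb (ltw_rpf k)).
  - by rewrite (rpf_rb (ltw_rpf k)).
have Dr x' y' : cD (rtw k x' y') = conv tpr m (rtw k) x' y'.
  rewrite -mtw_o_l (cD_mtw o); apply: eq_conv => ? ?.
    by rewrite mtw_o_l rtwoE.
  by rewrite mtw_o_l.
have Dm x' y' : cD (m x' y') = conv tpr (rtw k) (ltw k) x' y'.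
  rewrite -rtwoE -mtw_o_l (cD_mtw k); apply: eq_conv => ? ?.
    by rewrite mtw_o_l.
  by rewrite mtw_o_r.
have Dk x' y' : cD (mtw k k x' y') = conv tpr (ltw k) (rtw k) x' y'.
  exact: cD_mtw_o.
transitivity (conv3 (fun x y z => c o o x (m y z)) d x y z).
  rewrite -(hcc _ o) (conv_prodl (hcr o o) (hcl o k) bal_mul Dr).
  do 3 (apply: eq_tsum => ? ?); congr (_ * _).
  by rewrite -!ltwoE hco.
transitivity (conv3 (conv3 e f) d x y z).
  apply: eq_conv3 => // x' y' z'.
  by rewrite -(hcc _ k) (conv_prodr hC (hcr o k) (hcl k o) bal_mul Dm).
rewrite (conv3A hC x y z he hf hf' hd).
transitivity (conv3 e (fun x y z => c k k (mtw k k x y) z) x y z).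
  apply: eq_conv3 => // x' y' z'.
  rewrite -(hcc _ o) (conv_prodl (hcr k o) (hcl o k) bal_mul Dk).
  by do 3 (apply: eq_tsum => ? ?); rewrite /f -hco.
(* It remains to contract the convolution of [e] with c_kk(x y, z). This is done one variable at a
   time: x by [h1], y by [rb_sum], z by the counit law. *)
have h1 u v : 'S(x1, x2 <- x) c o k x1 u * c k k x2 v = c o k x (lb (ce v) u).
  under eq_tsum do rewrite hcd.
  rewrite -(S_tak hC (F := fun x1 x2 => c o k x1 u * ce x2)); last first.
    split=> [?|?|? ? ?].
    - exact: (adt_comp (adt_mull _) (lpfDl (hcl o k) _)).
    - exact: (adt_comp (adt_mulr _) (ceD hC)).
    - by rewrite (rpf_lb (hcr o k)) (ce_la hC) mulrA.
  rewrite -[RHS](counrF hC _ (lpfDl (hcl o k) _)); apply: eq_tsum => x1 x2.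
  by rewrite (rpf_rb (hcr o k)) (rpf_lb (hcr o k)).
rewrite /conv3 /e.
transitivity ('S(z1, z2 <- z) 'S(y1, y2 <- y)
    c o k x (rtw k (lb (ce (rb k (ce z2) y2)) y1) z1)).
  do 2 (apply: eq_tsum => ? ?); rewrite (rpf_lb (rtw_rpf k)) -(ce_rarb hC) -h1.
  by apply: eq_tsum => ? ?; rewrite c_mtw.
rewrite -[RHS](counrF hC _ (adt_comp (lpfDr (hcl o k) x) (rtwD' y))).
apply: eq_tsum => z1 z2; rewrite -(rpf_rb (rtw_rpf k)) rb_sum //.
by rewrite (tsum_adt _ _ (adt_comp (lpfDr (hcl o k) x) (rtwD z1))).
Qed.

Lemma ltwA i x y z : ltw i x (ltw i y z) = ltw i (ltw i x y) z.
Proof.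
apply: etrans (conv_prodr hC (hcr i o) hml bal_laop (cD_ltw i) x y z) _.
apply/esym/(etrans (conv_prodl (hcr i o) hml bal_laop (cD_ltw i) x y z)).
by do 3 (apply: eq_tsum => ? ?); rewrite -hmA -hco.
Qed.

Theorem mult_mtw : mult mtw.
Proof.
split=> [i j|i j|i j x y z|i j x|i j x|k i j x y|i x y].
- exact: mtw_lpf.
- exact: mtw_rpf.
(* With m_ij = (c_io * m) * c_oj, the scalar factor is moved by the derived condition [coc_inv] and
   the other factor is associative by [ltwA], where the assumed condition [hco] enters. *)
- apply: etrans (conv_prodr hC (ltw_rpf i) (hcl o j) bal_lbop (cD_mtw_o i j) x y z) _.
  apply/esym/(etrans (conv_prodl (ltw_rpf i) (hcl o j) bal_lbop (cD_mtw_o i j) x y z)).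
  by do 3 (apply: eq_tsum => ? ?); rewrite coc_inv ltwA.
- exact: mtw1l.
- exact: mtw1r.
- exact: cD_mtw.
- by rewrite ce_mtw hcd.
Qed.

Lemma coc_mtw_o i x y z : c o i (mtw o i x y) z = c o i x (mtw o i y z).
Proof. by rewrite !mtw_o_l coc_inv. Qed.

End Twisting.

(** * Canonical maps and cleaving *)

Section Galois.
Variables (B : pzRingType) (I : Type) (C : coringData B I).
Hypothesis hC : coring C.
Variable m : I -> I -> C -> C -> C.
Hypothesis hm : mult m.

Local Notation mulB := (fun x y : B => x * y).
Local Notation lmulB := (fun b a : B => b * a).
Local Notation rmulB := (fun b a : B => a * b).
Local Notation lbop := (fun (v : C) b => lb b v).

Local Notation TD := (tens (@lb B I C) (@la B I C)).
Local Notation TL l := (tens (@rb B I C l) (@lb B I C)).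
Local Notation TR k := (tens (@ra B I C k) (@la B I C)).
Local Notation c i j := (fun x y => ce (m i j x y)).

Let laDr' := laDr hC. Let laDl' := laDl hC.
Let lbDr' := lbDr hC. Let lbDl' := lbDl hC.
Let raDr' := raDr hC. Let raDl' := raDl hC.
Let rbDr' := rbDr hC. Let rbDl' := rbDl hC.
Let ceD' := ceD hC. Let cDD' := cDD hC.
Let mDl' i j := lpfDl (m_lpf hm i j).
Let mDr' i j := lpfDr (m_lpf hm i j).
#[local] Hint Resolve laDr' laDl' lbDr' lbDl' raDr' raDl' rbDr' rbDl' ceD' cDD' mDl' mDr' : adt.

Lemma m_la i j b x y : m i j (la b x) y = la b (m i j x y).
Proof. by rewrite (lpf_la (m_lpf hm i j)). Qed.
Lemma m_lb i j b x y : m i j (lb b x) y = lb b (m i j x y).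
Proof. by rewrite (rpf_lb (m_rpf hm i j)). Qed.
Lemma m_ra i j b x y : m i j (ra i b x) y = m i j x (la b y).
Proof. by rewrite (lpf_ra (m_lpf hm i j)). Qed.
Lemma m_rb i j b x y : m i j (rb j b x) y = m i j x (lb b y).
Proof. by rewrite (rpf_rb (m_rpf hm i j)). Qed.

Lemma m_la1 i j b x : m i j x (la b c1) = ra i b x.
Proof. by rewrite -m_ra (m1r hm). Qed.
Lemma m_lb1 i j b x : m i j x (lb b c1) = rb j b x.
Proof. by rewrite -m_rb (m1r hm). Qed.

Lemma m_mra i j b x y : m i j x (ra i b y) = ra i b (m i j x y).
Proof. by rewrite -!(m_la1 i j) (mA hm). Qed.

Lemma rbM i b b' x : rb i b (rb i b' x : C) = rb i (b * b') x.
Proof. by rewrite -!(m_lb1 i i) -(mA hm) m_lb (m1l hm) (lbM hC). Qed.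

Lemma c_lpf i j : lpf i lmulB (c i j).
Proof.
split=> *; [by adt|by adt|by rewrite m_la (ce_la hC)|by rewrite m_ra].
Qed.

Lemma c_rpf i j : rpf j rmulB (c i j).
Proof.
split=> *; [by adt|by adt|by rewrite m_lb (ce_lb hC)|by rewrite m_rb].
Qed.

Lemma S_m k i j (A : zmodType) (F : C -> C -> A) x y : bal lb la F ->
  'S(u, v <- m i j x y) F u v
    = 'S(y1, y2 <- y) 'S(x1, x2 <- x) F (m i k x1 y1) (m k j x2 y2).
Proof. exact: (S_prod (cD_m hm k i j)). Qed.

(** The counit on the first factor of the coproduct of m_ij, which is split at k. A second counit
    gives c_ik * c_kj = c_ij. *)
Lemma m_convl i k j x y : m i j x y = conv la (c i k) (m k j) x y.
Proof.
rewrite -{1}(counl hC (m i j x y)) (S_m k) //.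
by split; [adt|adt|move=> *; rewrite (ce_lb hC) (laM hC)].
Qed.

Lemma m_convr i k j x y : m i j x y = conv lbop (m i k) (c k j) x y.
Proof.
rewrite -{1}(counr hC (m i j x y)) (S_m k) //.
by split; [adt|adt|move=> *; rewrite (ce_la hC) (lbM hC)].
Qed.

Definition lam k l : TL l -> TD :=
  tsum (fun x y => 'S(u, v <- x) u ⊠ m k l v y).

Definition mu k l : TR k -> TD :=
  tsum (fun x y => 'S(u, v <- x) m k l u y ⊠ v).

Arguments lam k l _ : clear implicits.
Arguments mu k l _ : clear implicits.

Lemma lam_bal0 k l y : bal lb la (fun u v : C => (u ⊠ m k l v y : TD)).
Proof. by split; [adt|adt|move=> *; rewrite m_la tpr_bal]. Qed.

Lemma mu_bal0 k l y : bal lb la (fun u v : C => (m k l u y ⊠ v : TD)).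
Proof. by split; [adt|adt|move=> *; rewrite m_lb tpr_bal]. Qed.

Lemma lam_bal k l : bal (rb l) lb
  (fun x y => 'S(u, v <- x) u ⊠ m k l v y : TD).
Proof.
split.
- by move=> y; exact: (SD hC (lam_bal0 k l y)).
- by adt.
- move=> b x y; rewrite (S_rb hC _ _ _ (lam_bal0 k l y)).
  by apply: eq_tsum => *; rewrite m_rb.
Qed.

Lemma mu_bal k l : bal (ra k) la
  (fun x y => 'S(u, v <- x) m k l u y ⊠ v : TD).
Proof.
split.
- by move=> y; exact: (SD hC (mu_bal0 k l y)).
- by adt.
- move=> b x y; rewrite (S_ra hC _ _ _ (mu_bal0 k l y)).
  by apply: eq_tsum => *; rewrite m_ra.
Qed.

Lemma adt_lam k l : adt (lam k l). Proof. exact: (adt_tsum (lam_bal k l)). Qed.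
Lemma adt_mu k l : adt (mu k l). Proof. exact: (adt_tsum (mu_bal k l)). Qed.

Lemma lam_pure k l x y : lam k l (x ⊠ y) = 'S(u, v <- x) u ⊠ m k l v y.
Proof. exact: (tsum_pure (lam_bal k l)). Qed.
Lemma mu_pure k l x y : mu k l (x ⊠ y) = 'S(u, v <- x) m k l u y ⊠ v.
Proof. exact: (tsum_pure (mu_bal k l)). Qed.

(** * Changing the second index of lambda by convolution with scalars *)

Section Change.
Variables (i j k : I).

Let lbL l b : TL l -> TL l := tsum (fun u v => lb b u ⊠ v).
Arguments lbL l b _ : clear implicits.

Let bal_lbL l b : bal (rb l) lb (fun u v : C => lb b u ⊠ v : TL l).
Proof. by split; [adt|adt|move=> *; rewrite -(rb_lb hC) tpr_bal]. Qed.

Let adt_lbL l b : adt (lbL l b). Proof. exact: (adt_tsum (bal_lbL l b)). Qed.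
Let adt_lbLl l z : adt (fun b => lbL l b z).
Proof. by rewrite /lbL; adt. Qed.
#[local] Hint Resolve adt_lbL adt_lbLl : adt.

Let lbLM l b b' z : lbL l b (lbL l b' z) = lbL l (b' * b) z.
Proof.
apply: (tens_ext (f := fun z => lbL l b (lbL l b' z)) (g := lbL l (b' * b))) z.
- by adt.
- by adt.
- by move=> u v; rewrite /lbL !tsum_pure ?(lbM hC).
Qed.

Let op l (z : TL l) b := lbL l b z.
Arguments op l z b : clear implicits.

Let bal_op l : bal (lbL l) lmulB (op l).
Proof. by split; [rewrite /op; adt|rewrite /op; adt|move=> *; rewrite /op lbLM]. Qed.

Let pure_rpf l : rpf l (lbL l) (fun u v : C => u ⊠ v : TL l).
Proof.
split; [by adt|by adt|by move=> *; rewrite /lbL tsum_pure|by move=> *; rewrite tpr_bal].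
Qed.

(* x (x) y |-> c_ll'(x_(2), y_(2)) acting by [lb] on x_(1), tensored with y_(1). *)
Let th l l' : TL l' -> TL l :=
  tsum (conv (op l) (fun u v : C => u ⊠ v) (c l l')).
Arguments th l l' _ : clear implicits.

Let th_rpf l l' : rpf l' (lbL l) (conv (op l) (fun u v : C => u ⊠ v) (c l l')).
Proof.
apply: (conv_rpf hC (pure_rpf l) (c_lpf l l') (bal_op l) (c_rpf l l')).
  by move=> b; adt.
by move=> b z a; rewrite /op lbLM.
Qed.

Let th_bal l l' : bal (rb l') lb (conv (op l) (fun u v : C => u ⊠ v) (c l l')).
Proof. by have [] := th_rpf l l'. Qed.

Let adt_th l l' : adt (th l l'). Proof. exact: (adt_tsum (th_bal l l')). Qed.

Let th_lbL l l' b z : th l l' (lbL l' b z) = lbL l b (th l l' z).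
Proof.
apply: (tens_ext (f := fun z => th l l' (lbL l' b z)) (g := fun z => lbL l b (th l l' z))) z.
- exact: (adt_comp (adt_th l l')).
- by apply: (adt_comp (adt_lbL l b)).
- move=> u v; rewrite /lbL tsum_pure // /th !tsum_pure //.
  exact: (rpf_lb (th_rpf l l')).
Qed.

(** Both maps convolve the pure tensor on the right with a scalar function, so the composite
    convolves it with c_l'l * c_ll' = c_l'l', which is a unit. *)
Let thK l l' : cancel (th l l') (th l' l).
Proof.
move=> z.
apply: (tens_ext (f := fun z => th l' l (th l l' z)) (g := id)) z => //.
  exact: (adt_comp (adt_th l' l)).
move=> x y; rewrite [th l l' _](tsum_pure (th_bal l l')).
transitivity (conv (op l') (conv (op l') (fun u v : C => u ⊠ v) (c l' l)) (c l l') x y).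
  rewrite /conv (tsum_adt _ _ (adt_th l' l)); apply: eq_tsum => ? ?.
  rewrite (tsum_adt _ _ (adt_th l' l)); apply: eq_tsum => ? ?.
  by rewrite /op th_lbL /th tsum_pure.
rewrite (@convA _ _ _ hC _ _ _ _ _ _ (lbL l') lmulB rmulB lmulB (op l') (op l')
  mulB (op l') (bal_op l') (bal_mul _) _ _ _ _ l' l _ _ _ _ _ (pure_rpf l')
  (c_lpf l' l) (c_rpf l' l) (c_lpf l l')); last first.
- by move=> *; rewrite /op lbLM.
- by rewrite /op; adt.
- by rewrite /op; adt.
- by rewrite /op; adt.
rewrite -[RHS](conv_unitr hC (ce_m hm l') _ _ (pure_rpf l')).
apply: eq_conv => // u v.
rewrite (m_convl _ l) /conv (tsum_adt _ _ ceD'); apply: eq_tsum => ? ?.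
by rewrite (tsum_adt _ _ ceD'); apply: eq_tsum => ? ?; rewrite (ce_la hC).
Qed.

(** Writing m_ik = m_ij * c_jk puts the scalar c_jk(x_(3), y_(2)) next to x_(2) ._ij y_(1). By
    coassociativity it may be attached to the first tensorand before its coproduct is taken. *)
Lemma lam_th z : lam i j (th j k z) = lam i k z.
Proof.
apply: (tens_ext (f := fun z => lam i j (th j k z)) (g := lam i k)) z.
- exact: (adt_comp (adt_lam i j) (adt_th j k)).
- exact: adt_lam.
move=> x y; rewrite /th tsum_pure // lam_pure /conv.
rewrite (tsum_adt _ _ (adt_lam i j)).
under [RHS]eq_tsum => u v.
  rewrite (m_convr _ j) /conv (tsum_adt _ _ (@adt_tprr _ _ _ _ _ _)).
  under eq_tsum do rewrite (tsum_adt _ _ (@adt_tprr _ _ _ _ _ _)).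
over.
rewrite [RHS]tsum_exch; apply: eq_tsum => y1 y2.
have hF : bal3 (fun u x1 x2 => u ⊠ lb (ce (m j k x2 y2)) (m i j x1 y1) : TD).
  split; [by adt|by adt|by adt|..] => *.
  - by rewrite m_la -(la_lb hC) tpr_bal.
  - by rewrite m_lb (lbM hC) m_la (ce_la hC).
rewrite -[RHS](coass hC hF x).
rewrite (tsum_adt _ _ (adt_lam i j)); apply: eq_tsum => x1 x2.
rewrite /op /lbL tsum_pure // lam_pure (S_lb hC _ _ (lam_bal0 i j y1)).
by apply: eq_tsum => *; rewrite m_lb.
Qed.

Lemma lam_change : bijective (lam i j) -> bijective (lam i k).
Proof.
move=> h; have hh : bijective (lam i j \o th j k).
  by apply: bij_comp h _; exists (th k j); exact: thK.
exact: (eq_bij hh lam_th).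
Qed.

End Change.

(** * The map rho and the inverse of lambda_ij built from it *)

Section Cleaving.
Variables (i j : I) (li : TD -> TL j) (mi : TD -> TR j).
Hypothesis lamV : cancel (lam j j) li /\ cancel li (lam j j).
Hypothesis muV : cancel (mu j j) mi /\ cancel mi (mu j j).

Lemma adt_li : adt li. Proof. exact: (adt_inv lamV.1 lamV.2 (adt_lam j j)). Qed.
Lemma adt_mi : adt mi. Proof. exact: (adt_inv muV.1 muV.2 (adt_mu j j)). Qed.
#[local] Hint Resolve adt_li adt_mi : adt.

Section Char.
Variable A : zmodType.
Implicit Types F Q : C -> C -> A.

Lemma bal_li Q : bal (rb j) lb Q -> bal lb la (fun u w => tsum Q (li (u ⊠ w))).
Proof. by move=> hQ; split; [adt|adt|move=> *; rewrite tpr_bal]. Qed.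

Lemma bal_mi Q : bal (ra j) la Q -> bal lb la (fun u w => tsum Q (mi (u ⊠ w))).
Proof. by move=> hQ; split; [adt|adt|move=> *; rewrite tpr_bal]. Qed.

Lemma li_lam Q x y : bal (rb j) lb Q ->
  'S(u, v <- x) tsum Q (li (u ⊠ m j j v y)) = Q x y.
Proof.
move=> hQ; have h : adt (fun z => tsum Q (li z)) by adt.
by rewrite -(tsum_adt _ _ h) -lam_pure (lamV.1 (x ⊠ y)) tsum_pure.
Qed.

Lemma mi_mu Q x y : bal (ra j) la Q ->
  'S(u, v <- x) tsum Q (mi (m j j u y ⊠ v)) = Q x y.
Proof.
move=> hQ; have h : adt (fun z => tsum Q (mi z)) by adt.
by rewrite -(tsum_adt _ _ h) -mu_pure (muV.1 (x ⊠ y)) tsum_pure.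
Qed.

(** Surjectivity of lambda_jj as a proof principle: an identity between balanced functions need only
    be checked on x_(1) ⊗ x_(2) y, where [li] is explicit by [li_lam]. It takes the place of the
    usual calculus of translation maps. *)
Lemma lam_ind F F' : bal lb la F -> bal lb la F' ->
  (forall x y, 'S(u, v <- x) F u (m j j v y) = 'S(u, v <- x) F' u (m j j v y)) ->
  forall u w, F u w = F' u w.
Proof.
move=> hF hF' e u w; rewrite -(tsum_pure hF) -(tsum_pure hF') -(lamV.2 (u ⊠ w)).
have hl := adt_lam j j.
apply: (tens_ext (f := fun z => tsum F (lam j j z)) (g := fun z => tsum F' (lam j j z))).
- exact: (adt_comp (adt_tsum hF) hl).
- exact: (adt_comp (adt_tsum hF') hl).
move=> x y; rewrite lam_pure !tsum_tsum //.
under eq_tsum do rewrite tsum_pure //.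
by under [RHS]eq_tsum do rewrite tsum_pure //.
Qed.

Lemma mu_ind F F' : bal lb la F -> bal lb la F' ->
  (forall x y, 'S(u, v <- x) F (m j j u y) v = 'S(u, v <- x) F' (m j j u y) v) ->
  forall u w, F u w = F' u w.
Proof.
move=> hF hF' e u w; rewrite -(tsum_pure hF) -(tsum_pure hF') -(muV.2 (u ⊠ w)).
have hl := adt_mu j j.
apply: (tens_ext (f := fun z => tsum F (mu j j z)) (g := fun z => tsum F' (mu j j z))).
- exact: (adt_comp (adt_tsum hF) hl).
- exact: (adt_comp (adt_tsum hF') hl).
move=> x y; rewrite mu_pure !tsum_tsum //.
under eq_tsum do rewrite tsum_pure //.
by under [RHS]eq_tsum do rewrite tsum_pure //.
Qed.

Lemma li_char F Q : bal lb la F -> bal (rb j) lb Q ->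
  (forall x y, 'S(u, v <- x) F u (m j j v y) = Q x y) ->
  forall u w, tsum Q (li (u ⊠ w)) = F u w.
Proof.
move=> hF hQ e; apply: (lam_ind (bal_li hQ) hF) => x y.
by rewrite li_lam // e.
Qed.

Lemma mi_char F Q : bal lb la F -> bal (ra j) la Q ->
  (forall x y, 'S(u, v <- x) F (m j j u y) v = Q x y) ->
  forall u w, tsum Q (mi (u ⊠ w)) = F u w.
Proof.
move=> hF hQ e; apply: (mu_ind (bal_mi hQ) hF) => x y.
by rewrite mi_mu // e.
Qed.

(** This and the next four lemmas give the linearity of the inverse maps, each checked on the
    generating tensors by [mi_char] or [li_char]. *)
Lemma mi_la Q b u w : bal (ra j) la Q ->
  tsum Q (mi (la b u ⊠ w)) = tsum (fun x y => Q (la b x) y) (mi (u ⊠ w)).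
Proof.
move=> hQ; apply/esym; move: u w; apply: mi_char.
- by split; [adt|adt|move=> *; rewrite (la_lb hC) tpr_bal].
- by split; [move=> y; exact: (adt_comp (balDl hQ y))|move=> x; exact: (balDr hQ)|
    move=> b' x y; rewrite -(ra_la hC) (balB hQ)].
move=> x y; rewrite -(mi_mu _ _ hQ) (S_la hC) //.
  by apply: eq_tsum => *; rewrite m_la.
by split; [adt|adt|move=> *; rewrite m_lb tpr_bal].
Qed.

Lemma mi_lb Q b u w : bal (ra j) la Q ->
  tsum Q (mi (u ⊠ lb b w)) = tsum (fun x y => Q (lb b x) y) (mi (u ⊠ w)).
Proof.
move=> hQ; apply/esym; move: u w; apply: mi_char.
- by split; [adt|adt|move=> *; rewrite tpr_bal (la_lb hC)].
- by split; [move=> y; exact: (adt_comp (balDl hQ y))|move=> x; exact: (balDr hQ)|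
    move=> b' x y; rewrite -(ra_lb hC) (balB hQ)].
move=> x y; rewrite -(mi_mu _ _ hQ) (S_lb hC) //.
by split; [adt|adt|move=> *; rewrite m_lb tpr_bal].
Qed.

Lemma li_ra Q b u w : bal (rb j) lb Q ->
  tsum Q (li (u ⊠ ra j b w)) = tsum (fun x y => Q x (ra j b y)) (li (u ⊠ w)).
Proof.
move=> hQ; apply/esym; move: u w; apply: li_char.
- by split; [adt|adt|move=> *; rewrite tpr_bal (ra_la hC)].
- by split; [move=> y; exact: (balDl hQ)|move=> x; exact: (adt_comp (balDr hQ x))|
    move=> b' x y; rewrite (ra_lb hC) (balB hQ)].
move=> x y; rewrite -(li_lam _ _ hQ).
by apply: eq_tsum => *; rewrite m_mra.
Qed.

Lemma li_lb Q b u w : bal (rb j) lb Q ->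
  tsum Q (li (u ⊠ lb b w)) = tsum (fun x y => Q (lb b x) y) (li (u ⊠ w)).
Proof.
move=> hQ; apply/esym; move: u w; apply: li_char.
- by split; [adt|adt|move=> *; rewrite tpr_bal (la_lb hC)].
- by split; [move=> y; exact: (adt_comp (balDl hQ y))|move=> x; exact: (balDr hQ)|
    move=> b' x y; rewrite -(rb_lb hC) (balB hQ)].
move=> x y; rewrite -(li_lam _ _ hQ) (S_lb hC) //.
  by apply: eq_tsum => *; rewrite m_lb.
by split; [adt|adt|move=> *; rewrite m_la tpr_bal].
Qed.

Lemma li_la Q b u w : bal (rb j) lb Q ->
  tsum Q (li (la b u ⊠ w)) = tsum (fun x y => Q (la b x) y) (li (u ⊠ w)).
Proof.
move=> hQ; apply/esym; move: u w; apply: li_char.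
- by split; [adt|adt|move=> *; rewrite (la_lb hC) tpr_bal].
- by split; [move=> y; exact: (adt_comp (balDl hQ y))|move=> x; exact: (balDr hQ)|
    move=> b' x y; rewrite -(rb_la hC) (balB hQ)].
move=> x y; rewrite -(li_lam _ _ hQ) (S_la hC) //.
by split; [adt|adt|move=> *; rewrite m_la tpr_bal].
Qed.

End Char.

(* mu^-1 (lambda (x (x) y)) = x y_[+] (x) y_[-] *)
Lemma mi_lam x y :
  mi ('S(u, v <- x) u ⊠ m j j v y) = tsum (fun a b => m j j x a ⊠ b) (mi (c1 ⊠ y)).
Proof.
have hb : bal lb la (fun u v => 'S(x1, x2 <- x) m j j x1 u ⊠ m j j x2 v : TD).
  exact: (adm_bal hC x (conv_adm (m_rpf hm j j) (m_lpf hm j j) (bal_pure _))).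
have hb' : bal (ra j) la (fun a b => m j j x a ⊠ b : TR j).
  by split; [adt|adt|move=> *; rewrite m_mra tpr_bal].
apply: (can_inj muV.1); rewrite (muV.2 _) (tsum_adt _ _ (adt_mu j j)).
(* The tensor on the left is [c1 ⊠ y] multiplied from the left by the coproduct of x. That
   multiplication is well defined by [hb] and commutes with mu by associativity. *)
transitivity (tsum (fun u v => 'S(x1, x2 <- x) m j j x1 u ⊠ m j j x2 v : TD) (c1 ⊠ y : TD)).
  by rewrite tsum_pure //; apply: eq_tsum => *; rewrite (m1r hm).
rewrite -{1}(muV.2 (c1 ⊠ y)) [X in tsum _ X = _]/mu tsum_tsum //; apply: eq_tsum => a b.
rewrite tsum_tsum // mu_pure (S_m j); last exact: mu_bal0.
apply: eq_tsum => a1 a2; rewrite tsum_pure //; apply: eq_tsum => *.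
by rewrite (mA hm).
Qed.

Let K x y := 'S(u, v <- x) la (ce (m j i u y)) v.

Let bal_K0 y : bal lb la (fun u v : C => la (ce (m j i u y)) v).
Proof. by split; [adt|adt|move=> *; rewrite m_lb (ce_lb hC) (laM hC)]. Qed.

Let bal_K : bal (ra j) la K.
Proof.
split.
- by move=> y; exact: (SD hC (bal_K0 y)).
- by rewrite /K; adt.
- move=> b x y; rewrite /K (S_ra hC _ _ _ (bal_K0 y)).
  by apply: eq_tsum => *; rewrite m_ra.
Qed.
#[local] Hint Resolve bal_K : adt.

(* rho2 (w (x) z) extends rho z = c_ji(z_[+](1), z_[-]) z_[+](2) so that it can be
   evaluated on the image of mu. *)
Definition rho2 (z : TD) : C := tsum K (mi z).

Lemma adt_rho2 : adt rho2. Proof. by rewrite /rho2; adt. Qed.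
#[local] Hint Resolve adt_rho2 : adt.

Definition rho x := rho2 (c1 ⊠ x).

Lemma adt_rho : adt rho. Proof. by rewrite /rho; adt. Qed.
#[local] Hint Resolve adt_rho : adt.

Let rho2_mu x y : 'S(u, v <- x) rho2 (m j j u y ⊠ v) = K x y.
Proof. exact: (mi_mu _ _ bal_K). Qed.

Let bal_rho2 y : bal lb la (fun u v : C => rho2 (m j j u y ⊠ v)).
Proof. by split; [adt|adt|move=> *; rewrite m_lb tpr_bal]. Qed.

Lemma rho2_lb b u w : rho2 (u ⊠ lb b w) = lb b (rho2 (u ⊠ w)).
Proof.
move: u w; apply: mu_ind.
- by split; [adt|adt|move=> *; rewrite tpr_bal (la_lb hC)].
- by split; [adt|adt|move=> *; rewrite tpr_bal].
move=> x y; rewrite -(tsum_adt _ _ (lbDr' b)) rho2_mu.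
rewrite -(S_lb hC _ _ (bal_rho2 y)) rho2_mu /K (S_lb hC _ _ (bal_K0 y)).
by rewrite (tsum_adt _ _ (lbDr' b)); apply: eq_tsum => *; rewrite (la_lb hC).
Qed.

(** The right action passes from the j-th to the i-th product here. The Takeuchi condition moves b
    to x_(1) as \bar b, m_jj moves it to y, and c_ji, which is balanced for the i-th action, moves
    it back. *)
Lemma rho2_ra b u w : rho2 (u ⊠ ra j b w) = ra i b (rho2 (u ⊠ w)).
Proof.
move: u w; apply: mu_ind.
- by split; [adt|adt|move=> *; rewrite tpr_bal (ra_la hC)].
- by split; [adt|adt|move=> *; rewrite tpr_bal].
move=> x y; rewrite -(tsum_adt _ _ (raDr' i b)) rho2_mu -(S_tak hC _ _ _ (bal_rho2 y)).
under eq_tsum do rewrite m_rb.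
rewrite rho2_mu /K (tsum_adt _ _ (raDr' i b)).
under eq_tsum do rewrite -m_rb.
rewrite (S_tak hC _ _ _ (bal_K0 y)).
by apply: eq_tsum => *; rewrite (ra_la hC).
Qed.

Let bal_Drho u : bal lb la (fun z1 z2 : C => rho2 (u ⊠ z1) ⊠ z2 : TD).
Proof. by split; [adt|adt|move=> *; rewrite rho2_lb tpr_bal]. Qed.

(** On x_(1) y ⊗ x_(2) both sides reduce by coassociativity to c_ji(x_(1), y) x_(2) ⊗ x_(3). *)
Lemma cD_rho2 u w : cD (rho2 (u ⊠ w)) = 'S(z1, z2 <- w) rho2 (u ⊠ z1) ⊠ z2.
Proof.
move: u w; apply: mu_ind.
- by split; [adt|adt|move=> *; rewrite tpr_bal].
- split; [by adt|by move=> u; exact: (SD hC (bal_Drho u))|].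
  move=> b u w; rewrite (S_la hC _ _ (bal_Drho u)).
  by apply: eq_tsum => *; rewrite tpr_bal.
move=> x y; rewrite -(tsum_adt _ _ cDD') rho2_mu.
rewrite -(coass hC (F := fun a b c => rho2 (m j j a y ⊠ b) ⊠ c)); last first.
  split; [by adt|by adt|by adt|..] => *.
    by rewrite m_lb tpr_bal.
  by rewrite rho2_lb tpr_bal.
transitivity ('S(u, v <- x) (K u y ⊠ v : TD)); last first.
  apply: eq_tsum => u v; rewrite -rho2_mu.
  by rewrite (tsum_adt (h := fun t : C => t ⊠ v : TD) _ _ (adt_tprl _ _ _)).
under [RHS]eq_tsum do rewrite (tsum_adt _ _ (adt_tprl _ _ _)).
rewrite (coass hC (F := fun a b c => la (ce (m j i a y)) b ⊠ c)); last first.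
  split; [by adt|by adt|by adt|..] => *.
    by rewrite m_lb (ce_lb hC) (laM hC).
  by rewrite (la_lb hC) tpr_bal.
rewrite /K (tsum_adt _ _ cDD'); apply: eq_tsum => u v.
by rewrite (cD_la hC).
Qed.

Lemma rho_lb b x : rho (lb b x) = lb b (rho x). Proof. exact: rho2_lb. Qed.
Lemma rho_ra b x : rho (ra j b x) = ra i b (rho x). Proof. exact: rho2_ra. Qed.
Lemma cD_rho x : cD (rho x) = 'S(u, v <- x) rho u ⊠ v. Proof. exact: cD_rho2. Qed.

(* Since z_[+] (x) z_[-](1) (x) z_[-](2) = z_[+][+] (x) z_[+][-] (x) z_[-], the left hand
   side is c_ji(z_[+](1), z_[-](1)) (z_[+](2) ._ij z_[-](2)) = z_[+] ._jj z_[-]. *)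
Lemma rho_mi z : tsum (fun x y => m i j (rho x) y) (mi (c1 ⊠ z)) = lb (ce z) c1.
Proof.
pose J w x y := m i j (rho2 (w ⊠ x)) y.
have hJ w : bal (ra j) la (J w).
  by split; [rewrite /J; adt|rewrite /J; adt|move=> *; rewrite /J rho2_ra m_ra].
have JD w : adt (fun v => tsum (J w) (mi (v ⊠ z))) by adt.
have hB z' : bal lb la (fun u v => tsum (J u) (mi (v ⊠ z'))).
  split; [by rewrite /J; adt|by adt|].
  move=> b u v; rewrite (mi_la _ _ _ (hJ u)).
  by apply: eq_tsum => *; rewrite /J tpr_bal.
(* The unit is replaced by a variable w, shared between [rho2] and [mi] through its coproduct. The
   claim becomes an identity on all balanced tensors w ⊗ z', which [mu_ind] can check. *)
pose F w z' := 'S(u, v <- w) tsum (J u) (mi (v ⊠ z')).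
have hF : bal lb la F.
  split; [by move=> z'; exact: (SD hC (hB z'))|by rewrite /F; adt|].
  move=> b w z'; rewrite /F (S_lb hC _ _ (hB z')).
  by apply: eq_tsum => *; rewrite tpr_bal.
have hF' : bal lb la (fun w z' : C => lb (ce z') w).
  by split; [adt|adt|move=> *; rewrite (lbM hC) (ce_la hC)].
have -> : tsum (fun x y => m i j (rho x) y) (mi (c1 ⊠ z)) = F c1 z.
  by rewrite /F (S_c1 hC (hB z)).
apply: (mu_ind hF hF') => x y.
transitivity (m j j x y).
  rewrite /F.
  under eq_tsum => u v do rewrite (S_m j _ _ _ _ (hB v)).
  rewrite tsum_exch (m_convl _ i); apply: eq_tsum => y1 y2.
  have h3 : bal3 (fun a b c => tsum (J (m j j a y1)) (mi (m j j b y2 ⊠ c))).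
    split; [by rewrite /J; adt|by adt|by adt|..] => *.
    - rewrite m_lb m_la (mi_la _ _ _ (hJ _)).
      by apply: eq_tsum => *; rewrite /J tpr_bal.
    - by rewrite m_lb tpr_bal.
  rewrite (coass hC h3).
  under eq_tsum => u v do rewrite (mi_mu _ _ (hJ _)) /J.
  rewrite -(tsum_adt (h := fun t => m i j t y2) _ _ (mDl' _ _ _)) rho2_mu /K.
  rewrite (tsum_adt (h := fun t => m i j t y2) _ _ (mDl' _ _ _)).
  by apply: eq_tsum => *; rewrite m_la.
rewrite -[LHS](counrF hC (h := fun t => m j j t y) _ (mDl' _ _ _)).
by apply: eq_tsum => *; rewrite m_lb.
Qed.

Section Triangle.
Variables (A : zmodType) (Q : C -> C -> C -> A).
Hypothesis hQ1 : forall w, bal (rb j) lb (fun p r => Q p r w).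
Hypothesis hQ2 : forall p, bal (ra j) la (Q p).

Let Q' u a w := tsum (fun p r => Q p r w) (li (u ⊠ a)).

Let hQ1l r w : adt (fun p => Q p r w). Proof. exact: (balDl (hQ1 w)). Qed.
Let hQ1r p w : adt (fun r => Q p r w). Proof. exact: (balDr (hQ1 w)). Qed.
Let hQ2r p r : adt (Q p r). Proof. exact: (balDr (hQ2 p)). Qed.
#[local] Hint Resolve hQ1l hQ1r hQ2r : adt.

Let hQ' u : bal (ra j) la (Q' u).
Proof.
split; [by rewrite /Q'; adt|by rewrite /Q'; adt|].
move=> b a w; rewrite /Q' (li_ra _ _ _ (hQ1 w)).
by apply: eq_tsum => *; rewrite (balB (hQ2 _)).
Qed.

Let hmi w : bal lb la (fun u v => tsum (Q' u) (mi (v ⊠ w))).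
Proof.
split; [by rewrite /Q'; adt|by adt|].
move=> b u v; rewrite (mi_la _ _ _ (hQ' u)).
by apply: eq_tsum => *; rewrite /Q' tpr_bal.
Qed.

(* u_(1)+ (x) u_(1)- (x) u_(2) = u_+ (x) u_-[+] (x) u_-[-] *)
Lemma li_mi u : 'S(u1, u2 <- u) tsum (fun p r => Q p r u2) (li (u1 ⊠ c1))
  = tsum (fun p r => tsum (Q p) (mi (c1 ⊠ r))) (li (u ⊠ c1)).
Proof.
(* Again the unit becomes a variable w. At w = 1 the inner inverse is explicit, as mu_jj sends 1 ⊗
   u_(2) to u_(2) ⊗ 1. *)
pose F u w := 'S(u1, u2 <- u) tsum (Q' u1) (mi (u2 ⊠ w)).
have hG : bal (rb j) lb (fun p r => tsum (Q p) (mi (c1 ⊠ r))).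
  split; [by adt|by adt|].
  move=> b p r; rewrite (mi_lb _ _ _ (hQ2 p)).
  by apply: eq_tsum => *; rewrite (balB (hQ1 _)).
have hF : bal lb la F.
  split; [by move=> w; exact: (SD hC (hmi w))|by rewrite /F; adt|].
  move=> b v w; rewrite /F (S_lb hC _ _ (hmi w)).
  by apply: eq_tsum => *; rewrite tpr_bal.
rewrite (li_char hF hG).
  apply: eq_tsum => u1 u2; have <- : mu j j (c1 ⊠ u2) = u2 ⊠ c1.
    by rewrite mu_pure (S_c1 hC (mu_bal0 _ _ _)) (m1l hm).
  by rewrite (muV.1 (c1 ⊠ u2)) (tsum_pure (hQ' u1)).
move=> x y; rewrite /F.
have h3 : bal3 (fun a b c => tsum (Q' a) (mi (b ⊠ m j j c y))).
  split; [by rewrite /Q'; adt|by adt|by adt|..] => *.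
  - exact: (balB (hmi _)).
  - by rewrite tpr_bal m_la.
rewrite (coass hC h3).
transitivity ('S(a, t <- x) tsum (fun p r => Q' a (m j j t p) r) (mi (c1 ⊠ y))).
  apply: eq_tsum => a t.
  have h : adt (fun z => tsum (Q' a) (mi z)) by adt.
  by rewrite -(tsum_adt _ _ h) mi_lam (tsum_tsum _ _ (hQ' a));
     apply: eq_tsum => *; rewrite (tsum_pure (hQ' a)).
rewrite tsum_exch; apply: eq_tsum => p r.
exact: (li_lam _ _ (hQ1 r)).
Qed.

End Triangle.

(** On x_(1) ⊗ x_(2) y both sides are x \bar{eps y}. At w = 1 this is the rule X_+ \bar{eps(X_-)} =
    X. *)
Lemma li_ce u w : tsum (fun p r => rb j (ce r) p) (li (u ⊠ w)) = lb (ce w) u.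
Proof.
move: u w; apply: li_char.
- by split; [adt|adt|move=> *; rewrite (lbM hC) (ce_la hC)].
- by split; [adt|adt|move=> *; rewrite rbM (ce_lb hC)].
move=> x y; rewrite (rb_sum hC); apply: eq_tsum => u v.
by rewrite (ce_m hm) (ce_rarb hC).
Qed.

(* N x = x_+ ._ij rho x_- is coinvariant by [cD_N2], hence a scalar, and
   N x_(1) ._ij x_(2) = x by [N_mul]; so the scalar is eps x. *)
Let N2 u w := tsum (fun p r => m i j p (rho r)) (li (u ⊠ w)).

Let hN0 : bal (rb j) lb (fun p r => m i j p (rho r)).
Proof. by split; [adt|adt|move=> *; rewrite m_rb rho_lb]. Qed.

Let hN : bal lb la N2. Proof. exact: (bal_li hN0). Qed.
Let N2Dl w : adt (fun u => N2 u w). Proof. exact: (balDl hN). Qed.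
Let N2Dr u : adt (N2 u). Proof. exact: (balDr hN). Qed.
#[local] Hint Resolve N2Dl N2Dr : adt.

Let N2_lb b u w : N2 u (lb b w) = lb b (N2 u w).
Proof.
rewrite /N2 (li_lb _ _ _ hN0) (tsum_adt _ _ (lbDr' b)).
by apply: eq_tsum => *; rewrite m_lb.
Qed.

Let N2_la b u w : N2 (la b u) w = la b (N2 u w).
Proof.
rewrite /N2 (li_la _ _ _ hN0) (tsum_adt _ _ (laDr' b)).
by apply: eq_tsum => *; rewrite m_la.
Qed.

Let N2_lam x y : 'S(u, v <- x) N2 u (m j j v y) = m i j x (rho y).
Proof. exact: (li_lam _ _ hN0). Qed.

Let hN' u : bal lb la (fun w1 w2 => N2 u w1 ⊠ w2 : TD).
Proof. by split; [adt|adt|move=> *; rewrite N2_lb tpr_bal]. Qed.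

(** On x_(1) ⊗ x_(2) y the value is x ._ij rho y, whose coproduct is x_(1) ._ij rho y_(1) ⊗ x_(2)
    ._jj y_(2) because rho is right colinear. *)
Let cD_N2 u w : cD (N2 u w) = 'S(w1, w2 <- w) (N2 u w1 ⊠ w2 : TD).
Proof.
move: u w; apply: lam_ind.
- by split; [adt|adt|move=> *; rewrite (balB hN)].
- split; [by adt|by move=> u; exact: (SD hC (hN' u))|].
  move=> b u w; rewrite (S_la hC _ _ (hN' u)).
  by apply: eq_tsum => *; rewrite (balB hN).
move=> x y; rewrite -(tsum_adt _ _ cDD') N2_lam (cD_m hm j).
under [RHS]eq_tsum => u v do rewrite (S_m j _ _ _ _ (hN' u)).
rewrite [RHS]tsum_exch.
have h : bal lb la (fun w1 w2 => 'S(x1, x2 <- x) (m i j x1 w1 ⊠ m j j x2 w2 : TD)).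
  exact: (adm_bal hC x (conv_adm (m_rpf hm i j) (m_lpf hm j j) (bal_pure _))).
rewrite /conv cD_rho (tsum_tsum _ _ h); apply: eq_tsum => y1 y2.
rewrite (tsum_pure h).
rewrite -(coass hC (F := fun a b c => N2 a (m j j b y1) ⊠ m j j c y2)).
  apply: eq_tsum => u v; rewrite -N2_lam.
  by rewrite (tsum_adt (h := fun t : C => t ⊠ m j j v y2 : TD) _ _ (adt_tprl _ _ _)).
split; [by adt|by adt|by adt|..] => *.
- by rewrite m_la (balB hN).
- by rewrite m_lb N2_lb m_la tpr_bal.
Qed.

Let N x := N2 x c1.

Let N_scal x : N x = la (ce (N x)) c1.
Proof.
have h : bal lb la (fun u v : C => la (ce u) v).
  by split; [adt|adt|move=> *; rewrite (laM hC) (ce_lb hC)].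
rewrite -{1}(counl hC (N x)) {1}/N cD_N2 (S_c1 hC (hN' x)).
by rewrite (tsum_pure h).
Qed.

Let N_lb b x : ce (N (lb b x)) = ce (N x) * b.
Proof.
have -> : N (lb b x) = ra i b (N x).
  rewrite /N (balB hN) -(ra_c1 hC j) /N2 (li_ra _ _ _ hN0).
  rewrite (tsum_adt _ _ (raDr' i b)); apply: eq_tsum => *.
  by rewrite rho_ra m_mra.
by rewrite N_scal (ra_la hC) (ra_c1 hC) !(ce_la hC) (ce1 hC) !mulr1.
Qed.

(** By [li_mi] the sum is x_+ ._ij rho(x_-[+]) ._ij x_-[-]. By [rho_mi] it collapses to x_+
    \bar{eps(x_-)}, which is x by [li_ce]. *)
Let N_mul x : 'S(u, v <- x) m i j (N u) v = x.
Proof.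
pose Q p r w := m i j (m i j p (rho r)) w.
have h1 w : bal (rb j) lb (fun p r => Q p r w).
  by split; [rewrite /Q; adt|rewrite /Q; adt|move=> *; rewrite /Q m_rb rho_lb].
have h2 p : bal (ra j) la (Q p).
  by split; [rewrite /Q; adt|rewrite /Q; adt|move=> *; rewrite /Q rho_ra m_mra m_ra].
have e := li_mi h1 h2 x.
transitivity ('S(u1, u2 <- x) tsum (fun p r => Q p r u2) (li (u1 ⊠ c1))).
  apply: eq_tsum => u v.
  by rewrite /N /N2 (tsum_adt (h := fun t => m i j t v) _ _ (mDl' _ _ _)).
rewrite e -[RHS](lb1 hC) -(ce1 hC) -li_ce; apply: eq_tsum => p r.
rewrite -(m_lb1 i j) -rho_mi (tsum_adt _ _ (mDr' _ _ _)).
by apply: eq_tsum => a b; rewrite (mA hm).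
Qed.

Lemma li_rho x :
  tsum (fun p r => m i j p (rho r)) (li (x ⊠ c1)) = la (ce x) c1.
Proof.
rewrite -/(N2 x c1) -/(N x) N_scal; congr la.
have h : adt (fun t => ce (N t)) by rewrite /N; adt.
rewrite -[LHS](counrF hC (h := fun t => ce (N t)) _ h) -{2}(N_mul x).
rewrite (tsum_adt _ _ ceD'); apply: eq_tsum => u v.
by rewrite N_lb [in RHS]N_scal m_la (m1l hm) (ce_la hC).
Qed.

Let kap0 x z := tsum (fun p r => p ⊠ m i j (rho r) z : TL j) (li (x ⊠ c1)).

Let hkap1 z : bal (rb j) lb (fun p r => p ⊠ m i j (rho r) z : TL j).
Proof. by split; [adt|adt|move=> *; rewrite tpr_bal rho_lb m_lb]. Qed.

Let hkap : bal lb la kap0.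
Proof.
split; [by rewrite /kap0; adt|by rewrite /kap0; adt|].
move=> b x z; rewrite /kap0 tpr_bal -(ra_c1 hC j) (li_ra _ _ _ (hkap1 z)).
by apply: eq_tsum => *; rewrite rho_ra m_ra.
Qed.

(** The image is x_+(1) ⊗ x_+(2) ._ij rho(x_-) ._ij z. By [li_char] the last factors regroup as
    N(x_(2)) ._ij z, and N is the counit by [li_rho]. *)
Lemma lam_kap x z : lam i j (kap0 x z) = x ⊠ z.
Proof.
rewrite /kap0 (tsum_adt _ _ (adt_lam i j)).
under eq_tsum => p r.
  rewrite lam_pure; under eq_tsum do rewrite (mA hm).
over.
have hL z' : bal lb la (fun u1 u2 => u1 ⊠ m i j (N2 u2 z') z : TD).
  by split; [adt|adt|move=> *; rewrite N2_la m_la tpr_bal].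
rewrite (li_char (F := fun u w => 'S(u1, u2 <- u) (u1 ⊠ m i j (N2 u2 w) z : TD))).
- rewrite -[in RHS](counr hC x) (tsum_adt (h := fun t : C => t ⊠ z : TD) _ _ (adt_tprl _ _ _)).
  apply: eq_tsum => u1 u2.
  by rewrite -/(N u2) /N -[N2 u2 c1]/(N u2) /N /N2 li_rho m_la (m1l hm) tpr_bal.
- split; [by move=> w; exact: (SD hC (hL w))|by adt|].
  move=> b u w; rewrite (S_lb hC _ _ (hL w)).
  by apply: eq_tsum => *; rewrite (balB hN).
- have hp r : bal lb la (fun p1 p2 => p1 ⊠ m i j (m i j p2 (rho r)) z : TD).
    by split; [adt|adt|move=> *; rewrite !m_la tpr_bal].
  split; [by move=> r; exact: (SD hC (hp r))|by adt|].
  move=> b p r; rewrite (S_rb hC _ _ _ (hp r)).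
  by apply: eq_tsum => *; rewrite m_rb rho_lb.
move=> x' y.
have h3 : bal3 (fun a b c => a ⊠ m i j (N2 b (m j j c y)) z : TD).
  split; [by adt|by adt|by adt|..] => *.
  - by rewrite N2_la m_la tpr_bal.
  - by rewrite (balB hN) m_la.
rewrite (coass hC h3); apply: eq_tsum => u1 t; rewrite -N2_lam.
rewrite (tsum_adt (h := fun t => m i j t z) _ _ (mDl' _ _ _)).
by rewrite (tsum_adt _ _ (@adt_tprr _ _ _ _ _ _)).
Qed.

(** [li_mi] brings the two translation maps together, [rho_mi] makes their product the scalar
    \bar{eps(x_-)}, and [li_ce] returns x. *)
Lemma kap_lam x z : 'S(u, v <- x) kap0 u (m i j v z) = x ⊠ z.
Proof.
pose Q p r w := p ⊠ m i j (rho r) (m i j w z) : TL j.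
have h1 w : bal (rb j) lb (fun p r => Q p r w) by exact: hkap1.
have h2 p : bal (ra j) la (Q p).
  by split; [rewrite /Q; adt|rewrite /Q; adt|move=> *; rewrite /Q rho_ra m_ra m_la].
rewrite [LHS](li_mi h1 h2 x).
have e : x = tsum (fun p r => rb j (ce r) p) (li (x ⊠ c1)).
  by rewrite li_ce (ce1 hC) (lb1 hC).
rewrite [in RHS]e (tsum_adt (h := fun t : C => t ⊠ z : TL j) _ _ (adt_tprl _ _ _)).
apply: eq_tsum => p r; rewrite tpr_bal.
have -> : lb (ce r) z = m i j (lb (ce r) c1) z by rewrite m_lb (m1l hm).
rewrite -rho_mi (tsum_adt (h := fun t => m i j t z) _ _ (mDl' _ _ _)).
rewrite (tsum_adt _ _ (@adt_tprr _ _ _ _ _ _)); apply: eq_tsum => a b.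
by rewrite /Q (mA hm).
Qed.

Lemma lam_bij_inv : bijective (lam i j).
Proof.
exists (tsum kap0) => z.
- apply: (tens_ext (f := fun z => tsum kap0 (lam i j z)) (g := id)) z.
  + exact: (adt_comp (adt_tsum hkap) (adt_lam i j)).
  + exact: adt_id.
  move=> x y; rewrite lam_pure (tsum_tsum _ _ hkap).
  by under eq_tsum do rewrite (tsum_pure hkap); rewrite kap_lam.
- apply: (tens_ext (f := fun z => lam i j (tsum kap0 z)) (g := id)) z.
  + exact: (adt_comp (adt_lam i j) (adt_tsum hkap)).
  + exact: adt_id.
  by move=> x y; rewrite (tsum_pure hkap) lam_kap.
Qed.

End Cleaving.
End Galois.

Arguments lam {B I C} m k l _.
Arguments mu {B I C} m k l _.

(** The identities are stated for every preimage w instead of a given inverse, because the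
    translation maps of the definitions are preimages picked by choice. *)
Lemma cleaving (B : pzRingType) (I : Type) (C : coringData B I) (hC : coring C)
    (m : I -> I -> C -> C -> C) (hm : mult m) (i j : I) :
  bijective (lam m j j) -> bijective (mu m j j) ->
  exists r : C -> C,
    [/\ adt r, forall b x, r (lb b x) = lb b (r x),
        forall b x, r (ra j b x) = ra i b (r x),
        forall x w, lam m j j w = x ⊠ c1 ->
          tsum (fun p q => m i j p (r q)) w = la (ce x) c1 &
        forall x w, mu m j j w = c1 ⊠ x ->
          tsum (fun p q => m i j (r p) q) w = lb (ce x) c1].
Proof.
move=> [li lK Kl] [mi mK Km].
have hl : cancel (lam m j j) li /\ cancel li (lam m j j) by [].
have hr : cancel (mu m j j) mi /\ cancel mi (mu m j j) by [].
exists (rho m i mi); split.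
- exact: (adt_rho hC hm i hr).
- exact: (rho_lb hC hm i hr).
- exact: (rho_ra hC hm i hr).
- move=> x w e; rewrite -(hl.1 w) e.
  exact: (li_rho hC hm i hl hr).
- move=> x w e; rewrite -(hr.1 w) e.
  exact: (rho_mi hC hm i hr).
Qed.

Lemma lam_bij (B : pzRingType) (I : Type) (C : coringData B I) (hC : coring C)
    (m : I -> I -> C -> C -> C) (hm : mult m) (i j : I) :
  bijective (lam m j j) -> bijective (mu m j j) -> bijective (lam m i j).
Proof.
move=> [li lK Kl] [mi mK Km].
have hl : cancel (lam m j j) li /\ cancel li (lam m j j) by [].
have hr : cancel (mu m j j) mi /\ cancel mi (mu m j j) by [].
exact: (lam_bij_inv hC hm i hl hr).
Qed.

(** * The co-opposite coring *)

Section Coop.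
Variables (B : pzRingType) (I : Type) (C : coringData B I).
Hypothesis hC : coring C.
Variable m : I -> I -> C -> C -> C.
Hypothesis hm : mult m.

Definition flip (N M : zmodType) (r : B -> M -> M) (l : B -> N -> N) :
  tens r l -> tens l r := tsum (fun u v => v ⊠ u).

Lemma flip_bal (N M : zmodType) (r : B -> M -> M) (l : B -> N -> N) :
  bal r l (fun u v => v ⊠ u : tens l r).
Proof. by split=> *; [exact: adt_tprr|exact: adt_tprl|rewrite tpr_bal]. Qed.

Lemma adt_flip (N M : zmodType) (r : B -> M -> M) (l : B -> N -> N) :
  adt (@flip N M r l).
Proof. exact: (adt_tsum (flip_bal r l)). Qed.

Lemma flip_pure (N M : zmodType) (r : B -> M -> M) (l : B -> N -> N) u v :
  flip (u ⊠ v : tens r l) = v ⊠ u.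
Proof. exact: (tsum_pure (flip_bal r l)). Qed.

Lemma flipK (N M : zmodType) (r : B -> M -> M) (l : B -> N -> N) :
  cancel (@flip N M r l) (@flip M N l r).
Proof.
move=> z; apply: (tens_ext (f := fun z => flip (flip z)) (g := id)) z.
- exact: (adt_comp (@adt_flip _ _ _ _) (@adt_flip _ _ _ _)).
- exact: adt_id.
- by move=> u v; rewrite !flip_pure.
Qed.

Lemma flip_bij (N M : zmodType) (r : B -> M -> M) (l : B -> N -> N) :
  bijective (@flip N M r l).
Proof. by exists (@flip M N l r); exact: flipK. Qed.

Lemma tsum_flip (N M A : zmodType) (r : B -> M -> M) (l : B -> N -> N)
    (F : N -> M -> A) (z : tens r l) :
  bal l r F -> tsum F (flip z) = tsum (fun u v => F v u) z.
Proof.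
move=> hF; rewrite /flip (tsum_tsum _ _ hF).
by apply: eq_tsum => u v; rewrite (tsum_pure hF).
Qed.

(** Passing to the converse ring exchanges the two left actions, the two right actions and the
    tensor factors, so every axiom is mapped to its mirror image. *)
Definition coop : coringData (B^c)%type I :=
  @CoringData (B^c)%type I C (@lb B I C) (@la B I C) (fun x => flip (cD x))
    (@ce B I C) (@c1 B I C) (@rb B I C) (@ra B I C).

Let S_coop (A : zmodType) (F : C -> C -> A) (x : C) : bal (@la B I C) lb F ->
  tsum F (@cD _ _ coop x) = 'S(u, v <- x) F v u.
Proof. exact: tsum_flip. Qed.

Let bal_coop (A : zmodType) (F : C -> C -> A) : bal (@la B I C) lb F ->
  bal lb la (fun u v => F v u).
Proof. by case=> h1 h2 h3; split=> [n|n|b u v]; [exact: h2|exact: h1|rewrite -h3]. Qed.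

Section Flip2.
Variables (f g : C -> C).
Hypotheses (hf : adt f) (hg : adt g).
Hypothesis hfl : forall b x, f (lb b x) = lb b (f x).
Hypothesis hgl : forall b x, g (la b x) = la b (g x).

Lemma flip_map (x : C) :
  flip ('S(u, v <- x) f u ⊠ g v)
    = tsum (fun u v => g u ⊠ f v) (@cD _ _ coop x) :> tens la lb.
Proof.
have h : bal la lb (fun u v => g u ⊠ f v : tens la lb).
  split=> *; [apply: (adt_comp (adt_tprl _ _ _) hg)|apply: (adt_comp (adt_tprr _ _ _) hf)|].
  by rewrite hgl hfl tpr_bal.
rewrite (S_coop _ h) (tsum_adt _ _ (@adt_flip _ _ _ _)).
by apply: eq_tsum => u v; rewrite flip_pure.
Qed.
End Flip2.

Let coop_coass (A : zmodType) (F : C -> C -> C -> A) (x : C) :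
  @bal3 _ _ coop A F ->
  tsum (fun u v => tsum (fun a b => F a b v) (@cD _ _ coop u)) (@cD _ _ coop x)
  = tsum (fun u v => tsum (fun a b => F u a b) (@cD _ _ coop v)) (@cD _ _ coop x).
Proof.
move=> hF.
have h12 c : bal (@la B I C) lb (fun a b => F a b c)
  by case: hF => f1 f2 f3 f4 f5; split=> *; [exact: f1|exact: f2|exact: f4].
have h23 a : bal (@la B I C) lb (fun b c => F a b c)
  by case: hF => f1 f2 f3 f4 f5; split=> *; [exact: f2|exact: f3|exact: f5].
pose G a b c := F c b a.
have hG : @bal3 B I C A G.
  case: hF => f1 f2 f3 f4 f5.
  by split=> *; [exact: f3|exact: f2|exact: f1|rewrite /G f5|rewrite /G f4].
have hl : bal (@la B I C) lb (fun u v => tsum (fun a b => F a b v) (flip (cD u))).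
  split.
  + move=> v; exact: (adt_comp (adt_tsum (h12 v)) (adt_comp (@adt_flip _ _ _ _) (cDD hC))).
  + by move=> u; apply: adt_tsumf => a b; exact: (bal3D3 hF).
  + move=> b u v; rewrite !(tsum_flip _ (h12 _)).
    rewrite (S_la hC b u (bal_coop (h12 v))).
    by apply: eq_tsum => *; exact: (bal3B2 hF).
have hr : bal (@la B I C) lb (fun u v => tsum (fun a b => F u a b) (flip (cD v))).
  split.
  + by move=> v; apply: adt_tsumf => a b; exact: (bal3D1 hF).
  + move=> u; exact: (adt_comp (adt_tsum (h23 u)) (adt_comp (@adt_flip _ _ _ _) (cDD hC))).
  + move=> b u v; rewrite !(tsum_flip _ (h23 _)).
    rewrite (S_lb hC b v (bal_coop (h23 u))).
    by apply: eq_tsum => *; exact: (bal3B1 hF).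
rewrite (S_coop _ hl) (S_coop _ hr).
transitivity ('S(u, v <- x) 'S(a, b <- v) G u a b).
  by apply: eq_tsum => u v; rewrite (tsum_flip _ (h12 _)).
rewrite -(coass hC hG); apply: eq_tsum => u v.
by rewrite (tsum_flip _ (h23 _)).
Qed.

Lemma coop_coring : coring coop.
Proof.
have la_adt := laDr hC. have lb_adt := lbDr hC.
have ra_adt := raDr hC. have rb_adt := rbDr hC.
apply: Coring.
- exact: (lbDl hC).
- exact: (lbDr hC).
- exact: (laDl hC).
- exact: (laDr hC).
- exact: (lbM hC).
- exact: (laM hC).
- exact: (lb1 hC).
- exact: (la1 hC).
- by move=> b c x; rewrite [LHS]/= -(la_lb hC).
- exact: (adt_comp (@adt_flip _ _ _ _) (cDD hC)).
- move=> b x; apply: etrans (congr1 _ (cD_lb hC b x)) _.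
  by apply: (flip_map (f := fun u => u)) => // *; rewrite (la_lb hC).
- move=> b x; apply: etrans (congr1 _ (cD_la hC b x)) _.
  by apply: (flip_map (g := fun u => u)) => // *; rewrite (la_lb hC).
- move=> A F hF x; exact: coop_coass.
- exact: (ceD hC).
- exact: (ce_lb hC).
- exact: (ce_la hC).
- move=> x; apply: etrans (S_coop _ _) (counr hC x).
  split=> *; [exact: (adt_comp (lbDl hC _) (ceD hC))|exact: lb_adt|].
  by rewrite (ce_la hC) (lbM hC).
- move=> x; apply: etrans (S_coop _ _) (counl hC x).
  split=> *; [exact: la_adt|exact: (adt_comp (laDl hC _) (ceD hC))|].
  by rewrite (ce_lb hC) (laM hC).
- by apply: etrans (congr1 _ (cD1 hC)) _; rewrite flip_pure.
- exact: (ce1 hC).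
- exact: (rbDl hC).
- exact: (rbDr hC).
- exact: (raDl hC).
- exact: (raDr hC).
- by move=> i b c x; exact: (rb_lb hC).
- by move=> i b c x; exact: (rb_la hC).
- by move=> i b c x; exact: (ra_lb hC).
- by move=> i b c x; exact: (ra_la hC).
- move=> i b x; apply: etrans (congr1 _ (cD_rb hC i b x)) _.
  by apply: (flip_map (f := fun u => u)) => // *; rewrite (rb_la hC).
- move=> i b x; apply: etrans (congr1 _ (cD_ra hC i b x)) _.
  by apply: (flip_map (g := fun u => u)) => // *; rewrite (ra_lb hC).
- move=> k b x.
  have e1 := flip_map (f := @rb B I C k b) (g := fun u => u) (rb_adt k b) (@adt_id _)
    (fun c u => rb_lb hC k b c u) (fun _ _ => erefl) x.
  have e2 := flip_map (f := fun u => u) (g := @ra B I C k b) (@adt_id _) (ra_adt k b)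
    (fun _ _ => erefl) (fun c u => ra_la hC k b c u) x.
  exact: etrans (esym e2) (etrans (congr1 _ (esym (takeuchi hC k b x))) e1).
- by move=> i b x; apply/esym; exact: (ce_rarb hC).
- exact: (rb_c1 hC).
- exact: (ra_c1 hC).
Qed.

(** The order of multiplication is kept. The indices swap because flipping the coproduct turns m_ik
    ⊗ m_kj into m_kj ⊗ m_ik. *)
Definition mop i j : C -> C -> C := m j i.

Lemma coop_mult : @mult _ _ coop mop.
Proof.
have hl i j : @lpf _ _ coop i coop (@la _ _ coop) (mop i j).
  by have [] := m_rpf hm j i; split.
have hr i j : @rpf _ _ coop j coop (@lb _ _ coop) (mop i j).
  by have [] := m_lpf hm j i; split.
apply: Mult.
- exact: hl.
- exact: hr.
- by move=> i j; exact: mA hm j i.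
- by move=> i j; exact: m1l hm j i.
- by move=> i j; exact: m1r hm j i.
- move=> k i j x y.
  have ha := conv_adm (hr i k) (hl k j) (@bal_tpr _ _ _ lb la).
  rewrite /conv (tsum_flip _ (adm_bal coop_coring x ha)).
  rewrite {1}/cD /= (cD_m hm k) (tsum_adt _ _ (@adt_flip _ _ _ _)).
  apply: eq_tsum => y1 y2; rewrite (tsum_flip _ (admx ha _ _)).
  rewrite (tsum_adt _ _ (@adt_flip _ _ _ _)).
  by apply: eq_tsum => x1 x2; rewrite flip_pure.
- by move=> i x y; apply: etrans (ce_m hm i x y) (ce_rarb hC _ _ _).
Qed.

Lemma lam_coop i j z : lam (C := coop) mop i j z = flip (mu m j i z).
Proof.
have hc := coop_coring. have hm' := coop_mult.
apply: (tens_ext (f := @lam _ _ coop mop i j) (g := fun z => flip (mu m j i z))) z.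
- exact: (adt_lam hc hm').
- exact: (adt_comp (@adt_flip _ _ _ _) (adt_mu hC hm j i)).
move=> x y; rewrite (lam_pure hc hm') (mu_pure hC hm).
rewrite (tsum_flip _ (lam_bal0 hm' i j y)) (tsum_adt _ _ (@adt_flip _ _ _ _)).
by apply: eq_tsum => u v; rewrite flip_pure.
Qed.

Lemma mu_coop i j z : mu (C := coop) mop i j z = flip (lam m j i z).
Proof.
have hc := coop_coring. have hm' := coop_mult.
apply: (tens_ext (f := @mu _ _ coop mop i j) (g := fun z => flip (lam m j i z))) z.
- exact: (adt_mu hc hm').
- exact: (adt_comp (@adt_flip _ _ _ _) (adt_lam hC hm j i)).
move=> x y; rewrite (mu_pure hc hm') (lam_pure hC hm).
rewrite (tsum_flip _ (mu_bal0 hm' i j y)) (tsum_adt _ _ (@adt_flip _ _ _ _)).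
by apply: eq_tsum => u v; rewrite flip_pure.
Qed.

Lemma lam_coop_bij i j : bijective (lam (C := coop) mop i j) <-> bijective (mu m j i).
Proof.
split=> h.
  apply: (eq_bij (bij_comp (@flip_bij _ _ la lb) h)) => z /=.
  by rewrite lam_coop flipK.
by apply: (eq_bij (bij_comp (@flip_bij _ _ lb la) h)) => z; rewrite lam_coop.
Qed.

Lemma mu_coop_bij i j : bijective (lam m j i) -> bijective (mu (C := coop) mop i j).
Proof.
move=> h.
by apply: (eq_bij (bij_comp (@flip_bij _ _ lb la) h)) => z; rewrite mu_coop.
Qed.

Lemma mu_change i j k : bijective (mu m i j) -> bijective (mu m k j).
Proof.
move=> h; apply: (lam_coop_bij j k).1.
exact: (lam_change coop_coring coop_mult k ((lam_coop_bij j i).2 h)).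
Qed.

Lemma mu_bij i j :
  bijective (lam m j j) -> bijective (mu m j j) -> bijective (mu m j i).
Proof.
move=> hl hr; apply: (lam_coop_bij i j).1.
exact: (lam_bij coop_coring coop_mult i ((lam_coop_bij j j).2 hr) (mu_coop_bij hl)).
Qed.

Lemma cleaving_op i j :
  bijective (lam m j j) -> bijective (mu m j j) ->
  exists r : C -> C,
    [/\ adt r, forall b x, r (la b x) = la b (r x),
        forall b x, r (rb j b x) = rb i b (r x),
        forall x w, lam m j j w = x ⊠ c1 ->
          tsum (fun p q => m j i (r p) q) w = la (ce x) c1 &
        forall x w, mu m j j w = c1 ⊠ x ->
          tsum (fun p q => m j i p (r q)) w = lb (ce x) c1].
Proof.
move=> hl hr.
have [r [h1 h2 h3 h4 h5]] :=
  cleaving coop_coring coop_mult i ((lam_coop_bij j j).2 hr) (mu_coop_bij hl).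
exists r; split; [exact: h1|exact: h2|exact: h3|..].
(* The flip exchanges lambda and mu, so the identity for one translation map is the mirror image of
   that for the other. *)
- by move=> x w e; apply: (h5 x w); rewrite mu_coop e flip_pure.
- by move=> x w e; apply: (h4 x w); rewrite lam_coop e flip_pure.
Qed.

End Coop.

Lemma linear_adt (R : pzRingType) (U V : lmodType R) (f : U -> V) :
  linear f -> adt f.
Proof. by move=> h; split=> x y; have := h 1 x y; rewrite !scale1r. Qed.

Lemma tliftE (B : Type) (M N G : zmodType) (r : B -> M -> M) (l : B -> N -> N)
    (f : M -> N -> G) (z : tens r l) :
  tlift f z = tsum f z.
Proof. by rewrite tsum.unlock. Qed.

Lemma tprE (B : Type) (M N : zmodType) (r : B -> M -> M) (l : B -> N -> N) m n :
  m ⊗ n = m ⊠ n :> tens r l.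
Proof. by rewrite tpr.unlock. Qed.

(** * The coring of a bialgebroid with a cocycle *)

Section Base.
Variables (k : fieldType) (B : algType k) (H : hopfdata B).
Hypothesis hH : is_bialgebroid H.

Definition coring_of (J : Type) (ra rb : J -> B -> H -> H) : coringData B J :=
  @CoringData B J (carrier H) (@lact _ _ H) (@lactop _ _ H) cop eps bone ra rb.

Let hA := bia_alg hH.
Let hS := bia_src hH.
Let hT := bia_tgt hH.

Lemma bmulDl (y : H) : adt (fun x : H => x ⋅ y).
Proof. exact: (linear_adt (alg_linl hA y)). Qed.
Lemma bmulDr (x : H) : adt (bmul x).
Proof. exact: (linear_adt (alg_linr hA x)). Qed.
Lemma srcD : adt (@src _ _ H). Proof. exact: (linear_adt (src_lin hS)). Qed.
Lemma tgtD : adt (@tgt _ _ H). Proof. exact: (linear_adt (tgt_lin hT)). Qed.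

(** The coring with the right actions of H alone. It serves to establish the properties of the
    twisted right actions, which enter the larger coring only afterwards. *)
Definition coring0 : coringData B unit :=
  coring_of (fun _ => @ract _ _ H) (fun _ => @ractop _ _ H).

Lemma lact1 (x : H) : 1 ▹ x = x.
Proof. by rewrite (src_lact hS) (src_1 hS) (alg_mul1 hA). Qed.
Lemma lactop1 (x : H) : 1 ▸ x = x.
Proof. by rewrite (tgt_lactop hT) (tgt_1 hT) (alg_mul1 hA). Qed.

Lemma lactDr b : adt (lact b : H -> H).
Proof.
split=> x y; rewrite !(src_lact hS); exact: (adtD (bmulDr _)).
Qed.
Lemma lactDl (x : H) : adt (fun b => lact b x).
Proof.
split=> b b'; rewrite !(src_lact hS) (adtD srcD); exact: (adtD (bmulDl _)).
Qed.
Lemma lactopDr b : adt (lactop b : H -> H).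
Proof.
split=> x y; rewrite !(tgt_lactop hT); exact: (adtD (bmulDr _)).
Qed.
Lemma lactopDl (x : H) : adt (fun b => lactop b x).
Proof.
split=> b b'; rewrite !(tgt_lactop hT) (adtD tgtD); exact: (adtD (bmulDl _)).
Qed.

Lemma lact_lactop b c (x : H) : b ▹ c ▸ x = c ▸ b ▹ x.
Proof.
by rewrite !(tgt_lactop hT) !(src_lact hS) !(alg_mulA hA) (bia_comm hH).
Qed.

Lemma lact_bmul b (x y : H) : (b ▹ x) ⋅ y = b ▹ (x ⋅ y).
Proof. by rewrite !(src_lact hS) (alg_mulA hA). Qed.
Lemma lactop_bmul b (x y : H) : (b ▸ x) ⋅ y = b ▸ (x ⋅ y).
Proof. by rewrite !(tgt_lactop hT) (alg_mulA hA). Qed.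
Lemma ract_bmul b (x y : H) : ract b x ⋅ y = x ⋅ (b ▹ y).
Proof. by rewrite !(src_lact hS) /ract (alg_mulA hA). Qed.
Lemma ractop_bmul b (x y : H) : ractop b x ⋅ y = x ⋅ (b ▸ y).
Proof. by rewrite !(tgt_lactop hT) /ractop (alg_mulA hA). Qed.

Lemma srcE b : src b = b ▹ bone :> H.
Proof. by rewrite (src_lact hS) (alg_mulr1 hA). Qed.
Lemma tgtE b : tgt b = b ▸ bone :> H.
Proof. by rewrite (tgt_lactop hT) (alg_mulr1 hA). Qed.

Lemma eps_lact b (x : H) : eps (b ▹ x) = b * eps x.
Proof. by rewrite -{1}(lactop1 x) (eps_bilin hH) mulr1. Qed.
Lemma eps_lactop b (x : H) : eps (b ▸ x) = eps x * b.
Proof. by rewrite -(lact1 (b ▸ x)) (eps_bilin hH) mul1r. Qed.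
Lemma eps_src1 b : eps (src b : H) = b.
Proof. by rewrite srcE eps_lact (eps_1 hH) mulr1. Qed.
Lemma eps_tgt1 b : eps (tgt b : H) = b.
Proof. by rewrite tgtE eps_lactop (eps_1 hH) mul1r. Qed.

Lemma eps_ract b (x : H) : eps (ract b x) = eps (ractop b x).
Proof.
by rewrite -{1}(eps_src1 b) /ract (eps_src hH) -(eps_tgt hH) eps_src1.
Qed.

Lemma cop_lact b (x : H) :
  cop (b ▹ x) = tsum (fun u v => (b ▹ u) ⊠ v) (cop x).
Proof.
rewrite -{1}(lactop1 x) (cop_bilin hH) tsum.unlock tpr.unlock.
by apply: eq_bigr => p _; rewrite lactop1.
Qed.

Lemma cop_lactop b (x : H) :
  cop (b ▸ x) = tsum (fun u v => u ⊠ (b ▸ v)) (cop x).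
Proof.
rewrite -(lact1 (b ▸ x)) (cop_bilin hH) tsum.unlock tpr.unlock.
by apply: eq_bigr => p _; rewrite lact1.
Qed.

Lemma copD : adt (cop : H -> _).
Proof. by split; exact: (cop_add hH). Qed.

Lemma cop_tak b (x : H) :
  tsum (fun u v => ractop b u ⊠ v) (cop x)
    = tsum (fun u v => u ⊠ ract b v) (cop x) :> tens (@lactop _ _ H) lact.
Proof.
by rewrite tsum.unlock tpr.unlock; exact: (cop_takeuchi hH).
Qed.

Lemma cop_takF (A : zmodType) (F : H -> H -> A) b (x : H) : bal lactop lact F ->
  tsum (fun u v => F (ractop b u) v) (cop x) = tsum (fun u v => F u (ract b v)) (cop x).
Proof.
move=> hF; have := congr1 (tsum F) (cop_tak b x).
rewrite (tsum_adt _ _ (adt_tsum hF)) [RHS](tsum_adt _ _ (adt_tsum hF)) => e.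
apply: etrans (etrans _ e) _; apply: eq_tsum => u v; by rewrite tsum_pure.
Qed.

Lemma cop_bmul (x y : H) :
  cop (x ⋅ y) = tsum (fun y1 y2 => tsum (fun x1 x2 => (x1 ⋅ y1) ⊠ (x2 ⋅ y2)) (cop x)) (cop y).
Proof.
by rewrite tsum_exch tsum.unlock tpr.unlock; exact: (cop_M hH).
Qed.

Lemma cop_bmul_bal (x : H) :
  bal lactop lact (fun y1 y2 => tsum (fun x1 x2 => (x1 ⋅ y1) ⊠ (x2 ⋅ y2)) (cop x) :
    tens (@lactop _ _ H) lact).
Proof.
split.
- move=> y2; apply: adt_tsumf => x1 x2.
  exact: (adt_comp (adt_tprl _ _ _) (bmulDr _)).
- move=> y1; apply: adt_tsumf => x1 x2.
  exact: (adt_comp (adt_tprr _ _ _) (bmulDr _)).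
- move=> b y1 y2.
  under eq_tsum do rewrite -ractop_bmul.
  rewrite (cop_takF (F := fun x1 x2 => (x1 ⋅ y1) ⊠ (x2 ⋅ y2))).
    by apply: eq_tsum => *; rewrite ract_bmul.
  split=> *.
  + exact: (adt_comp (adt_tprl _ _ _) (bmulDl _)).
  + exact: (adt_comp (adt_tprr _ _ _) (bmulDl _)).
  + by rewrite lactop_bmul lact_bmul tpr_bal.
Qed.

Lemma cop_one : cop (bone : H) = bone ⊠ bone.
Proof. by rewrite (cop_1 hH) tprE. Qed.

Lemma cop_ract b (x : H) : cop (ract b x) = tsum (fun u v => ract b u ⊠ v) (cop x).
Proof.
rewrite /ract cop_bmul srcE cop_lact cop_one.
rewrite tsum_pure; last first.
  split=> *; [apply: (adt_comp (adt_tprl _ _ _) (lactDr _))|exact: adt_tprr|].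
  by rewrite lact_lactop tpr_bal.
rewrite (tsum_pure (cop_bmul_bal x)).
by apply: eq_tsum => u v; rewrite (alg_mulr1 hA).
Qed.

Lemma cop_ractop b (x : H) : cop (ractop b x) = tsum (fun u v => u ⊠ ractop b v) (cop x).
Proof.
rewrite /ractop cop_bmul tgtE cop_lactop cop_one.
rewrite tsum_pure; last first.
  split=> *; [exact: adt_tprl|apply: (adt_comp (adt_tprr _ _ _) (lactopDr _))|].
  by rewrite -lact_lactop tpr_bal.
rewrite (tsum_pure (cop_bmul_bal x)).
by apply: eq_tsum => u v; rewrite (alg_mulr1 hA).
Qed.

(** The coassociativity axiom lives in an iterated tensor product; it is evaluated here under the
    map induced by [F]. *)
Lemma cop_coass (A : zmodType) (F : H -> H -> H -> A) (x : H) :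
  @bal3 _ _ coring0 A F ->
  tsum (fun u v => tsum (fun a b => F a b v) (cop u)) (cop x)
  = tsum (fun u v => tsum (fun a b => F u a b) (cop v)) (cop x).
Proof.
move=> hF.
have h12 z : bal (@lactop _ _ H) lact (fun a b => F a b z) := @bal3_12 _ _ (coring0) A F z hF.
have hL : bal (@lactop2 k B H H lactop lact lactop) (@lact _ _ H)
    (fun t z => tsum (fun a b => F a b z) t).
  split.
  - by move=> z; exact: (adt_tsum (h12 z)).
  - by move=> t; apply: adt_tsumf => *; exact: (bal3D3 hF).
  - move=> b t z; rewrite /lactop2 tliftE tsum_tsum //; apply: eq_tsum => u v.
    by rewrite tprE tsum_pure //; exact: (bal3B2 hF).
have e : tsum (fun u v => cop u ⊠ v :
      tens (@lactop2 k B H H lactop lact lactop) (@lact _ _ H)) (cop x)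
    = tsum (fun u v => tsum (fun a b => (u ⊠ a) ⊠ b) (cop v)) (cop x).
  by rewrite tsum.unlock tpr.unlock; exact: (cop_coassoc hH).
have := congr1 (tsum (fun t z => tsum (fun a b => F a b z) t)) e.
rewrite !(tsum_tsum _ _ hL) => {}e.
apply: etrans (etrans _ e) _.
  by apply: eq_tsum => u v; rewrite (tsum_pure hL).
apply: eq_tsum => u v; rewrite (tsum_tsum _ _ hL); apply: eq_tsum => a b.
by rewrite (tsum_pure hL) tsum_pure.
Qed.

Lemma coring0_ax : coring coring0.
Proof.
apply: Coring.
- exact: lactDl.
- exact: lactDr.
- exact: lactopDl.
- exact: lactopDr.
- by move=> b c x /=; rewrite !(src_lact hS) (src_M hS) (alg_mulA hA).
- by move=> b c x /=; rewrite !(tgt_lactop hT) (tgt_M hT) (alg_mulA hA).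
- exact: lact1.
- exact: lactop1.
- exact: lact_lactop.
- exact: copD.
- exact: cop_lact.
- exact: cop_lactop.
- by move=> A F hF x; exact: cop_coass.
- exact: (linear_adt (eps_lin hH)).
- exact: eps_lact.
- exact: eps_lactop.
- by move=> x; rewrite tsum.unlock; exact: (eps_l hH).
- by move=> x; rewrite tsum.unlock; exact: (eps_r hH).
- exact: cop_one.
- exact: (eps_1 hH).
- by move=> i x; exact: (adt_comp (bmulDr x) srcD).
- by move=> i b; exact: bmulDl.
- by move=> i x; exact: (adt_comp (bmulDr x) tgtD).
- by move=> i b; exact: bmulDl.
- by move=> i b c x; exact: lact_bmul.
- by move=> i b c x; exact: lactop_bmul.
- by move=> i b c x; exact: lact_bmul.
- by move=> i b c x; exact: lactop_bmul.
- by move=> i; exact: cop_ract.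
- by move=> i; exact: cop_ractop.
- by move=> i; exact: cop_tak.
- by move=> i; exact: eps_ract.
- by move=> i b; rewrite /= /ract (alg_mul1 hA) srcE.
- by move=> i b; rewrite /= /ractop (alg_mul1 hA) tgtE.
Qed.

End Base.

(** * The twisted right actions and the scalar functions c_ij *)

Section Cocycle.
Variables (k : fieldType) (B : algType k) (H : hopfdata B).
Hypothesis hH : is_bialgebroid H.
Variables G Gi : H -> H -> B.
Hypothesis hG : is_2cocycle H G.
Hypothesis hGi : is_cocycle_inverse H G Gi.

Local Notation C0 := (coring0 H).
Local Notation TD := (tens (@lactop _ _ H) (@lact _ _ H)).
Local Notation mulB := (fun x y : B => x * y).
Local Notation lmulB := (fun b a : B => b * a).
Local Notation rmulB := (fun b a : B => a * b).
Let hC0 : coring C0 := coring0_ax hH.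
Let hA := bia_alg hH.

Let GDl y : adt (fun x => G x y). Proof. exact: (linear_adt (coc_linl hG y)). Qed.
Let GDr x : adt (G x). Proof. exact: (linear_adt (coc_linr hG x)). Qed.
Let GiDl y : adt (fun x => Gi x y). Proof. exact: (linear_adt (coci_linl hGi y)). Qed.
Let GiDr x : adt (Gi x). Proof. exact: (linear_adt (coci_linr hGi x)). Qed.
Let srcD' := srcD hH.
Let tgtD' := tgtD hH.
Let lactDl' := lactDl hH. Let lactDr' := lactDr hH.
Let lactopDl' := lactopDl hH. Let lactopDr' := lactopDr hH.
Let copD' := copD hH.
Let bmulDl' := bmulDl hH. Let bmulDr' := bmulDr hH.
Let epsD' : adt (@eps _ _ H) := linear_adt (eps_lin hH).
#[local] Hint Resolve GDl GDr GiDl GiDr srcD' tgtD' lactDl' lactDr' lactopDl'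
  lactopDr' copD' bmulDl' bmulDr' epsD' : adt.

Lemma G_la b x y : G (b ▹ x) y = b * G x y.
Proof. by rewrite -{1}(lactop1 hH x) (coc_bilin hG) mulr1. Qed.
Lemma G_lb b x y : G (b ▸ x) y = G x y * b.
Proof. by rewrite -(lact1 hH (b ▸ x)) (coc_bilin hG) mul1r. Qed.
Lemma Gi_la b x y : Gi (b ▹ x) y = b * Gi x y.
Proof. by rewrite -{1}(lactop1 hH x) (coci_bilin hGi) mulr1. Qed.
Lemma Gi_lb b x y : Gi (b ▸ x) y = Gi x y * b.
Proof. by rewrite -(lact1 hH (b ▸ x)) (coci_bilin hGi) mul1r. Qed.

Let laM' b c (x : H) : b ▹ c ▹ x = (b * c) ▹ x := laM hC0 b c x.
Let lbM' b c (x : H) : b ▸ c ▸ x = (c * b) ▸ x := lbM hC0 b c x.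
Let lalb b c (x : H) : b ▹ c ▸ x = c ▸ b ▹ x := lact_lactop hH b c x.

Let lpf_m : @lpf _ _ C0 tt C0 (@la _ _ C0) bmul.
Proof.
split; [by adt|by adt|exact: lact_bmul|exact: ract_bmul].
Qed.

Let rpf_m : @rpf _ _ C0 tt C0 (@lb _ _ C0) bmul.
Proof.
split; [by adt|by adt|exact: lactop_bmul|exact: ractop_bmul].
Qed.

Let rpf_G : @rpf _ _ C0 tt B rmulB G.
Proof. by split; [adt|adt|exact: G_lb|by move=> *; exact: (coc_bal hG)]. Qed.

Let lpf_Gi : @lpf _ _ C0 tt B lmulB Gi.
Proof. by split; [adt|adt|exact: Gi_la|by move=> *; exact: (coci_bal hGi)]. Qed.

Let bal_laop0 := bal_laop hC0.
Let bal_mul0 := bal_mul B.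

Lemma coci_conv x y : @conv _ _ C0 B B B mulB G Gi x y = G x (src (eps y)).
Proof. by rewrite /conv tsum_exch tsum.unlock; exact: (coci_l hGi). Qed.

Lemma cocycle_mulE x y :
  cocycle_mul G x y = @conv _ _ C0 B C0 C0 (@lact _ _ H) G bmul x y.
Proof. by rewrite /conv tsum_exch tsum.unlock. Qed.

Lemma G1l x : G bone x = eps x. Proof. exact: (coc_1l hG). Qed.
Lemma G1r x : G x bone = eps x. Proof. exact: (coc_1r hG). Qed.

(* Both sides are the value of G * Gi at x and tgt b. *)
Lemma Gi_tgt x b : Gi x (tgt b) = G x (src b).
Proof.
rewrite -{2}(eps_tgt1 hH b) -coci_conv (tgtE hH) /conv.
have ha := conv_adm rpf_G lpf_Gi bal_mul0.
rewrite [RHS](S_lb hC0 b (c1 : C0) (adm_bal hC0 x ha)).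
have hb : bal lactop lact (fun y1 y2 => tsum (fun x1 x2 => G x1 y1 * Gi x2 (b ▸ y2)) (cop x)).
  have [h1 h2 h3] := adm_bal hC0 x ha.
  split; [by move=> n; exact: h1|by move=> n; exact: (adt_comp (h2 n))|].
  by move=> c u v; rewrite -lalb; exact: h3.
rewrite (S_c1 hC0 hb) -[LHS](counlF hC0 (h := fun t => Gi t (b ▸ bone))) //.
by apply: eq_tsum => u v; rewrite G1r; exact: Gi_la.
Qed.

(** [rat b] and [rbt b] are right multiplication by b and \bar b in the twisted product, as [mH_src]
    and [mH_tgt] confirm. They are written out in advance because the coring, on which that product
    is built, needs them. *)
Definition rat b (x : H) : H := tsum (fun u v => G u (src b) ▹ v) (cop x).
Definition rbt b (x : H) : H := tsum (fun u v => Gi v (tgt b) ▸ u) (cop x).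

Let bal_rat b : bal (@lactop _ _ H) lact (fun u v : H => G u (src b) ▹ v).
Proof. by split; [adt|adt|move=> *; rewrite G_lb laM']. Qed.

Let bal_rbt b : bal (@lactop _ _ H) lact (fun u v : H => Gi v (tgt b) ▸ u).
Proof. by split; [adt|adt|move=> *; rewrite Gi_la lbM']. Qed.

Lemma eps_rat b x : eps (rat b x) = G x (src b).
Proof.
rewrite /rat (tsum_adt _ _ epsD') -[RHS](counrF hC0 (h := fun t => G t (src b))) //.
by apply: eq_tsum => u v; rewrite (eps_lact hH) [RHS]G_lb.
Qed.

Lemma eps_rbt b x : eps (rbt b x) = Gi x (tgt b).
Proof.
rewrite /rbt (tsum_adt _ _ epsD') -[RHS](counlF hC0 (h := fun t => Gi t (tgt b))) //.
by apply: eq_tsum => u v; rewrite (eps_lactop hH) [RHS]Gi_la.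
Qed.

Lemma cop_rat b x : cop (rat b x) = tsum (fun u v => rat b u ⊠ v : TD) (cop x).
Proof.
have h3 : @bal3 _ _ C0 _ (fun u v w : H => (G u (src b) ▹ v) ⊠ w : TD).
  split; [by adt|by adt|by adt|..] => *.
  - by rewrite [in LHS]G_lb -laM'.
  - by rewrite [in LHS]lalb tpr_bal.
rewrite {1}/rat (tsum_adt _ _ copD').
under eq_tsum do rewrite (cop_lact hH).
rewrite -[LHS](coass hC0 h3); apply: eq_tsum => u v.
by rewrite /rat (tsum_adt (h := fun t : H => t ⊠ v : TD) _ _ (adt_tprl _ _ _)).
Qed.

Lemma cop_rbt b x : cop (rbt b x) = tsum (fun u v => u ⊠ rbt b v : TD) (cop x).
Proof.
have h3 : @bal3 _ _ C0 _ (fun u v w : H => u ⊠ (Gi w (tgt b) ▸ v) : TD).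
  split; [by adt|by adt|by adt|..] => *.
  - by rewrite [in RHS]/la /= -lalb tpr_bal.
  - by rewrite [in RHS]Gi_la -lbM'.
rewrite {1}/rbt (tsum_adt _ _ copD').
under eq_tsum do rewrite (cop_lactop hH).
rewrite [LHS](coass hC0 h3); apply: eq_tsum => u v.
by rewrite /rbt (tsum_adt _ _ (@adt_tprr _ _ _ _ _ _)).
Qed.

(** Both sides are sums over X_(1), X_(2), X_(3) in which X_(2) only contributes a scalar, and the
    scalars Gi(X_(2), \bar b) and G(X_(2), b) agree by [Gi_tgt]. *)
Lemma tak_t b x :
  tsum (fun u v => rbt b u ⊠ v : TD) (cop x) = tsum (fun u v => u ⊠ rat b v) (cop x).
Proof.
have h3 : @bal3 _ _ C0 _ (fun u v w : H => (Gi v (tgt b) ▸ u) ⊠ w : TD).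
  split; [by adt|by adt|by adt|..] => *.
  - by rewrite [in RHS]Gi_la -lbM'.
  - by rewrite [in LHS]Gi_lb -lbM' !tpr_bal laM'.
transitivity (tsum (fun u w => tsum (fun a c => (Gi c (tgt b) ▸ a) ⊠ w : TD) (cop u)) (cop x)).
  apply: eq_tsum => u w.
  by rewrite /rbt (tsum_adt (h := fun t : H => t ⊠ w : TD) _ _ (adt_tprl _ _ _)).
rewrite [LHS](coass hC0 h3); apply: eq_tsum => u w.
rewrite /rat (tsum_adt _ _ (@adt_tprr _ _ _ _ _ _)); apply: eq_tsum => a c.
by rewrite tpr_bal Gi_tgt.
Qed.

(* The index [true] belongs to H and [false] to its twist. *)
Definition ra2 (i : bool) : B -> H -> H := if i then @ract _ _ H else rat.
Definition rb2 (i : bool) : B -> H -> H := if i then @ractop _ _ H else rbt.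

Definition coring2 : coringData B bool := coring_of ra2 rb2.
Local Notation C := coring2.

Lemma coring2_ax : coring coring2.
Proof.
have [] := hC0 => laDl laDr lbDl lbDr laM lbM la1 lb1 la_lb cDD cD_la cD_lb coass
  ceD ce_la ce_lb counl counr cD1 ce1 raDl raDr rbDl rbDr ra_la ra_lb rb_la rb_lb
  cD_ra cD_rb takeuchi ce_rarb ra_c1 rb_c1.
apply: Coring.
- exact: laDl.
- exact: laDr.
- exact: lbDl.
- exact: lbDr.
- exact: laM.
- exact: lbM.
- exact: la1.
- exact: lb1.
- exact: la_lb.
- exact: cDD.
- exact: cD_la.
- exact: cD_lb.
- move=> A F [h1 h2 h3 h4 h5] x; apply: coass.
  split; [exact: h1|exact: h2|exact: h3|exact: h4|exact: h5].
- exact: ceD.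
- exact: ce_la.
- exact: ce_lb.
- exact: counl.
- exact: counr.
- exact: cD1.
- exact: ce1.
- by case=> x; [exact: (raDl tt)|rewrite /= /rat; adt].
- by case=> b; [exact: (raDr tt)|exact: (SD hC0 (bal_rat b))].
- by case=> x; [exact: (rbDl tt)|rewrite /= /rbt; adt].
- by case=> b; [exact: (rbDr tt)|exact: (SD hC0 (bal_rbt b))].
- case=> b c x; first exact: (ra_la tt).
  rewrite [LHS](S_la hC0 c x (bal_rat b)) [RHS](tsum_adt _ _ (lactDr' c)).
  by apply: eq_tsum => u v; rewrite laM'; congr lact; exact: G_la.
- case=> b c x; first exact: (ra_lb tt).
  rewrite [LHS](S_lb hC0 c x (bal_rat b)) [RHS](tsum_adt _ _ (lactopDr' c)).
  by apply: eq_tsum => u v; exact: lalb.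
- case=> b c x; first exact: (rb_la tt).
  rewrite [LHS](S_la hC0 c x (bal_rbt b)) [RHS](tsum_adt _ _ (lactDr' c)).
  by apply: eq_tsum => u v; exact: esym (lalb _ _ _).
- case=> b c x; first exact: (rb_lb tt).
  rewrite [LHS](S_lb hC0 c x (bal_rbt b)) [RHS](tsum_adt _ _ (lactopDr' c)).
  by apply: eq_tsum => u v; rewrite lbM'; congr lactop; exact: Gi_lb.
- by case=> b x; [exact: (cD_ra tt)|exact: cop_rat].
- by case=> b x; [exact: (cD_rb tt)|exact: cop_rbt].
- by case=> b x; [exact: (takeuchi tt)|exact: tak_t].
- by case=> b x; [exact: (ce_rarb tt)|rewrite /= eps_rat eps_rbt Gi_tgt].
- case=> b; first exact: (ra_c1 tt).
  rewrite [LHS](S_c1 hC0 (bal_rat b)) [RHS]/la /=; congr lact.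
  by rewrite [LHS]G1l (eps_src1 hH).
- case=> b; first exact: (rb_c1 tt).
  rewrite [LHS](S_c1 hC0 (bal_rbt b)) [RHS]/lb /=; congr lactop.
  by rewrite [LHS]Gi_tgt G1l (eps_src1 hH).
Qed.

Let hC := coring2_ax.

Lemma rbt_rbt b b' x : rbt b (rbt b' x) = rbt (b * b') x.
Proof.
rewrite {1}/rbt [LHS](S_rb hC false b' x (bal_rbt b)) /rbt.
apply: eq_tsum => u v; congr lactop.
rewrite -/(rbt b' v) (tgt_M (bia_tgt hH)) -(tgt_lactop (bia_tgt hH)).
rewrite /rbt (tsum_adt _ _ (GiDl _)) (coci_lactop hGi) tsum.unlock.
by apply: eq_bigr => p _; rewrite Gi_lb.
Qed.

(** The cocycle condition with [src b] as its middle argument. The mirror statement [Gi_rbt] is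
    instead the axiom [coci_lactop] read backwards. *)
Lemma G_rat b x y : G (rat b x) y = G x (b ▹ y).
Proof.
have e1 : cocycle_mul G x (src b) = rat b x.
  rewrite cocycle_mulE /conv srcE //.
  have h := adm_bal hC0 x (conv_adm rpf_G lpf_m bal_laop0).
  rewrite (S_la hC0 b c1 h).
  have h' : bal lactop lact (fun y1 y2 => tsum (fun x1 x2 => G x1 (b ▹ y1) ▹ (x2 ⋅ y2)) (cop x)).
    have [h1 h2 h3] := h.
    split; [by move=> n; exact: (adt_comp (h1 n))|by move=> n; exact: h2|].
    by move=> c u v; rewrite lalb; exact: h3.
  rewrite (S_c1 hC0 h') /rat srcE //; apply: eq_tsum => u v.
  by rewrite (alg_mulr1 hA).
have e2 z : cocycle_mul G (src b) z = b ▹ z.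
  rewrite cocycle_mulE /conv srcE //.
  have h := admx (conv_adm rpf_G lpf_m bal_laop0).
  transitivity (tsum (fun y1 y2 => b ▹ eps y1 ▹ y2) (cop z)); last first.
    by rewrite -(tsum_adt _ _ (lactDr' b)) (counl hC0).
  apply: eq_tsum => y1 y2.
  rewrite (S_la hC0 b c1 (h y1 y2)).
  rewrite (S_c1 hC0) /=; first by rewrite G_la G1l (alg_mul1 hA) laM'.
  have [h1 h2 h3] := h y1 y2.
  split; [by move=> n; exact: (adt_comp (h1 n))|by move=> n; exact: h2|].
  by move=> c u v; rewrite lalb; exact: h3.
by rewrite -e1 -(coc_cocycle hG) e2.
Qed.

Lemma Gi_rbt b x y : Gi (rbt b x) y = Gi x (b ▸ y).
Proof.
rewrite /rbt (tsum_adt _ _ (GiDl _)) (coci_lactop hGi) tsum.unlock.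
by apply: eq_bigr => p _; rewrite Gi_lb.
Qed.

Definition ctw (i j : bool) : H -> H -> B :=
  match i, j with
  | true, true => fun x y => eps (x ⋅ y)
  | true, false => Gi
  | false, true => G
  | false, false => fun x y => G x (src (eps y))
  end.

Lemma ctw_diag i x y : ctw i i x y = eps (ra2 i (eps y) x).
Proof. by case: i; rewrite /= ?eps_rat // /ract (eps_src hH). Qed.

Lemma ctw_lpf i j : @lpf _ _ C i B lmulB (ctw i j).
Proof.
case: i j => [] []; split; rewrite /ctw.
- by adt.
- by adt.
- by move=> b x y; rewrite [_ b x]/= (lact_bmul hH) (eps_lact hH).
- by move=> b x y; rewrite [_ b x]/= (ract_bmul hH).
- by adt.
- by adt.
- exact: Gi_la.
- by move=> *; exact: (coci_bal hGi).
- by adt.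
- by adt.
- exact: G_la.
- exact: G_rat.
- by adt.
- by adt.
- by move=> *; exact: G_la.
- move=> b x y; rewrite G_rat eps_lact // (src_M (bia_src hH)).
  by rewrite (src_lact (bia_src hH)).
Qed.

Lemma ctw_rpf i j : @rpf _ _ C j B rmulB (ctw i j).
Proof.
case: i j => [] []; split; rewrite /ctw.
- by adt.
- by adt.
- by move=> b x y; rewrite [_ b x]/= (lactop_bmul hH) (eps_lactop hH).
- by move=> b x y; rewrite [_ b x]/= (ractop_bmul hH).
- by adt.
- by adt.
- exact: Gi_lb.
- exact: Gi_rbt.
- by adt.
- by adt.
- exact: G_lb.
- by move=> *; exact: (coc_bal hG).
- by adt.
- by adt.
- by move=> *; exact: G_lb.
- move=> b x y.
  have e b' z : eps (rat b' z) = eps (rbt b' z) := ce_rarb hC false b' z.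
  by rewrite -!eps_rat !e [_ b x]/= rbt_rbt eps_lactop.
Qed.

Lemma ctw_conv i l j x y :
  @conv _ _ C B B B mulB (ctw i l) (ctw l j) x y = ctw i j x y.
Proof.
have [<-|nil] := eqVneq i l.
  exact: (conv_unitl hC (ctw_diag i) _ _ (ctw_lpf i j)).
have [<-|nlj] := eqVneq l j.
  exact: (conv_unitr hC (ctw_diag l) _ _ (ctw_rpf i l)).
case: i l j nil nlj => [] [] [] // _ _.
  by rewrite /conv tsum_exch tsum.unlock; exact: (coci_r hGi).
exact: coci_conv.
Qed.

(** Normalisation of the inverse is obtained by evaluating G * Gi at the unit, where G reduces to
    the counit. *)
Lemma Gi1l x : Gi bone x = eps x.
Proof.
have e := ctw_conv false true false bone x.
rewrite /ctw G1l (eps_src1 hH) in e; rewrite -{}e /conv.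
rewrite -{1}(counl hC x) (tsum_adt _ _ (GiDr _)); apply: eq_tsum => y1 y2.
rewrite (S_c1 hC (admx (conv_adm (ctw_rpf false true) (ctw_lpf true false) bal_mul0) y1 y2)).
rewrite -(coci_bal hGi) /ract (alg_mul1 hA) /= G1l -Gi_la.
by rewrite srcE.
Qed.

Lemma ctw1l i j x : ctw i j bone x = eps x.
Proof.
case: i j => [] [] /=.
- by rewrite (alg_mul1 hA).
- exact: Gi1l.
- exact: G1l.
- by rewrite G1l eps_src1.
Qed.

Lemma Gi1r x : Gi x bone = eps x.
Proof.
have e := ctw_conv false true false x bone.
rewrite /ctw (eps_1 hH) (src_1 (bia_src hH)) G1r in e; rewrite -{}e /conv.
rewrite (S_c1 hC (adm_bal hC x (conv_adm (ctw_rpf false true) (ctw_lpf true false) bal_mul0))).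
rewrite -{1}(counl hC x) (tsum_adt _ _ (GiDl _)); apply: eq_tsum => u v.
by rewrite /= G1r Gi_la.
Qed.

Lemma ctw1r i j x : ctw i j x bone = eps x.
Proof.
case: i j => [] [] /=.
- by rewrite (alg_mulr1 hA).
- exact: Gi1r.
- exact: G1r.
- by rewrite (eps_1 hH) (src_1 (bia_src hH)) G1r.
Qed.

Lemma bmul_lpf : @lpf _ _ C true C (@la _ _ C) bmul.
Proof. by case: lpf_m. Qed.

Lemma bmul_rpf : @rpf _ _ C true C (@lb _ _ C) bmul.
Proof. by case: rpf_m. Qed.

Lemma ltw_coc i x y z :
  ctw i true (@ltw _ _ C true bmul ctw i x y) z
    = ctw i true x (@ltw _ _ C true bmul ctw i y z).
Proof.
case: i.
  rewrite !(ltwoE hC bmul_lpf ctw_diag) /=.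
  by rewrite (alg_mulA hA).
by have := coc_cocycle hG x y z; rewrite !cocycle_mulE => e; exact: (esym e).
Qed.

Definition mH : bool -> bool -> H -> H -> H := @mtw _ _ C true bmul ctw.

Theorem mH_mult : mult (C := C) mH.
Proof.
apply: (mult_mtw hC bmul_lpf bmul_rpf (alg_mulA hA) (alg_mul1 hA) (alg_mulr1 hA) _
  _ ctw_lpf ctw_rpf ctw_conv ctw_diag ctw1l ctw1r ltw_coc).
- exact: (cop_bmul hH).
- by [].
Qed.

Lemma mH_H x y : mH true true x y = x ⋅ y.
Proof.
apply: etrans (mtw_o_r hC bmul_lpf bmul_rpf ctw_rpf ctw_diag true x y) _.
exact: (ltwoE hC bmul_lpf ctw_diag).
Qed.

Lemma mH_P x y : mH false true x y = cocycle_mul G x y.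
Proof.
apply: etrans (mtw_o_r hC bmul_lpf bmul_rpf ctw_rpf ctw_diag false x y) _.
by rewrite cocycle_mulE.
Qed.

Lemma eps_mH i j x y : eps (mH i j x y) = ctw i j x y.
Proof. by apply: (ce_mtw hC _ ctw_conv). Qed.

Lemma mH_coc x y z : Gi (mH true false x y) z = Gi x (mH true false y z).
Proof.
exact: (coc_mtw_o hC bmul_lpf bmul_rpf (alg_mulA hA) (alg_mulr1 hA) (cop_bmul hH)
  ctw_lpf ctw_rpf ctw_conv ctw_diag ctw1r ltw_coc false).
Qed.

End Cocycle.

Lemma adt_linear (R : pzRingType) (U V : lmodType R) (f : U -> V) :
  adt f -> (forall a x, f (a *: x) = a *: f x) -> linear f.
Proof. by move=> hf hs a x y; rewrite (adtD hf) hs. Qed.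

Lemma linear_scale (R : pzRingType) (U V : lmodType R) (f : U -> V) :
  linear f -> forall a x, f (a *: x) = a *: f x.
Proof.
by move=> h a x; have := h a x 0; rewrite !addr0 (adt0 (linear_adt h)) addr0.
Qed.

Lemma bij_tlift (B : Type) (M N G : zmodType) (r r' : B -> M -> M)
    (l : B -> N -> N) (f f' : M -> N -> G) :
  (forall b x, r' b x = r b x) -> (forall x y, f' x y = f x y) ->
  bijective (tsum f : tens r l -> G) <-> bijective (tlift f' : tens r' l -> G).
Proof.
move=> er ef.
have -> : r' = r by apply/funext => b; apply/funext => x; exact: er.
have -> : f' = f by apply/funext => x; apply/funext => y; exact: ef.
by rewrite tsum.unlock.
Qed.

Lemma xget_bij (T T' : choice.Choice.type) (f : T -> T') (x0 : T) (y : T') :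
  bijective f -> f (xget x0 [set w | f w = y]) = y.
Proof.
move=> [g fK gK]; apply: (@xgetPex _ x0 [set w | f w = y]).
by exists (g y) => /=; rewrite gK.
Qed.

(** * The biGalois extension *)

Section Main.
Variables (k : fieldType) (B : algType k) (H : hopfdata B).
Hypothesis hH : is_bialgebroid H.
Variables G Gi : H -> H -> B.
Hypothesis hG : is_2cocycle H G.
Hypothesis hGi : is_cocycle_inverse H G Gi.

Local Notation C := (coring2 G Gi).
Local Notation m := (mH G Gi).
Local Notation TD := (tens (@lactop _ _ H) (@lact _ _ H)).
Let hC : coring C := coring2_ax hH hG hGi.
Let hm : mult (C := C) m := mH_mult hH hG hGi.

(* H with another product. *)
Definition ber (f : H -> H -> H) : berng B :=
  @BeRng _ _ H f bone src tgt lact lactop.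
Definition hop (f : H -> H -> H) : hopfdata B := @HopfData _ _ (ber f) cop eps.

Lemma cop3_sum (A : zmodType) (F : H -> H -> H -> A) (x : H) :
  \sum_(u <- cop3 x) F u.1.1 u.1.2 u.2
    = tsum (fun t w => tsum (fun a b => F a b w) (cop t)) (cop x).
Proof. by rewrite /cop3 big_allpairs_dep tsum.unlock. Qed.

Lemma cop3_conv (g h : H -> H -> B) (f : H -> H -> H) (x y : H) :
  \sum_(u <- cop3 x) \sum_(v <- cop3 y) g u.1.1 v.1.1 ▹ h u.2 v.2 ▸ f u.1.2 v.1.2
  = @conv _ _ C C B C (fun v b => @lactop _ _ H b v)
      (@conv _ _ C B C C (@lact _ _ H) g f) h x y.
Proof.
pose F a b w := tsum (fun t z => tsum (fun c d =>
  g a c ▹ h w z ▸ f b d) (cop t)) (cop y).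
transitivity (\sum_(u <- cop3 x) F u.1.1 u.1.2 u.2).
  apply: eq_bigr => u _.
  exact: (cop3_sum (fun c d z => g u.1.1 c ▹ h u.2 z ▸ f u.1.2 d)).
rewrite cop3_sum.
under eq_tsum => t w do rewrite /F tsum_exch.
rewrite tsum_exch; apply: eq_tsum => y1 y2; apply: eq_tsum => x1 x2.
rewrite tsum_exch [RHS](tsum_adt _ _ (lactopDr hH _)); apply: eq_tsum => c d.
rewrite [RHS](tsum_adt _ _ (lactopDr hH _)); apply: eq_tsum => a b.
by rewrite (lact_lactop hH).
Qed.

Lemma mH_L x y : m false false x y =
  \sum_(u <- cop3 x) \sum_(v <- cop3 y)
    G u.1.1 v.1.1 ▹ Gi u.2 v.2 ▸ (u.1.2 ⋅ v.1.2).
Proof. by rewrite cop3_conv. Qed.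

(** This is m_22 = c_21 * m_11 * c_12, which undoes m_11 = c_12 * m_22 * c_21. *)
Lemma twist_twist_mul x y : x ⋅ y =
  \sum_(u <- cop3 x) \sum_(v <- cop3 y)
    Gi u.1.1 v.1.1 ▹ G u.2 v.2 ▸ m false false u.1.2 v.1.2.
Proof.
rewrite cop3_conv -(mH_H hH hG hGi) (m_convr hC hm true false true); apply: eq_conv => u v.
  rewrite (m_convl hC hm true false false); apply: eq_conv => // a b.
  exact: (eps_mH hH hG hGi).
exact: (eps_mH hH hG hGi).
Qed.

(** The corings above know only additivity. As k acts through B, linearity over k is recovered from
    linearity over B. *)
Lemma scale_lact a (x : H) : a *: x = a%:A ▹ x.
Proof.
rewrite (src_lact (bia_src hH)) (linear_scale (src_lin (bia_src hH))).
rewrite (src_1 (bia_src hH)) (linear_scale (alg_linl (bia_alg hH) x)).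
by rewrite (alg_mul1 (bia_alg hH)).
Qed.

Lemma scale_lactop a (x : H) : a *: x = a%:A ▸ x.
Proof.
rewrite (tgt_lactop (bia_tgt hH)) (linear_scale (tgt_lin (bia_tgt hH))).
rewrite (tgt_1 (bia_tgt hH)) (linear_scale (alg_linl (bia_alg hH) x)).
by rewrite (alg_mul1 (bia_alg hH)).
Qed.

Lemma lact_linear b : linear (lact b : H -> H).
Proof.
apply: adt_linear (lactDr hH b) _ => a x.
by rewrite !(src_lact (bia_src hH)) (linear_scale (alg_linr (bia_alg hH) _)).
Qed.

Lemma lactop_linear b : linear (lactop b : H -> H).
Proof.
apply: adt_linear (lactopDr hH b) _ => a x.
by rewrite !(tgt_lactop (bia_tgt hH)) (linear_scale (alg_linr (bia_alg hH) _)).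
Qed.

Lemma lact_linearl (x : H) : linear (fun b => lact b x).
Proof.
apply: adt_linear (lactDl hH x) _ => a b.
rewrite !(src_lact (bia_src hH)) (linear_scale (src_lin (bia_src hH))).
by rewrite (linear_scale (alg_linl (bia_alg hH) x)).
Qed.

Lemma lactop_linearl (x : H) : linear (fun b => lactop b x).
Proof.
apply: adt_linear (lactopDl hH x) _ => a b.
rewrite !(tgt_lactop (bia_tgt hH)) (linear_scale (tgt_lin (bia_tgt hH))).
by rewrite (linear_scale (alg_linl (bia_alg hH) x)).
Qed.

Lemma ra2_scale i a (x : H) : ra2 G i a%:A x = a *: x.
Proof.
case: i => /=.
  rewrite /ract (linear_scale (src_lin (bia_src hH))) (src_1 (bia_src hH)).
  by rewrite (linear_scale (alg_linr (bia_alg hH) x)) (alg_mulr1 (bia_alg hH)).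
rewrite /rat -{2}(counl hC x) -[RHS]/((fun t => a *: t) _) tsum_adt; last first.
  by split=> u v; rewrite scalerDr.
apply: eq_tsum => u v.
rewrite (linear_scale (src_lin (bia_src hH))) (src_1 (bia_src hH)).
rewrite (linear_scale (coc_linr hG u)) (G1r hG).
by rewrite (linear_scale (lact_linearl v)).
Qed.

Lemma ber_alg i j : is_alg (ber (m i j)).
Proof.
split.
- move=> y; apply: adt_linear (lpfDl (m_lpf hm i j) y) _ => a x.
  by rewrite !scale_lact; exact: (m_la hm).
- move=> x; apply: adt_linear (lpfDr (m_lpf hm i j) x) _ => a y.
  rewrite {1}scale_lact -[LHS](m_ra hm) [X in m _ _ X _]ra2_scale.
  by rewrite !scale_lact; exact: (m_la hm).
- exact: (mA hm i j).
- exact: (m1l hm i j).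
- exact: (m1r hm i j).
Qed.

Lemma mH_src i j b x : m i j x (src b) = ra2 G i b x.
Proof. by rewrite srcE //; exact: (m_la1 hm). Qed.

Lemma mH_tgt i j b x : m i j x (tgt b) = rb2 Gi j b x.
Proof. by rewrite tgtE //; exact: (m_lb1 hm). Qed.

Lemma src_mH i j b x : m i j (src b) x = b ▹ x.
Proof. by rewrite srcE // (m_la hm) (m1l hm). Qed.

Lemma tgt_mH i j b x : m i j (tgt b) x = b ▸ x.
Proof. by rewrite tgtE // (m_lb hm) (m1l hm). Qed.

Lemma ber_src i j : is_src (ber (m i j)).
Proof.
split.
- exact: (src_lin (bia_src hH)).
- exact: (src_1 (bia_src hH)).
- move=> b c; rewrite [RHS]src_mH [LHS](src_M (bia_src hH)).
  by rewrite (src_lact (bia_src hH)).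
- by move=> b p; rewrite [RHS]src_mH.
Qed.

Lemma ber_tgt i j : is_tgt (ber (m i j)).
Proof.
split.
- exact: (tgt_lin (bia_tgt hH)).
- exact: (tgt_1 (bia_tgt hH)).
- move=> b c; rewrite [RHS]tgt_mH [LHS](tgt_M (bia_tgt hH)).
  by rewrite (tgt_lactop (bia_tgt hH)).
- by move=> b p; rewrite [RHS]tgt_mH.
Qed.

Lemma ber_comm i j : src_tgt_commute (ber (m i j)).
Proof.
move=> b c; rewrite [LHS]src_mH [RHS]tgt_mH /= srcE // tgtE //.
exact: (lact_lactop hH).
Qed.

Lemma ber_takeuchi i j l (x : H) b :
  (\sw_(u <- cop x) m l i u.1 (tgt b) ⊗ u.2 : TD)
    = \sw_(u <- cop x) u.1 ⊗ m i j u.2 (src b).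
Proof.
have := takeuchi hC i b x; rewrite tsum.unlock tpr.unlock => e.
apply: etrans (etrans _ e) _; apply: eq_bigr => p _.
  by rewrite mH_tgt.
by rewrite mH_src.
Qed.

Lemma ber_cop_M i l j (x y : H) :
  (cop (m i j x y) : TD)
    = \sw_(u <- cop x) \sw_(v <- cop y) m i l u.1 v.1 ⊗ m l j u.2 v.2.
Proof.
apply: etrans (cD_m hm l i j x y) _.
by rewrite /conv tsum_exch tsum.unlock tpr.unlock.
Qed.

Lemma hop_bialgebroid i : is_bialgebroid (hop (m i i)).
Proof.
split.
- exact: ber_alg.
- exact: ber_src.
- exact: ber_tgt.
- exact: ber_comm.
- exact: (cop_add hH).
- by move=> x a; exact: ber_takeuchi.
- exact: (cop_1 hH).
- by move=> x y; exact: ber_cop_M.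
- exact: (cop_bilin hH).
- exact: (cop_coassoc hH).
- exact: (eps_lin hH).
- exact: (eps_bilin hH).
- exact: (eps_l hH).
- exact: (eps_r hH).
- exact: (eps_1 hH).
- move=> x y; rewrite [X in eps X = _]mH_src; exact: esym (ce_m hm i x y).
- move=> x y; rewrite [X in eps X = _]mH_tgt -[LHS](ce_rarb hC).
  exact: esym (ce_m hm i x y).
Qed.

Hypothesis hl : bijective (@hopf_lambda _ _ H).
Hypothesis hr : bijective (@hopf_mu _ _ H).

Lemma lam_tlift (r' : B -> H -> H) i j : (forall b x, r' b x = rb2 Gi j b x) ->
  bijective (lam (C := C) m i j) <->
  bijective (tlift (fun x y : H => \sw_(u <- cop x) u.1 ⊗ m i j u.2 y)
    : tens r' (@lactop _ _ H) -> TD).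
Proof.
move=> er; apply: bij_tlift => // x y.
by rewrite tsum.unlock tpr.unlock.
Qed.

Lemma mu_tlift (r' : B -> H -> H) i j : (forall b x, r' b x = ra2 G i b x) ->
  bijective (mu (C := C) m i j) <->
  bijective (tlift (fun x y : H => \sw_(u <- cop x) m i j u.1 y ⊗ u.2)
    : tens r' (@lact _ _ H) -> TD).
Proof.
move=> er; apply: bij_tlift => // x y.
by rewrite tsum.unlock tpr.unlock.
Qed.

Lemma mH_Hfun : m true true = bmul.
Proof. by apply/funext => x; apply/funext => y; exact: mH_H. Qed.

Lemma lamH : bijective (lam (C := C) m true true).
Proof.
have e := lam_tlift (r' := @ractop _ _ H) true (j := true) (fun _ _ => erefl).
by apply: e.2; rewrite mH_Hfun; exact: hl.
Qed.

Lemma muH : bijective (mu (C := C) m true true).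
Proof.
have e := mu_tlift (r' := @ract _ _ H) (i := true) true (fun _ _ => erefl).
by apply: e.2; rewrite mH_Hfun; exact: hr.
Qed.

Lemma lamP : bijective (lam (C := C) m false true).
Proof. exact: (lam_bij hC hm false lamH muH). Qed.

Lemma muP : bijective (mu (C := C) m false true).
Proof. exact: (mu_change hC hm false muH). Qed.

(** [lam_change] moves the second index and [mu_change] the first. Hence L is reached from H through
    P for lambda, but through Q for mu. *)
Lemma lamL : bijective (lam (C := C) m false false).
Proof. exact: (lam_change hC hm false lamP). Qed.

Lemma muL : bijective (mu (C := C) m false false).
Proof. exact: (mu_change hC hm false (mu_bij hC hm false lamH muH)). Qed.

Lemma hop_hopf i : is_hopf_algebroid (hop (m i i)).
Proof.
split; first exact: hop_bialgebroid.
  apply: (lam_tlift (r' := @ractop _ _ (hop (m i i))) i (j := i) _).1.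
    by move=> b x; exact: mH_tgt.
  by case: i; [exact: lamH|exact: lamL].
apply: (mu_tlift (r' := @ract _ _ (hop (m i i))) (i := i) i _).1.
  by move=> b x; exact: mH_src.
by case: i; [exact: muH|exact: muL].
Qed.

Lemma cop_lact_sw b (x : H) : cop (b ▹ x) = \sw_(u <- cop x) (b ▹ u.1) ⊗ u.2.
Proof. by rewrite (cop_lact hH) tsum.unlock tpr.unlock. Qed.

Lemma cop_lactop_sw b (x : H) : cop (b ▸ x) = \sw_(u <- cop x) u.1 ⊗ (b ▸ u.2).
Proof. by rewrite (cop_lactop hH) tsum.unlock tpr.unlock. Qed.

Lemma cop_src b : cop (src b : H) = src b ⊗ bone.
Proof.
rewrite srcE // (cop_lact hH) (cop_one hH) tsum_pure ?tprE //.
split=> *; [apply: (adt_comp (adt_tprl _ _ _) (lactDr hH _))|exact: adt_tprr|].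
by rewrite (lact_lactop hH) tpr_bal.
Qed.

Lemma cop_tgt b : cop (tgt b : H) = bone ⊗ tgt b.
Proof.
rewrite tgtE // (cop_lactop hH) (cop_one hH) tsum_pure ?tprE //.
split=> *; [exact: adt_tprl|apply: (adt_comp (adt_tprr _ _ _) (lactopDr hH _))|].
by rewrite -(lact_lactop hH) tpr_bal.
Qed.

Lemma hop_lcomod i : @is_lcomod _ _ (hop (m i i)) H (@lact _ _ H) cop.
Proof.
split.
- split; [exact: lact_linearl|exact: lact_linear|exact: lact1|].
  by move=> b c v; exact: esym (laM hC b c v).
- exact: (cop_add hH).
- exact: cop_lact_sw.
- exact: (cop_coassoc hH).
- exact: (eps_l hH).
Qed.

Lemma hop_rcomod i : @is_rcomod _ _ (hop (m i i)) H (@lactop _ _ H) cop.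
Proof.
split.
- split; [exact: lactop_linearl|exact: lactop_linear|exact: lactop1|].
  by move=> b c v; exact: esym (lbM hC c b v).
- exact: (cop_add hH).
- exact: cop_lactop_sw.
- exact: (cop_coassoc hH).
- exact: (eps_r hH).
Qed.

Lemma lcomod_ractE i b (x : H) :
  @lcomod_ract _ _ (hop (m i i)) H (@lact _ _ H) cop b x = ra2 G i b x.
Proof.
apply: etrans _ (esym (ra_sum hC i b x)); rewrite tsum.unlock.
by apply: eq_bigr => p _; rewrite [ract _ _]mH_src.
Qed.

Lemma rcomod_ractopE i b (x : H) :
  @rcomod_ractop _ _ (hop (m i i)) H (@lactop _ _ H) cop b x = rb2 Gi i b x.
Proof.
apply: etrans _ (esym (rb_sum hC i b x)); rewrite tsum.unlock.
apply: eq_bigr => p _; rewrite [ract _ _]mH_src.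
by congr lactop; exact: (ce_rarb hC).
Qed.

Lemma hop_lcomod_alg i j : @is_lcomod_alg _ _ (hop (m i i)) (ber (m i j)) cop.
Proof.
split.
- exact: hop_lcomod.
- exact: ber_alg.
- exact: ber_src.
- by move=> b p; rewrite [LHS]lcomod_ractE [RHS]mH_src.
- by move=> p b; exact: ber_takeuchi.
- by move=> p q; exact: ber_cop_M.
- exact: (cop_1 hH).
- exact: cop_src.
Qed.

Lemma hop_rcomod_alg i j : @is_rcomod_alg _ _ (hop (m j j)) (ber (m i j)) cop.
Proof.
split.
- exact: hop_rcomod.
- exact: ber_alg.
- exact: ber_tgt.
- by move=> b p; rewrite [LHS]rcomod_ractopE [RHS]mH_tgt.
- by move=> p b; exact: ber_takeuchi.
- by move=> p q; exact: ber_cop_M.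
- exact: (cop_1 hH).
- exact: cop_tgt.
Qed.

Lemma tgt_inj : injective (@tgt _ _ H).
Proof. exact: (can_inj (eps_tgt1 hH)). Qed.

Lemma src_inj : injective (@src _ _ H).
Proof. exact: (can_inj (eps_src1 hH)). Qed.

Lemma coinv_tgt (p : H) : cop p = bone ⊗ p -> p = tgt (eps p).
Proof.
move=> e; rewrite -{1}(counr hC p) /cD /= e tprE tsum_pure; first by rewrite tgtE.
split=> *; [exact: (lbDr hC)|exact: (adt_comp (lbDl hC _) (ceD hC))|].
by rewrite (eps_lact hH); exact: (lbM hC).
Qed.

Lemma coinv_src (p : H) : cop p = p ⊗ bone -> p = src (eps p).
Proof.
move=> e; rewrite -{1}(counl hC p) /cD /= e tprE tsum_pure; first by rewrite srcE.
split=> *; [exact: (adt_comp (laDl hC _) (ceD hC))|exact: (laDr hC)|].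
by rewrite (eps_lactop hH); exact: esym (laM hC _ _ _).
Qed.

Lemma hop_bicomod i j : @is_bicomod_alg _ _ (hop (m i i)) (hop (m j j)) (ber (m i j)) cop cop.
Proof.
split.
- exact: ber_comm.
- exact: hop_lcomod_alg.
- exact: hop_rcomod_alg.
- exact: cop_lactop_sw.
- exact: cop_lact_sw.
- exact: (cop_coassoc hH).
Qed.

Lemma hop_biGalois :
  is_biGalois (hop (m false false)) (hop (m true true)) (ber (m false true)) cop cop.
Proof.
split.
- exact: hop_hopf.
- exact: hop_hopf.
- exact: hop_bicomod.
- exact: tgt_inj.
- apply/seteqP; split=> [p /coinv_tgt e|_ [b _ <-]]; last exact: cop_tgt.
  by exists (eps p).
- exact: src_inj.
- apply/seteqP; split=> [p /coinv_src e|_ [b _ <-]]; last exact: cop_src.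
  by exists (eps p).
- apply: (lam_tlift (r' := @ractop _ _ (ber (m false true))) false (j := true) _).1.
    by move=> b x; exact: mH_tgt.
  exact: lamP.
- apply: (mu_tlift (r' := @ract _ _ (ber (m false true))) (i := false) true _).1.
    by move=> b x; exact: mH_src.
  exact: muP.
Qed.

(** Of the chosen preimage only the equation that defines it is used. The right action is first
    rewritten to [rb2], because the balancing relation is part of the type of the tensor. *)
Lemma trans_lambda_tsum i (F : H -> H -> H) (x y : H) :
  (forall w, lam (C := C) m i i w = x ⊠ bone -> tsum F w = y) ->
  \sw_(p <- trans_lambda (H := hop (m i i)) x) F p.1 p.2 = y.
Proof.
have := xget_bij 0 (x ⊗ bone : TD) (hopf_lambda_bij (hop_hopf i)).
rewrite -/(trans_lambda _).
move: (trans_lambda _); rewrite /hopf_lambda.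
have -> : @ractop _ _ (hop (m i i)) = rb2 Gi i.
  by apply/funext => b; apply/funext => p; exact: mH_tgt.
move=> w e /(_ w); rewrite /lam tsum.unlock tpr.unlock; exact.
Qed.

Lemma trans_mu_tsum i (F : H -> H -> H) (x y : H) :
  (forall w, mu (C := C) m i i w = bone ⊠ x -> tsum F w = y) ->
  \sw_(p <- trans_mu (H := hop (m i i)) x) F p.1 p.2 = y.
Proof.
have := xget_bij 0 (bone ⊗ x : TD) (hopf_mu_bij (hop_hopf i)).
rewrite -/(trans_mu _).
move: (trans_mu _); rewrite /hopf_mu.
have -> : @ract _ _ (hop (m i i)) = ra2 G i.
  by apply/funext => b; apply/funext => p; exact: mH_src.
move=> w e /(_ w); rewrite /mu tsum.unlock tpr.unlock; exact.
Qed.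

Lemma hop_left_cleft : left_cleft (hop (m false false)) (ber (m false true)) cop.
Proof.
split.
- exact: hop_lcomod_alg.
(* The coaction is the coproduct, so the reversibility map is the map mu of L. *)
- apply: (mu_tlift (i := false) false _).1 muL.
  by move=> b x; exact: lcomod_ractE.
- by split; [exact: ber_tgt|exact: tgt_inj|move=> _ [b _ <-]; exact: cop_tgt].
(* The cleaving map is the identity of the common underlying space, colinear because the coproduct
   is also the coaction. *)
exists id; split=> //.
  by move=> x; rewrite -repE.
(* The translation maps are those of L, so j is [false], and i is [true] in order that m_ji be the
   product of P. *)
have [r [h1 h2 h3 h4 h5]] := cleaving_op hC hm true lamL muL.
exists r; split.
- by apply: (adt_linear h1) => a x; rewrite !scale_lact; exact: h2.
- exact: h2.
- by move=> b x; rewrite [ractop b x]mH_tgt [RHS]mH_tgt; exact: h3.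
- move=> x; rewrite [src _](srcE hH).
  exact: (trans_lambda_tsum (fun w => h4 x w)).
- move=> x; rewrite [tgt _](tgtE hH).
  exact: (trans_mu_tsum (fun w => h5 x w)).
Qed.

Lemma hop_right_anticleft : right_anticleft (hop (m true true)) (ber (m false true)) cop.
Proof.
split.
- exact: hop_rcomod_alg.
- apply: (lam_tlift true (j := true) _).1 lamH.
  by move=> b x; exact: rcomod_ractopE.
- by split; [exact: ber_src|exact: src_inj|move=> _ [b _ <-]; exact: cop_src].
exists id; split=> //.
  by move=> x; rewrite -repE.
have [r [h1 h2 h3 h4 h5]] := cleaving hC hm false lamH muH.
exists r; split.
- by apply: (adt_linear h1) => a x; rewrite !scale_lactop; exact: h2.
- exact: h2.
- by move=> b x; rewrite [ract b x]mH_src [RHS]mH_src; exact: h3.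
- move=> x; rewrite [src _](srcE hH).
  exact: (trans_lambda_tsum (fun w => h4 x w)).
- move=> x; rewrite [tgt _](tgtE hH).
  exact: (trans_mu_tsum (fun w => h5 x w)).
Qed.

Lemma hop_2cocycle : is_2cocycle (hop (m false false)) Gi.
Proof.
split.
- exact: (coci_linl hGi).
- exact: (coci_linr hGi).
- by move=> x b y; rewrite [ractop b x]mH_tgt; exact: (Gi_rbt hH hGi).
- exact: (coci_bilin hGi).
- move=> x y z.
  (* The cocycle product formed in L from the inverse is c_21 * m_11 = m_21, the product of Q. *)
  have e u v : cocycle_mul (H := hop (m false false)) Gi u v = m true false u v.
    rewrite (m_convl hC hm true false false) /conv tsum_exch tsum.unlock.
    apply: eq_bigr => p _; apply: eq_bigr => q _; congr lact.
    exact: esym (eps_mH hH hG hGi true false _ _).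
  by rewrite !e (mH_coc hH hG hGi).
- exact: (Gi1l hH hG hGi).
- exact: (Gi1r hH hG hGi).
Qed.

Lemma hop_cocycle_inverse : is_cocycle_inverse (hop (m false false)) Gi G.
Proof.
split.
- exact: (coc_linl hG).
- exact: (coc_linr hG).
- by move=> x b y; rewrite [ract b x]mH_src; exact: (G_rat hH hG).
- exact: (coc_bilin hG).
- move=> x b y.
  apply: etrans (esym (coc_bal hG x b y)) _.
  (* Here x \bar b is expanded as \bar{eps(x_(2) \bar b)} x_(1), and the scalar eps(x_(2) \bar b)
     equals G(x_(2), \bar b) because G(X, 1) is the counit. *)
  apply: etrans (congr1 (G^~ y) (rb_sum hC true b x)) _.
  rewrite (tsum_adt _ _ (linear_adt (coc_linl hG y))) tsum.unlock.
  apply: eq_bigr => p _; rewrite [LHS](G_lb hH hG); congr (_ * _).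
  rewrite /= -(G1r hG) (coc_bal hG) tgtE //.
- move=> x y; have := ctw_conv hH hG hGi true false true x y.
  rewrite /conv tsum_exch tsum.unlock => e; apply: etrans e _.
  have e' : Gi x (src (eps y) : H) = eps (@bmul _ _ H x y).
    by rewrite (srcE hH) -(coci_bal hGi) (Gi1r hH hG hGi) /ract (eps_src hH).
  exact: esym e'.
- move=> x y; have := ctw_conv hH hG hGi false true false x y.
  rewrite /conv tsum_exch tsum.unlock => e; apply: etrans e _.
  exact: esym (eps_mH hH hG hGi false false x y).
Qed.

(** The products are variables with equations because they equal the m_ij only extensionally;
    substituting them changes all the structures at once. *)
Theorem hop_main (fL fP fH : H -> H -> H) :
  fL = m false false -> fP = m false true -> fH = m true true ->
  [/\ is_biGalois (hop fL) (hop fH) (ber fP) cop cop,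
      left_cleft (hop fL) (ber fP) cop,
      right_anticleft (hop fH) (ber fP) cop &
      is_2cocycle (hop fL) Gi /\ is_cocycle_inverse (hop fL) Gi G].
Proof.
move=> -> -> ->; split.
- exact: hop_biGalois.
- exact: hop_left_cleft.
- exact: hop_right_anticleft.
- by split; [exact: hop_2cocycle|exact: hop_cocycle_inverse].
Qed.

End Main.

Theorem corollary4p18 (k : fieldType) (B : algType k) (H : hopfdata B)
    (hH : is_hopf_algebroid H) (Gamma Gammai : H -> H -> B)
    (hGamma : is_2cocycle H Gamma)
    (hGammai : is_cocycle_inverse H Gamma Gammai) :
  [/\ is_biGalois (twist H Gamma Gammai) H (cocycle_alg H Gamma)
        (@cop k B H) (@cop k B H),
      left_cleft (twist H Gamma Gammai) (cocycle_alg H Gamma) (@cop k B H),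
      right_anticleft H (cocycle_alg H Gamma) (@cop k B H),
      is_2cocycle (twist H Gamma Gammai) Gammai /\
      is_cocycle_inverse (twist H Gamma Gammai) Gammai Gamma &
      twist (twist H Gamma Gammai) Gammai Gamma = H].
Proof.
(* With H an explicit record, the twice twisted data and H agree field by field except for the
   product, so their equality reduces to that of two functions. *)
case: H hH Gamma Gammai hGamma hGammai => [[V mul one s t a b] d e] hH G Gi hG hGi.
have [hb hl hr] := hH.
set H := HopfData _ _ in hH G Gi hG hGi hb hl hr *.
have eL : @bmul _ _ (twist H G Gi) = mH G Gi false false.
  apply/funext => x; apply/funext => y; exact: esym (mH_L hb G Gi x y).
have eP : @bmul _ _ (cocycle_alg H G) = mH G Gi false true.
  apply/funext => x; apply/funext => y; exact: esym (mH_P hb hG hGi x y).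
have eH : @bmul _ _ H = mH G Gi true true.
  apply/funext => x; apply/funext => y; exact: esym (mH_H hb hG hGi x y).
have [h1 h2 h3 h4] := hop_main hb hG hGi hl hr eL eP eH.
split; [exact: h1|exact: h2|exact: h3|exact: h4|].
have eT : @bmul _ _ (twist (twist H G Gi) Gi G) = mul.
  apply/funext => x; apply/funext => y; rewrite [RHS](twist_twist_mul hb hG hGi x y).
  by rewrite -eL.
pose f := bmul (b := twist (twist H G Gi) Gi G).
by rewrite -[LHS]/(HopfData (hring := BeRng f one s t a b) d e) /f eT.
Qed.
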